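(* Let $p\in(0,1)$ be a fixed constant and let $G(n,p)$ be the binomial random graph on vertex set $\{1,\ldots,n\}$. Let $e(k)$, $k\in\mathbb{N}$, be a sequence of non-negative integers with $e(k)={k\choose 2}p+O(k)$. Let $\mathcal{X}_n(e)$ denote the maximum $k$ such that $G(n,p)$ has an induced subgraph with exactly $k$ vertices and exactly $e(k)$ edges. \begin{enumerate} \item[(i)] There exists $t>0$ such that, for all $c>t$ and $C>2c+t$, $$0<\liminf_{n\to\infty}{\sf P}\left(n-C\sqrt{\tfrac{n}{\ln n}}<\mathcal{X}_n(e)<n-c\sqrt{\tfrac{n}{\ln n}}\right)\leq\limsup_{n\to\infty}{\sf P}\left(n-C\sqrt{\tfrac{n}{\ln n}}<\mathcal{X}_n(e)<n-c\sqrt{\tfrac{n}{\ln n}}\right)<1.$$ \item[(ii)] Suppose that, for every sequence $m_k=O(\sqrt{k/\ln k})$ of non-negative integers, the smoothness condition $$\left|\left(e(k)-{k\choose 2}p\right)-\left(e(k-m_k)-{k-m_k\choose 2}p\right)\right|=o(k)$$ holds. Then, for every $\varepsilon>0$, there exist $c,C$ such that $$\liminf_{n\to\infty}{\sf P}\left(n-C\sqrt{\tfrac{n}{\ln n}}<\mathcal{X}_n(e)<n-c\sqrt{\tfrac{n}{\ln n}}\right)>1-\varepsilon.$$ \end{enumerate}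
   Context: $G(n,p)$ is the random graph on $n$ vertices in which each of the ${n\choose 2}$ possible edges is present independently with probability $p$. An induced subgraph on $k$ vertices means the subgraph induced by some $k$-element subset of the vertex set. Asymptotic notation refers to $k\to\infty$ (or $n\to\infty$). *)

(* Defs.v *)
From mathcomp Require Import all_boot all_order all_algebra.
From mathcomp Require Import all_classical all_reals all_analysis.

Set Implicit Arguments.
Unset Strict Implicit.
Unset Printing Implicit Defensive.

Import Order.TTheory GRing.Theory Num.Theory.

Local Open Scope ring_scope.

Definition edge (n : nat) : finType := {f : {set 'I_n} | #|f| == 2%N}.

(* A simple graph on n labelled vertices is identified with its edge set. *)
Definition graph (n : nat) : finType := {set (edge n)}.

Definition induced_edges (n : nat) (G : graph n) (S : {set 'I_n}) :
    {set (edge n)} :=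
  finset (fun f : edge n => (f \in G) && (val f \subset S)).

Definition has_induced (n : nat) (G : graph n) (k m : nat) : bool :=
  [exists S : {set 'I_n}, (#|S| == k) && (#|induced_edges G S| == m)].

(* The value is 0 when no k qualifies. *)
Definition max_induced (e : nat -> nat) (n : nat) (G : graph n) : nat :=
  (\max_(k < n.+1 | has_induced G k (e k)) k)%N.

Definition Gnp_mass (R : realType) (p : R) (n : nat) (G : graph n) : R :=
  \prod_(f : edge n) (if f \in G then p else 1 - p).

Definition Gnp_prob (R : realType) (p : R) (n : nat) (A : pred (graph n)) : R :=
  \sum_(G : graph n | A G) Gnp_mass p G.

Definition scale (R : realType) (n : nat) : R := Num.sqrt (n%:R / ln n%:R).

Definition deviation (R : realType) (p : R) (e : nat -> nat) (k : nat) : R :=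
  (e k)%:R - 'C(k, 2)%:R * p.

Definition window_prob (R : realType) (p : R) (e : nat -> nat) (c C : R)
    (n : nat) : R :=
  Gnp_prob p (fun G : graph n =>
    n%:R - C * scale R n < (max_induced e G)%:R < n%:R - c * scale R n).

(* Main.v *)
(**
Write q = p(1-p), D for the number of edges of G(n,p) minus its mean, and
dev(k) = e(k) - p C(k,2).  If U is the complement of a k-set and m = |U|, then

  e(G - U) - p C(k,2) = D - sum_{u in U} (deg u - p(n-1)) + e(U) - p C(m,2),

and for m = O(sqrt(n/ln n)) the last two terms are o(n).  So one has to remove
vertices whose degree deviations sum to D - dev(k) up to o(n), and then hit the
exact value.  D is of order n, by local bounds for the binomial law.

Upper bound on X_n.  A first moment bound on sum_u (|deg u - p(n-1)| - T)_+ with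
T = a sqrt(n ln n), a^2 > (4/3) q, shows that with high probability no set of m
vertices has degree deviations summing to more than m T + o(n).  So if
|D - dev(k)| > (a c + o(1)) n for all k >= n - c sqrt(n/ln n), then
X_n < n - c sqrt(n/ln n).

Lower bound on X_n.  Split off pairs (x, x') of vertices from a set Y of almost
all vertices, and resample G by exchanging the edges xy and x'y for the y in a
random subset of Y.  This preserves the law of G and all the sums deg x + deg x',
and makes deg x a shifted Bin(h,1/2), independently for distinct pairs, with
h close to 2 q |Y|.  Some pairs ("coarse") yield more than sqrt(n/ln n) pairs
whose degrees deviate by +-b sqrt(n ln n).  Exchanging partners one at a time
moves the sum of the removed degrees through the target with half-steps of about
b sqrt(n ln n).  The remaining error is then corrected exactly by the choice of
one last removed vertex among other ("fine") pairs: each of them has the degree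
needed with probability of order at least n^{-0.98}, and there are order n of
them.

Both steps work for b^2 close to q/3, so a = 2b is possible; this is where the
factor 2 in C > 2c + t is used.  The values a = (22/19) sqrt q and
b = (11/19) sqrt q will do.
*)

Require Import Defs.
From mathcomp Require Import all_boot all_order all_algebra.
From mathcomp Require Import all_classical all_reals all_analysis.
From mathcomp Require Import ring lra zify.

Set Implicit Arguments.
Unset Strict Implicit.
Unset Printing Implicit Defensive.

Import Order.TTheory GRing.Theory Num.Theory.
Import numFieldNormedType.Exports.

Local Open Scope ring_scope.

(** Degrees are dependent and the number of edges has to be exact; the exchange of neighbours turns
    this into independent fair coins tossed over a frozen background. Edges inside the paired
    vertices are never exchanged, so the edges inside a removed set stay put while the coins are
    tossed, and only single degrees move. The price is a factor sqrt 2: freezing deg x + deg x'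
    leaves half of the variance q n of a degree. With sharp Gaussian exponents the upper bound would
    work for a down to sqrt q, and the exchange for b up to sqrt(q/2). This ratio sqrt 2 is below
    the 2 allowed in C > 2c + t, and the room is spent on elementary estimates: 2/3 instead of 1/2
    in the exponential moments asks for a^2 > (4/3) q, while 3/5 instead of 1/2 in the binomial
    lower bounds still admits b^2 slightly above q/3. *)

Lemma expR_le_quad (R : realType) (x : R) : `|x| <= 1 / 100 ->
  expR x <= 1 + x + 2 / 3 * x ^+ 2.
Proof.
move=> hx.
have xQ (Q : R) : `|Q| <= 1 -> `|x * Q| <= 1 / 100.
  by move=> hQ; rewrite normrM -[leRHS]mulr1 ler_pM.
have bd (c Q : R) : `|c| <= 1 / 2 -> `|Q| <= 1 / 100 -> `|c + Q| <= 1.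
  by move=> hc hQ; apply: le_trans (ler_normD _ _) _; lra.
have cst (a b : R) : 0 < b -> - (b / 2) <= a <= b / 2 -> `|a / b| <= 1 / 2.
  move=> b0; rewrite normrM normfV (gtr0_norm b0) ler_pdivrMr// ler_norml.
  by move=> /andP[? ?]; apply/andP; split; lra.
(* exp (- x) >= (1 - x/4)^4 reduces the claim to a polynomial inequality. *)
have h6 : 1 <= (1 - x / 4) ^+ 4 * (1 + x + 2 / 3 * x ^+ 2).
  set Q := x * (- 17 / 48 + x * (49 / 256 + x * (- 29 / 768 + x * (2 / 768)))).
  have -> : (1 - x / 4) ^+ 4 * (1 + x + 2 / 3 * x ^+ 2) =
     1 + x ^+ 2 * (1 / 24 + Q) by rewrite /Q; field.
  have : `|Q| <= 1 / 100.
    apply/xQ/bd; first by apply: cst; lra.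
    apply/xQ/bd; first by apply: cst; lra.
    apply/xQ/bd; first by apply: cst; lra.
    apply/xQ; apply: (@le_trans _ _ (1 / 2)); [apply: cst; lra|lra].
  rewrite ler_norml => /andP[hQ _].
  by rewrite lerDl mulr_ge0 ?sqr_ge0//; lra.
move: hx; rewrite ler_norml => /andP[h1 h2].
have h4 : 0 <= 1 - x / 4 by lra.
have h5 : (1 - x / 4) ^+ 4 <= expR (- x).
  have -> : - x = 4%:R * (- (x / 4)) by field.
  rewrite expRM_natl lerXn2r// ?nnegrE ?expR_ge0//.
  exact: expR_ge1Dx.
have h8 : 0 <= 1 + x + 2 / 3 * x ^+ 2.
  by have := sqr_ge0 x; move: h1 (x ^+ 2) => {}h1 y; lra.
rewrite -[leLHS]mulr1 -ler_pdivlMl ?expR_gt0// -expRN.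
by apply: le_trans h6 _; rewrite ler_wpM2r.
Qed.

(** * Binomial probabilities *)

(** The linear terms cancel because the variable is centred, and the quadratic ones add up to its
    variance. The factor 2/3, where the Gaussian one is 1/2, is the source of the threshold a^2 >
    (4/3) q. *)
Lemma bern_mgf (R : realType) (p l : R) : 0 < p < 1 -> `|l| <= 1 / 100 ->
  p * expR (l * (1 - p)) + (1 - p) * expR (- l * p) <=
  expR (2 / 3 * l ^+ 2 * (p * (1 - p))).
Proof.
move=> /andP[p0 p1] hl.
have e1 : expR (l * (1 - p)) <= 1 + l * (1 - p) + 2 / 3 * (l * (1 - p)) ^+ 2.
  apply: expR_le_quad; rewrite normrM (@ger0_norm _ (1 - p)) ?subr_ge0 ?(ltW p1)//.
  by apply: le_trans hl; rewrite ler_piMr//; lra.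
have e2 : expR (- l * p) <= 1 + - l * p + 2 / 3 * (- l * p) ^+ 2.
  apply: expR_le_quad; rewrite normrM normrN (ger0_norm (ltW p0)).
  by apply: le_trans hl; rewrite ler_piMr// (ltW p1).
apply: le_trans (expR_ge1Dx _).
apply: (@le_trans _ _ (p * (1 + l * (1 - p) + 2 / 3 * (l * (1 - p)) ^+ 2) +
   (1 - p) * (1 + - l * p + 2 / 3 * (- l * p) ^+ 2))).
  by apply: lerD; rewrite ler_wpM2l//; lra.
rewrite le_eqVlt; apply/orP; left; apply/eqP; by field.
Qed.

Definition binp (R : realType) (p : R) (N j : nat) : R :=
  'C(N, j)%:R * p ^+ j * (1 - p) ^+ (N - j).

Lemma binp_ge0 (R : realType) (p : R) N j : 0 < p < 1 -> 0 <= binp p N j.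
Proof.
by case/andP=> p0 p1; rewrite !mulr_ge0 ?exprn_ge0 ?ler0n ?subr_ge0 ?ltW.
Qed.

Lemma binp_sym (R : realType) (p : R) N j : (j <= N)%N ->
  binp (1 - p) N (N - j) = binp p N j.
Proof.
move=> jN; rewrite /binp bin_sub// subKn// (_ : 1 - (1 - p) = p); last by ring.
by rewrite mulrAC.
Qed.

Lemma binp_sum_expR (R : realType) (p l : R) N :
  \sum_(j < N.+1) binp p N j * expR (l * (j%:R - N%:R * p)) =
  (p * expR (l * (1 - p)) + (1 - p) * expR (- l * p)) ^+ N.
Proof.
rewrite addrC exprDn; apply: eq_bigr => -[j jN] _ /=.
rewrite /binp -mulr_natr !exprMn -!expRM_natl.
have -> : l * (j%:R - N%:R * p) =
   (N - j)%:R * (- l * p) + j%:R * (l * (1 - p)).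
  by rewrite natrB//; ring.
by rewrite expRD; ring.
Qed.

Lemma binp_sum1 (R : realType) (p : R) N : \sum_(j < N.+1) binp p N j = 1.
Proof.
have := binp_sum_expR p 0 N; rewrite !mul0r oppr0 mul0r expR0 !mulr1.
rewrite (_ : p + (1 - p) = 1); last by ring.
rewrite expr1n => <-; apply: eq_bigr => j _.
by rewrite mul0r expR0 mulr1.
Qed.

Lemma binpS (R : realType) (p : R) N j : (j < N)%N ->
  binp p N j.+1 * (j.+1%:R * (1 - p)) = binp p N j * ((N - j)%:R * p).
Proof.
move=> jN; rewrite /binp.
have -> : (1 - p) ^+ (N - j) = (1 - p) ^+ (N - j.+1) * (1 - p).
  by rewrite -exprSr subnSK.
have := mul_bin_left N j => /(congr1 (fun x : nat => x%:R : R)).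
rewrite !natrM exprSr => h.
transitivity (j.+1%:R * 'C(N, j.+1)%:R *
  (p ^+ j * p * (1 - p) ^+ (N - j.+1) * (1 - p))); first by ring.
by rewrite h; ring.
Qed.

Section binomial_mode.
Variables (R : realType) (p : R).
Hypothesis hp : 0 < p < 1.

Lemma binp_incr N j : j.+1%:R <= N.+1%:R * p -> binp p N j <= binp p N j.+1.
Proof.
case/andP: (hp) => p0 p1 h.
have jN : (j < N)%N.
  rewrite -ltnS -(ltr_nat R); apply: le_lt_trans h _.
  by rewrite -[ltRHS]mulr1 ltr_pM2l ?ltr0n.
have h0 : 0 < j.+1%:R * (1 - p) by rewrite mulr_gt0 ?ltr0n ?subr_gt0.
rewrite -(ler_pM2r h0) binpS// ler_wpM2l ?binp_ge0//.
by rewrite natrB ?(ltnW jN)//; move: h; rewrite -!natr1; lra.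
Qed.

Lemma binp_decr N j : N.+1%:R * p <= j.+1%:R -> binp p N j.+1 <= binp p N j.
Proof.
case/andP: (hp) => p0 p1 h.
case: (ltnP j N) => jN; last first.
  by rewrite {1}/binp bin_small ?ltnS// !mul0r binp_ge0.
have h0 : 0 < j.+1%:R * (1 - p) by rewrite mulr_gt0 ?ltr0n ?subr_gt0.
rewrite -(ler_pM2r h0) binpS// ler_wpM2l ?binp_ge0//.
by rewrite natrB ?(ltnW jN)//; move: h; rewrite -!natr1; lra.
Qed.

(** By [binpS] the ratio of consecutive terms crosses 1 at j + 1 = (N + 1) p, which locates the
    mode. *)
Lemma binp_max N j : binp p N j <= binp p N (Num.trunc (N.+1%:R * p)).
Proof.
case/andP: (hp) => p0 p1.
set m := Num.trunc _.
have /andP[m1 m2] : m%:R <= N.+1%:R * p < m.+1%:R.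
  by rewrite truncn_itv// mulr_ge0 ?ler0n ?ltW.
case: (leqP j m) => [jm|/ltnW mj].
  have : forall i, (i <= m)%N -> binp p N (m - i) <= binp p N m.
    elim=> [|i IH] im; first by rewrite subn0.
    apply: le_trans (IH (ltnW im)); rewrite -(subnSK im).
    apply: binp_incr; apply: le_trans m1.
    by rewrite ler_nat subnSK// leq_subr.
  by move=> /(_ _ (leq_subr j m)); rewrite subKn.
have : forall i, binp p N (m + i) <= binp p N m.
  elim=> [|i IH]; first by rewrite addn0.
  apply: le_trans IH; rewrite addnS; apply: binp_decr.
  by apply: ltW; apply: lt_le_trans m2 _; rewrite ler_nat ltnS leq_addr.
by move=> /(_ (j - m)%N); rewrite subnKC.
Qed.

(** A converse to 1 - x <= exp (- x) at the cost of 6/5; half of this 6/5 is the 3/5 in the binomial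
    lower bounds. *)
Lemma expRN_le (x : R) : 0 <= x <= 1 / 6 -> expR (- (6 / 5 * x)) <= 1 - x.
Proof.
move=> /andP[x0 x1].
have h1 : 1 + 6/5 * x <= expR (6/5 * x) by exact: expR_ge1Dx.
have h2 : expR (6/5 * x) * expR (- (6/5 * x)) = 1.
  by rewrite expRN divff// gt_eqF ?expR_gt0.
have h3 := expR_gt0 (6/5 * x).
have h4 := expR_gt0 (- (6/5 * x)).
rewrite -(ler_pM2l h3) h2.
apply: (@le_trans _ _ ((1 + 6 / 5 * x) * (1 - x))); first nra.
by rewrite ler_wpM2r//; lra.
Qed.

(** With u = (i + 1)/(N + 1), the ratio of the terms at distances i + 1 and i from the mode is at
    least (1 - u/(1-p)) / (1 + u/p), hence at least exp (- (6/5) u / (p (1-p))). These exponents sum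
    to (3/5) i (i + 1). *)
Lemma binp_right N i : i%:R <= N.+1%:R * (p * (1 - p)) / 6 ->
  binp p N (Num.trunc (N.+1%:R * p)) *
    expR (- (3 / 5 * (i%:R * (i%:R + 1)) / (p * (1 - p) * N.+1%:R))) <=
  binp p N (Num.trunc (N.+1%:R * p) + i).
Proof.
case/andP: (hp) => p0 p1.
set m := Num.trunc _.
have /andP[m1 m2] : m%:R <= N.+1%:R * p < m.+1%:R.
  by rewrite truncn_itv// mulr_ge0 ?ler0n ?ltW.
have q0 : 0 < 1 - p by lra.
have N0 : (0 : R) < N.+1%:R by rewrite ltr0n.
elim: i => [|i IH] hi.
  by rewrite addn0 mul0r mulr0 mul0r oppr0 expR0 mulr1.
have hi' : i%:R <= N.+1%:R * (p * (1 - p)) / 6.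
  by apply: le_trans hi; rewrite ler_nat.
have {}IH := IH hi'.
set u := i.+1%:R / N.+1%:R : R.
have uE : u * N.+1%:R = i.+1%:R by rewrite /u divfK ?gt_eqF.
have u0 : 0 < u by rewrite /u divr_gt0 ?ltr0n.
have u1 : u <= p * (1 - p) / 6.
  by rewrite /u ler_pdivrMr//; move: hi; lra.
have uq : u / (1 - p) <= 1/6.
  by rewrite ler_pdivrMr//; nra.
have miN : (m + i < N)%N.
  rewrite -(ltr_nat R) natrD.
  have : m%:R + i.+1%:R < N.+1%:R :> R.
    apply: (@lt_le_trans _ _ (N.+1%:R * p + N.+1%:R * (1 - p))); last first.
      by rewrite -mulrDr addrC subrK mulr1.
    apply: ler_ltD => //; apply: le_lt_trans hi _.
    rewrite -mulrA ltr_pM2l//; nra.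
  by rewrite -!natr1; lra.
have h0 : 0 < (m + i).+1%:R * (1 - p) by rewrite mulr_gt0 ?ltr0n.
rewrite addnS -(ler_pM2r h0) binpS//.
set E := expR _.
set E0 := expR _ in IH.
have EE : E = E0 * expR (- (6 / 5 * u / (p * (1 - p)))).
  rewrite /E /E0 -expRD; congr expR.
  by rewrite /u -(natr1 i); field; rewrite ?natr1 !gt_eqF.
rewrite EE.
have : expR (- (6 / 5 * u / (p * (1 - p)))) * ((m + i).+1%:R * (1 - p)) <=
   (N - (m + i))%:R * p.
  have -> : 6 / 5 * u / (p * (1 - p)) = 6/5 * (u / (1 - p)) + 6/5 * (u / p).
    by field; rewrite !gt_eqF.
  rewrite opprD expRD.
  have h1 : expR (- (6 / 5 * (u / (1 - p)))) <= 1 - u / (1 - p).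
    by apply: expRN_le; rewrite uq andbT divr_ge0 ?ltW.
  have h2 : expR (- (6 / 5 * (u / p))) * (1 + u / p) <= 1.
    have h3 := expR_ge1Dx (6 / 5 * (u / p)).
    have h2 : expR (6/5 * (u / p)) * expR (- (6/5 * (u / p))) = 1.
      by rewrite expRN divff// gt_eqF ?expR_gt0.
    rewrite -[leRHS]h2 mulrC ler_wpM2r ?expR_ge0//.
    by apply: le_trans h3; have : 0 < u / p by [rewrite divr_gt0]; lra.
  have h4 : (m + i).+1%:R <= N.+1%:R * p * (1 + u / p).
    have -> : N.+1%:R * p * (1 + u / p) = N.+1%:R * p + u * N.+1%:R by field; rewrite gt_eqF.
    by rewrite uE -addnS natrD lerD2r.
  have h5 : N.+1%:R * (1 - p) * (1 - u / (1 - p)) <= (N - (m + i))%:R.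
    have -> : N.+1%:R * (1 - p) * (1 - u / (1 - p)) = N.+1%:R - N.+1%:R * p - u * N.+1%:R.
      by field; rewrite gt_eqF.
    rewrite uE natrB ?(ltnW miN)// natrD -!natr1 in m1 m2 *; lra.
  set A := expR _ in h1 *; set B := expR _ in h2 *.
  have A0 : 0 <= A by exact: expR_ge0.
  have B0 : 0 <= B by exact: expR_ge0.
  have -> : A * B * ((m + i).+1%:R * (1 - p)) = (A * (1 - p)) * (B * (m + i).+1%:R) by ring.
  apply: (@le_trans _ _ ((A * (1 - p)) * (N.+1%:R * p))).
    rewrite ler_wpM2l ?mulr_ge0 ?(ltW q0)//.
    apply: (@le_trans _ _ (B * (N.+1%:R * p * (1 + u / p)))).
      by rewrite ler_wpM2l.
    rewrite mulrCA -[leRHS]mulr1 ler_wpM2l// mulr_ge0 ?ltW//.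
  apply: (@le_trans _ _ ((N.+1%:R * (1 - p) * (1 - u / (1 - p))) * p)).
    have -> : A * (1 - p) * (N.+1%:R * p) = A * ((N.+1%:R * (1 - p)) * p) by ring.
    have -> : N.+1%:R * (1 - p) * (1 - u / (1 - p)) * p =
        (1 - u / (1 - p)) * ((N.+1%:R * (1 - p)) * p) by ring.
    by rewrite ler_wpM2r// !mulr_ge0 ?ltW.
  by rewrite ler_wpM2r// ltW.
move=> h.
rewrite [leLHS](_ : _ = (binp p N m * E0) *
  (expR (- (6 / 5 * u / (p * (1 - p)))) * ((m + i).+1%:R * (1 - p)))); last by ring.
apply: ler_pM => //.
- by rewrite mulr_ge0 ?binp_ge0 ?expR_ge0.
- by rewrite !mulr_ge0 ?expR_ge0 ?ler0n ?ltW.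
Qed.
End binomial_mode.

Lemma sum_indic_card (R : pzSemiRingType) (T : finType) (A : {set T}) :
  \sum_j ((j \in A)%:R : R) = #|A|%:R.
Proof.
rewrite -sum1_card natr_sum [RHS]big_mkcond; apply: eq_bigr => j _.
by case: ifP.
Qed.

Lemma card_itv_le (R : realType) (N : nat) (x y : R) : x <= y ->
  #|[set j : 'I_N | x <= (j : nat)%:R <= y]|%:R <= y - x + 1.
Proof.
move=> xy; set A := [set j | _].
case: (set_0Vmem A) => [->|[j0 j0A]].
  by rewrite cards0; lra.
case: (@arg_minnP _ j0 (mem A) (fun j : 'I_N => j : nat) j0A) => j1 j1A jmin.
pose f (j : 'I_N) : 'I_(Num.trunc (y - x)).+1 := inord (j - j1).
have yx0 : 0 <= y - x by lra.
have lt j : j \in A -> (j - j1 < (Num.trunc (y - x)).+1)%N.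
  move=> jA; have := jA; have := j1A; rewrite !inE => /andP[h1 h2] /andP[h3 h4].
  by rewrite ltnS truncn_ge_nat// natrB ?jmin//; lra.
have finj : {in A &, injective f}.
  move=> i j iA jA /(congr1 val) /=; rewrite !inordK ?lt// => h.
  have := jmin _ iA; have := jmin _ jA => h1 h2.
  by apply: val_inj => /=; rewrite -(subnK h2) h subnK.
rewrite -(card_in_imset finj).
apply: (@le_trans _ _ (Num.trunc (y - x)).+1%:R).
  by rewrite ler_nat; apply: leq_trans (max_card _) _; rewrite card_ord.
by rewrite -(natr1 (Num.trunc _)) lerD2r truncn_le.
Qed.

Lemma card_itv_ge (R : realType) (N : nat) (x y : R) : 0 <= x -> y <= N%:R ->
  y - x - 1 <= #|[set j : 'I_N.+1 | x <= (j : nat)%:R <= y]|%:R.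
Proof.
move=> x0 yN; set A := [set j | _].
set a := (Num.trunc x).+1.
have /andP[ax xa] : (Num.trunc x)%:R <= x < a%:R by exact: truncn_itv.
have ax1 : a%:R <= x + 1 by rewrite /a -natr1 lerD2r.
case: (ltrP y a%:R) => ya.
  by apply: (@le_trans _ _ 0); [lra|rewrite ler0n].
have ya0 : 0 <= y - a%:R by lra.
set k := (Num.trunc (y - a%:R)).+1.
have kE : y - a%:R < k%:R by exact: truncnS_gt.
have iy (i : 'I_k) : (a + i)%:R <= y.
  have : (i <= Num.trunc (y - a%:R))%N by rewrite -ltnS.
  by rewrite natrD truncn_ge_nat//; lra.
have iN (i : 'I_k) : (a + i < N.+1)%N.
  by rewrite ltnS -(ler_nat R); apply: le_trans (iy i) yN.
pose f (i : 'I_k) : 'I_N.+1 := inord (a + i).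
have finj : injective f.
  move=> i j /(congr1 val) /=; rewrite !inordK// => /addnI h.
  exact: val_inj.
apply: (@le_trans _ _ k%:R); first lra.
rewrite ler_nat -[X in (X <= _)%N]card_ord -(card_imset _ finj).
apply/subset_leq_card/fintype.subsetP => _ /imsetP[i _ ->].
rewrite inE inordK// iy andbT.
by apply: le_trans (ltW xa) _; rewrite ler_nat leq_addr.
Qed.

Section binomial_compare.
Variables (R : realType) (p : R).
Hypothesis hp : 0 < p < 1.

(** Recentres [binp_right] at the mean N p: mode and mean differ by less than 1, and bounding i (i +
    1) by a square costs 1 more, whence the + 2. *)
Lemma binp_compare_right N j : (Num.trunc (N.+1%:R * p) <= j <= N)%N ->
  `|j%:R - N%:R * p| + 2 <= N%:R * (p * (1 - p)) / 6 ->
  binp p N (Num.trunc (N.+1%:R * p)) *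
    expR (- (3 / 5 * (`|j%:R - N%:R * p| + 2) ^+ 2 / (p * (1 - p) * N%:R))) <=
  binp p N j.
Proof.
case/andP: (hp) => p0 p1 /andP[mj jN] hd.
move: mj; set m := Num.trunc _ => mj.
have /andP[m1 m2] : m%:R <= N.+1%:R * p < m.+1%:R.
  by rewrite truncn_itv// mulr_ge0 ?ler0n ?(ltW p0).
have q0 : 0 < p * (1 - p) by apply: mulr_gt0; lra.
set d : R := `|_| in hd *.
have d1 : j%:R - N%:R * p <= d by rewrite ler_norm.
have d0 : 0 <= d by exact: normr_ge0.
clearbody d.
have N0 : 0 < N%:R :> R.
  by rewrite -(pmulr_lgt0 _ q0); lra.
have id : (j - m)%:R <= d + 1.
  by rewrite natrB//; move: m2; rewrite -(natr1 N) -(natr1 m); lra.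
have hi : (j - m)%:R <= N.+1%:R * (p * (1 - p)) / 6.
  by apply: le_trans id _; rewrite -(natr1 N); move: hd q0; clear; move: (p * _) => z; lra.
have := binp_right hp hi; rewrite -/m (subnKC mj).
apply: le_trans; rewrite ler_wpM2l ?binp_ge0// ler_expR lerN2.
have qN : 0 < p * (1 - p) * N%:R by rewrite mulr_gt0.
have qN1 : 0 < p * (1 - p) * N.+1%:R by rewrite mulr_gt0 ?ltr0n.
have i0 : 0 <= (j - m)%:R :> R by rewrite ler0n.
apply: (@le_trans _ _ (3 / 5 * (d + 2) ^+ 2 / (p * (1 - p) * N.+1%:R))).
  rewrite ler_wpM2r ?invr_ge0 ?(ltW qN1)//.
  have h35 : 0 <= 3 / 5 :> R by lra.
  rewrite ler_wpM2l// expr2; apply: ler_pM => //; lra.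
rewrite ler_wpM2l//; first by rewrite mulr_ge0 ?sqr_ge0//; lra.
by rewrite lef_pV2// ler_pM2l// ler_nat.
Qed.
End binomial_compare.

Section binomial_bounds.
Variables (R : realType) (p : R).
Hypothesis hp : 0 < p < 1.

(** Values left of the mode are reflected to the right by exchanging p with 1 - p and j with N -
    j. *)
Lemma binp_compare N j j0 : (j <= N)%N ->
  `|j%:R - N%:R * p| + 2 <= N%:R * (p * (1 - p)) / 6 ->
  binp p N j0 *
    expR (- (3 / 5 * (`|j%:R - N%:R * p| + 2) ^+ 2 / (p * (1 - p) * N%:R))) <=
  binp p N j.
Proof.
move=> jN hd; case/andP: (hp) => p0 p1.
set m := Num.trunc (N.+1%:R * p).
have /andP[m1 m2] : m%:R <= N.+1%:R * p < m.+1%:R.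
  by rewrite truncn_itv// mulr_ge0 ?ler0n ?(ltW p0).
case: (leqP m j) => mj.
  apply: le_trans (binp_compare_right hp _ hd); last by rewrite mj.
  by rewrite ler_wpM2r ?expR_ge0// binp_max.
case: (leqP j0 N) => j0N; last first.
  by rewrite {1}/binp bin_small// !mul0r binp_ge0.
have hq : 0 < 1 - p < 1 by apply/andP; split; lra.
have hdq : `|(N - j)%:R - N%:R * (1 - p)| = `|j%:R - N%:R * p|.
  by rewrite -normrN natrB//; congr `|_|; ring.
have qE : (1 - p) * (1 - (1 - p)) = p * (1 - p) by ring.
have := @binp_compare_right R (1 - p) hq N (N - j).
rewrite hdq qE binp_sym// => /(_ _ hd) h.
apply: le_trans (h _) => //.
  rewrite ler_wpM2r ?expR_ge0//.
  by rewrite -(binp_sym p j0N) binp_max.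
rewrite leq_subr andbT.
rewrite -ltnS truncn_lt_nat ?mulr_ge0 ?ler0n//; last by lra.
rewrite -(natr1 (N - j)) natrB//.
have : j.+1%:R <= m%:R :> R by rewrite ler_nat.
by move: m1; rewrite -(natr1 N) -(natr1 j); lra.
Qed.

(** Exponential moments at l = 1/sqrt N and l = - 1/sqrt N leave mass at most 2 e^{-3} <= 1/2 beyond
    distance 4 sqrt N from the mean. The other half of the mass sits on at most 8 sqrt N + 1 <= 9
    sqrt N values, none of which exceeds the mode. *)
Lemma binp_mode_ge N : (10000 <= N)%N ->
  (18 * Num.sqrt N%:R)^-1 <= binp p N (Num.trunc (N.+1%:R * p)).
Proof.
move=> hN; case/andP: (hp) => p0 p1.
set s : R := Num.sqrt N%:R.
set F : R := binp p N _.
have sE : s ^+ 2 = N%:R by rewrite sqr_sqrtr ?ler0n.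
have s100 : 100 <= s.
  rewrite -(@ler_pXn2r _ 2) ?nnegrE ?sqrtr_ge0// sE.
  have : 10000%:R <= N%:R :> R by rewrite ler_nat.
  lra.
have s0 : 0 < s by lra.
have F0 : 0 <= F by rewrite binp_ge0.
have ls : `|s^-1| <= 1 / 100.
  rewrite ger0_norm ?invr_ge0 ?(ltW s0)// div1r lef_pV2 ?posrE//; lra.
have tail (l : R) : `|l| <= 1 / 100 -> l ^+ 2 * N%:R = 1 ->
    \sum_(j < N.+1) binp p N j * expR (l * (j%:R - N%:R * p)) <= expR 1.
  move=> hl l1; rewrite binp_sum_expR.
  apply: (@le_trans _ _ (expR (2 / 3 * l ^+ 2 * (p * (1 - p))) ^+ N)).
    rewrite lerXn2r ?nnegrE ?bern_mgf ?expR_ge0//.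
    by rewrite addr_ge0// mulr_ge0 ?expR_ge0//; lra.
  rewrite -expRM_natl ler_expR.
  rewrite (_ : _ * _ = (l ^+ 2 * N%:R) * (2 / 3 * (p * (1 - p)))); last by ring.
  rewrite l1 mul1r.
  have := sqr_ge0 (2 * p - 1); rewrite expr2; lra.
have l1 : s^-1 ^+ 2 * N%:R = 1 by rewrite -sE exprVn mulVf// gt_eqF// exprn_gt0.
have l2 : (- s^-1) ^+ 2 * N%:R = 1 by rewrite sqrrN.
have pt (j : 'I_N.+1) : binp p N j <=
    F * (j \in [set j : 'I_N.+1 | N%:R * p - 4 * s <= j%:R <= N%:R * p + 4 * s])%:R +
    (binp p N j * expR (s^-1 * (j%:R - N%:R * p)) +
     binp p N j * expR (- s^-1 * (j%:R - N%:R * p))) * expR (- 4).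
  rewrite inE; case: (boolP (_ <= _ <= _)) => h.
    apply: le_trans (binp_max hp N j) _; rewrite mulr1 lerDl mulr_ge0 ?expR_ge0//.
    by rewrite addr_ge0// mulr_ge0 ?binp_ge0 ?expR_ge0.
  rewrite mulr0 add0r -mulrDr -mulrA ler_peMr ?binp_ge0//.
  rewrite mulrDl -!expRD.
  move: h; rewrite negb_and -!ltNge => /orP[h|h].
    apply: ler_wpDl; first exact: expR_ge0.
    rewrite -[leLHS]expR0 ler_expR.
    have : s^-1 * (j%:R - N%:R * p) <= s^-1 * (- 4 * s).
      by rewrite ler_wpM2l ?invr_ge0 ?(ltW s0)//; lra.
    rewrite (_ : s^-1 * (- 4 * s) = - 4); last by field; rewrite gt_eqF.
    by rewrite mulNr; move: (s^-1 * _) => z; lra.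
  apply: ler_wpDr; first exact: expR_ge0.
  rewrite -[leLHS]expR0 ler_expR.
  have : s^-1 * (4 * s) <= s^-1 * (j%:R - N%:R * p).
    by rewrite ler_wpM2l ?invr_ge0 ?(ltW s0)//; lra.
  rewrite (_ : s^-1 * (4 * s) = 4); last by field; rewrite gt_eqF.
  by move: (s^-1 * _) => z; lra.
have : 1 <= F * (8 * s + 1) + (expR 1 + expR 1) * expR (- 4).
  rewrite -[leLHS](binp_sum1 p N).
  apply: le_trans (ler_sum _ (fun j _ => pt j)) _.
  rewrite big_split/= -mulr_sumr -mulr_suml; apply: lerD.
    rewrite ler_wpM2l//.
    rewrite sum_indic_card.
    by apply: le_trans (card_itv_le _ _) _; lra.
  rewrite ler_wpM2r ?expR_ge0// big_split/= lerD//; apply: tail => //.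
  by rewrite normrN.
rewrite (mulrDl (expR 1)) -expRD.
have e3 : expR (1 + - 4) <= 1 / 4 :> R.
  rewrite (_ : 1 + - 4 = - 3); last by ring.
  rewrite expRN div1r lef_pV2 ?posrE ?expR_gt0//.
  by apply: le_trans (expR_ge1Dx _); lra.
move=> h.
rewrite -[leLHS]mul1r ler_pdivrMr ?mulr_gt0//.
have : F * (8 * s + 1) <= F * (9 * s) by rewrite ler_wpM2l//; lra.
lra.
Qed.

Lemma binp_lower N j : (10000 <= N)%N -> (j <= N)%N ->
  `|j%:R - N%:R * p| + 2 <= N%:R * (p * (1 - p)) / 6 ->
  (18 * Num.sqrt N%:R)^-1 *
    expR (- (3 / 5 * (`|j%:R - N%:R * p| + 2) ^+ 2 / (p * (1 - p) * N%:R))) <=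
  binp p N j.
Proof.
move=> hN jN hd; apply: le_trans (binp_compare _ jN hd).
by rewrite ler_wpM2r ?expR_ge0//; apply: binp_mode_ge.
Qed.

(** At least sqrt N values lie within sqrt N of the mean, and by [binp_compare] each of them has at
    least a constant fraction of the probability of j0; all of them together have at most 1. *)
Lemma binp_upper N j0 : 18 / (p * (1 - p)) <= Num.sqrt N%:R ->
  binp p N j0 <= expR (6 / (p * (1 - p))) / Num.sqrt N%:R.
Proof.
case/andP: (hp) => p0 p1; set s : R := Num.sqrt _ => hs.
have sE : s ^+ 2 = N%:R by rewrite sqr_sqrtr ?ler0n.
have pq0 : 0 < p * (1 - p) by apply: mulr_gt0; lra.
have pq1 : p * (1 - p) < 1 by nra.
have hs' : 18 <= s * (p * (1 - p)) by rewrite -ler_pdivrMr.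
have s18 : 18 <= s.
  by apply: le_trans hs' _; rewrite ler_piMr ?sqrtr_ge0// (ltW pq1).
have s0 : 0 < s by lra.
have sp : 18 <= s * p by nra.
have sq : 18 <= s * (1 - p) by nra.
rewrite ler_pdivlMr//.
set E := expR _.
have E0 : 0 < E by exact: expR_gt0.
set A := [set j : 'I_N.+1 | N%:R * p - s <= j%:R <= N%:R * p + s].
have cA : s <= #|A|%:R.
  apply: (@le_trans _ _ ((N%:R * p + s) - (N%:R * p - s) - 1)); first lra.
  apply: card_itv_ge; rewrite -sE; nra.
have ptA (j : 'I_N.+1) : j \in A -> binp p N j0 / E <= binp p N j.
  rewrite inE => /andP[h1 h2].
  have hd : `|j%:R - N%:R * p| <= s by rewrite ler_norml; apply/andP; split; lra.
  have hd2 : `|j%:R - N%:R * p| + 2 <= N%:R * (p * (1 - p)) / 6.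
    have : s * 18 <= s ^+ 2 * (p * (1 - p)).
      by rewrite expr2 -mulrA ler_wpM2l// (ltW s0).
    rewrite sE => h; apply: (@le_trans _ _ (s + 2)); first by rewrite lerD2r.
    by move: h; move: (N%:R * (p * (1 - p))) => z h; lra.
  have jN : (j <= N)%N by rewrite -ltnS.
  apply: le_trans (binp_compare j0 jN hd2).
  move: hd; set d : R := `|_| => hd.
  have d0 : 0 <= d by exact: normr_ge0.
  clearbody d.
  rewrite ler_wpM2l ?binp_ge0// /E -expRN ler_expR lerN2.
  rewrite ler_pdivrMr; last by rewrite mulr_gt0// -sE exprn_gt0.
  rewrite (mulrA (6 / _)) divfK ?gt_eqF// -sE.
  have : (d + 2) ^+ 2 <= (10 / 9 * s) ^+ 2.
    rewrite lerXn2r// ?nnegrE; lra.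
  rewrite exprMn; have := sqr_ge0 s; lra.
have : \sum_(j in A) (binp p N j0 / E) <= 1.
  rewrite -[leRHS](binp_sum1 p N).
  apply: le_trans (ler_sum _ ptA) _.
  rewrite [leRHS](bigID (mem A))/= lerDl sumr_ge0// => j _.
  exact: binp_ge0.
rewrite sumr_const -mulr_natr => h.
have b0 : 0 <= binp p N j0 / E by rewrite divr_ge0 ?binp_ge0 ?(ltW E0).
have : binp p N j0 / E * s <= 1.
  by apply: le_trans h; rewrite ler_wpM2l.
by rewrite mulrAC ler_pdivrMr// mul1r.
Qed.
End binomial_bounds.

(** * Expectations over the binomial random graph *)

Section expectation.
Variables (R : realType) (p : R).
Hypothesis hp : 0 < p < 1.
Variable n : nat.
Implicit Types (G : graph n) (A B : pred (graph n)) (F : graph n -> R).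

Definition Gnp_exp F : R := \sum_(G : graph n) Gnp_mass p G * F G.

Lemma Gnp_mass_ge0 G : 0 <= Gnp_mass p G.
Proof. by case/andP: hp => p0 p1; apply: prodr_ge0 => f _; case: ifP; lra. Qed.

Lemma Gnp_massE G :
  Gnp_mass p G = p ^+ #|G| * (1 - p) ^+ (#|edge n| - #|G|).
Proof.
rewrite /Gnp_mass (bigID (mem G))/=.
rewrite (eq_bigr (fun=> p)); last by move=> f ->.
rewrite prodr_const; congr (_ * _).
rewrite (eq_bigr (fun=> 1 - p)); last by move=> f /negbTE ->.
by rewrite prodr_const -(cardC (mem G)) addKn.
Qed.

Lemma Gnp_exp_prod (g : edge n -> bool -> R) :
  Gnp_exp (fun G => \prod_f g f (f \in G)) =
  \prod_f (p * g f true + (1 - p) * g f false).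
Proof.
rewrite bigA_distr; apply: eq_bigr => G _.
rewrite /Gnp_mass -big_split/=; apply: eq_bigr => f _.
by case: ifP.
Qed.

Lemma Gnp_mass_sum1 : \sum_(G : graph n) Gnp_mass p G = 1.
Proof.
rewrite -(bigA_distr _ _ (fun=> p) (fun=> 1 - p)) big1// => f _.
by rewrite /=; ring.
Qed.

Lemma Gnp_exp_cst (c : R) : Gnp_exp (fun=> c) = c.
Proof. by rewrite /Gnp_exp -mulr_suml Gnp_mass_sum1 mul1r. Qed.

Lemma le_Gnp_exp F F' : (forall G, F G <= F' G) -> Gnp_exp F <= Gnp_exp F'.
Proof. by move=> h; apply: ler_sum => G _; rewrite ler_wpM2l ?Gnp_mass_ge0. Qed.

Lemma Gnp_exp_sum (I : finType) (P : pred I) (F : I -> graph n -> R) :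
  Gnp_exp (fun G => \sum_(i | P i) F i G) = \sum_(i | P i) Gnp_exp (F i).
Proof.
rewrite /Gnp_exp exchange_big/=; apply: eq_bigr => G _.
by rewrite mulr_sumr.
Qed.

Lemma Gnp_expD F F' : Gnp_exp (fun G => F G + F' G) = Gnp_exp F + Gnp_exp F'.
Proof. by rewrite -big_split/=; apply: eq_bigr => G _; rewrite mulrDr. Qed.

Lemma Gnp_expZ (c : R) F : Gnp_exp (fun G => c * F G) = c * Gnp_exp F.
Proof. by rewrite mulr_sumr; apply: eq_bigr => G _; rewrite mulrCA. Qed.

Lemma Gnp_probE A : Gnp_prob p A = Gnp_exp (fun G => (A G)%:R).
Proof.
rewrite /Gnp_prob big_mkcond; apply: eq_bigr => G _.
by case: ifP; rewrite ?mulr1 ?mulr0.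
Qed.

Lemma Gnp_prob_ge0 A : 0 <= Gnp_prob p A.
Proof. by apply: sumr_ge0 => G _; exact: Gnp_mass_ge0. Qed.

Lemma le_Gnp_prob A B : (forall G, A G -> B G) -> Gnp_prob p A <= Gnp_prob p B.
Proof.
move=> h; rewrite !Gnp_probE; apply: le_Gnp_exp => G.
by rewrite ler_nat; move: (h G); case: (A G) => // /(_ isT) ->.
Qed.

Lemma Gnp_prob_le1 A : Gnp_prob p A <= 1.
Proof.
by rewrite -[leRHS](Gnp_exp_cst 1) Gnp_probE; apply: le_Gnp_exp => G; case: (A G).
Qed.

Lemma Gnp_probC A : Gnp_prob p (fun G => ~~ A G) = 1 - Gnp_prob p A.
Proof.
apply/eqP; rewrite eq_sym subr_eq !Gnp_probE -Gnp_expD -[eqbLHS](Gnp_exp_cst 1).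
by apply/eqP/eq_bigr => G _; case: (A G); rewrite ?add0r ?addr0.
Qed.

Lemma Gnp_prob_union A B C : (forall G, A G -> B G || C G) ->
  Gnp_prob p A <= Gnp_prob p B + Gnp_prob p C.
Proof.
move=> h; rewrite !Gnp_probE -Gnp_expD; apply: le_Gnp_exp => G.
by move: (h G); rewrite -natrD ler_nat; case: (A G) => // /(_ isT);
  case: (B G); case: (C G).
Qed.

Lemma Gnp_markov F (t : R) : (forall G, 0 <= F G) -> 0 < t ->
  Gnp_prob p (fun G => t <= F G) <= Gnp_exp F / t.
Proof.
move=> F0 t0; rewrite ler_pdivlMr// Gnp_probE mulrC -Gnp_expZ.
by apply: le_Gnp_exp => G; case: (lerP t (F G)); rewrite ?mulr1 ?mulr0.
Qed.

Lemma Gnp_chebyshev F (v t : R) : Gnp_exp (fun G => F G ^+ 2) <= v -> 0 < t ->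
  Gnp_prob p (fun G => t <= `|F G|) <= v / t ^+ 2.
Proof.
move=> hv t0.
apply: (@le_trans _ _ (Gnp_prob p (fun G => t ^+ 2 <= F G ^+ 2))).
  apply: le_Gnp_prob => G h.
  by rewrite -[F G ^+ 2]real_normK ?num_real// lerXn2r ?nnegrE// ltW.
apply: le_trans (Gnp_markov _ _) _; rewrite ?exprn_gt0//.
  by move=> G; exact: sqr_ge0.
by rewrite ler_pM2r// invr_gt0 exprn_gt0.
Qed.

Lemma card_edge : #|edge n| = 'C(n, 2).
Proof. by rewrite card_sig -[in RHS](card_ord n) -card_draws cardsE. Qed.

Lemma Gnp_prob_card (P : pred nat) :
  Gnp_prob p (fun G => P #|G|) = \sum_(j < 'C(n, 2).+1 | P j) binp p 'C(n, 2) j.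
Proof.
pose f (G : graph n) : 'I_('C(n, 2).+1) := inord #|G|.
have fE G : f G = #|G| :> nat.
  by rewrite inordK// ltnS -card_edge max_card.
rewrite /Gnp_prob (partition_big f (fun j => P j))/=; last by move=> G; rewrite fE.
apply: eq_bigr => j Pj.
rewrite (eq_bigr (fun=> p ^+ j * (1 - p) ^+ ('C(n, 2) - j))); last first.
  by move=> G /andP[_ /eqP <-]; rewrite Gnp_massE fE card_edge.
rewrite sumr_const /binp -[LHS]mulr_natl mulrA; congr (_%:R * _ * _).
have := card_draws (edge n) j; rewrite card_edge => <-; rewrite cardsE.
apply: eq_card => G.
rewrite !unfold_in/=; apply/andP/eqP => [[_ /eqP e]|h].
  by rewrite -(fE G) e.
have e : f G = j by apply: val_inj; rewrite /= fE h.
by rewrite h e eqxx.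
Qed.

(** Orthogonality kills the cross terms. It is applied to centred edge indicators and also to
    products of two of them. *)
Lemma le_Gnp_exp_sqr_orth (I : finType) (r : I -> graph n -> R) (c : I -> R) :
  (forall i G, r i G ^+ 2 <= c i) ->
  (forall i j, i != j -> Gnp_exp (fun G => r i G * r j G) = 0) ->
  Gnp_exp (fun G => (\sum_i r i G) ^+ 2) <= \sum_i c i.
Proof.
move=> rc ro.
have -> : Gnp_exp (fun G => (\sum_i r i G) ^+ 2) =
    \sum_i \sum_j Gnp_exp (fun G => r i G * r j G).
  rewrite -[RHS](eq_bigr _ (fun i _ => Gnp_exp_sum xpredT (fun j G => r i G * r j G))).
  rewrite -Gnp_exp_sum; apply: eq_bigr => G _; congr (_ * _).
  by rewrite expr2 mulr_suml; apply: eq_bigr => i _; rewrite mulr_sumr.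
apply: ler_sum => i _; rewrite (bigD1 i)//= [X in _ + X]big1 ?addr0; last first.
  by move=> j ji; apply: ro; rewrite eq_sym.
rewrite -[leRHS]Gnp_exp_cst; apply: le_Gnp_exp => G; exact: rc.
Qed.

Definition xi (f : edge n) G : R := (f \in G)%:R - p.

Lemma xi_sqr_le1 f G : xi f G ^+ 2 <= 1.
Proof.
case/andP: hp => p0 p1; rewrite -[leLHS]real_normK ?num_real// expr_le1//.
by rewrite ler_norml /xi; case: (f \in G) => /=; apply/andP; split; lra.
Qed.

(** The hypothesis says that F ignores the edge f. Toggling f turns mass times [xi] from p (1-p)
    into - (1-p) p, up to a common factor, so this involution negates the summand. *)
Lemma Gnp_exp_xi f F : (forall G, F (f |: G) = F (G :\ f)) ->
  Gnp_exp (fun G => xi f G * F G) = 0.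
Proof.
move=> hF.
pose tg G := if f \in G then G :\ f else f |: G.
have tgK : involutive tg.
  move=> G; rewrite /tg; case: (boolP (f \in G)) => fG.
    by rewrite !inE eqxx/= finset.setD1K.
  by rewrite !inE eqxx/= finset.setU1K.
pose phi G := Gnp_mass p G * (xi f G * F G).
have mass G : Gnp_mass p G = (if f \in G then p else 1 - p) *
    \prod_(g | g != f) (if g \in G then p else 1 - p).
  by rewrite /Gnp_mass (bigD1 f).
have mE G : \prod_(g | g != f) (if g \in tg G then p else 1 - p) =
    \prod_(g | g != f) (if g \in G then p else 1 - p).
  apply: eq_bigr => g gf; rewrite /tg.
  by case: (f \in G); rewrite !inE ?gf ?(negbTE gf).
have fE G : F (tg G) = F G.
  rewrite /tg; case: (boolP (f \in G)) => fG.
    by rewrite -hF; congr F; apply/finset.setP => g; rewrite !inE; case: eqVneq => // ->.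
  rewrite hF; congr F; apply/finset.setP => g; rewrite !inE.
  by case: eqVneq => // ->; rewrite (negbTE fG).
have phiN G : phi (tg G) = - phi G.
  rewrite /phi fE mass mE [in RHS]mass /xi.
  have -> : (f \in tg G) = ~~ (f \in G).
    by rewrite /tg; case: (boolP (f \in G)) => fG; rewrite !inE eqxx.
  by case: (f \in G) => /=; ring.
have : \sum_G phi G = - \sum_G phi G.
  rewrite {1}(reindex_inj (inv_inj tgK))/= -sumrN.
  by apply: eq_bigr => G _; exact: phiN.
rewrite /Gnp_exp -/phi; move: (\sum_G _) => z h; lra.
Qed.
End expectation.

(** * Degrees and induced subgraphs *)

Lemma bin2_le_expn m : ('C(m, 2) <= m ^ 2)%N.
Proof. by rewrite bin2 -divn2; nia. Qed.

Section graphs.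
Variable n : nat.
Implicit Types (G : graph n) (u v x y : 'I_n) (U V : {set 'I_n}) (f : edge n).

Definition adj G u v : bool := [exists f in G, val f == [set u; v]].

Definition deg G u : nat := #|[set f in G | u \in val f]|.

Definition mkedge u v (uv : u != v) : edge n :=
  Sub [set u; v] (introT eqP (etrans (cards2 u v) (congr1 (fun b : bool => b.+1) uv))).

Lemma val_mkedge u v (uv : u != v) : val (mkedge uv) = [set u; v].
Proof. by rewrite SubK. Qed.

Lemma edge_mem f u : u \in val f -> exists2 v, v != u & val f = [set u; v].
Proof.
case: f => A /= /cards2P[a [b [ab ->]]]; rewrite !inE => /orP[/eqP ->|/eqP ->].
  by exists b; rewrite // eq_sym.
by exists a; rewrite // finset.setUC.
Qed.

Lemma adjE G u v (uv : u != v) : adj G u v = (mkedge uv \in G).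
Proof.
apply/exists_inP/idP => [[f fG /eqP fE]|h].
  by rewrite (_ : mkedge uv = f)//; apply: val_inj; rewrite val_mkedge fE.
by exists (mkedge uv); rewrite ?val_mkedge ?eqxx.
Qed.

Lemma adjxx G u : adj G u u = false.
Proof.
rewrite /adj; apply/negbTE/exists_inP => -[f _ /eqP h]; have := valP f.
by rewrite h finset.setUid cards1.
Qed.

Lemma set2_inj u v v' : v != u -> [set u; v]%SET = [set u; v']%SET -> v = v'.
Proof.
move=> vu /finset.setP/(_ v); rewrite !inE eqxx orbT (negbTE vu) /=.
by move=> /esym/eqP.
Qed.

Lemma deg_adj G u : deg G u = #|[set v | adj G u v]|.
Proof.
pose h v : {set 'I_n} := [set u; v]%SET.
have hinj : {in [set v | adj G u v] &, injective h}.
  move=> v v'; rewrite !inE => av _; apply: set2_inj.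
  by apply: contraTneq av => ->; rewrite adjxx.
rewrite -(card_in_imset hinj) /deg -(card_imset _ val_inj).
apply: eq_card => A; apply/imsetP/imsetP => [[f]|[v]].
  rewrite inE => /andP[fG uf] ->; have [v vu fE] := edge_mem uf.
  by exists v; rewrite // inE; apply/exists_inP; exists f; rewrite // fE eqxx.
rewrite inE /adj => /exists_inP[f fG /eqP fE] ->.
by exists f; rewrite // inE fG fE !inE eqxx.
Qed.

Lemma card_edges_at u : #|[set f : edge n | u \in val f]| = n.-1.
Proof.
have := deg_adj [set: edge n] u; rewrite /deg.
rewrite (eq_finset (fun f => u \in val f)); last by move=> f; rewrite inE.
move=> ->.
have -> : [set v | adj [set: edge n] u v] = [set~ u].
  apply/finset.setP => v; rewrite !inE; case: (eqVneq v u) => [->|vu].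
    by rewrite adjxx.
  by move: vu; rewrite eq_sym => uv; rewrite (adjE _ uv) inE.
by rewrite cardsC1 card_ord.
Qed.

Lemma induced_sumE G U : (#|induced_edges G U| =
  \sum_(f in G) (val f \subset U))%N.
Proof.
rewrite -sum1_card big_mkcond [RHS]big_mkcond; apply: eq_bigr => f _.
by rewrite inE; case: (f \in G) => //=; case: (_ \subset _).
Qed.

(** The contribution of a single edge to the double count in [induced_compl]: it meets U in 0, 1 or
    2 vertices. *)
Lemma card_setI_edge f U :
  ((val f \subset ~: U) + #|val f :&: U| = 1 + (val f \subset U))%N.
Proof.
case: f => A /= /cards2P[a [b [ab ->]]].
have -> : #|[set a; b] :&: U| = ((a \in U) + (b \in U))%N.
  rewrite finset.setIUl cardsU (_ : (_ :&: U) :&: _ = finset.set0) ?cards0 ?subn0.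
    have h c : #|[set c] :&: U| = (c \in U).
      case: (boolP (c \in U)) => cU.
        by rewrite (finset.setIidPl _) ?cards1// finset.sub1set.
      rewrite (_ : _ :&: _ = finset.set0) ?cards0//; apply/finset.setP => d.
      by rewrite !inE; case: eqVneq => // ->; rewrite (negbTE cU).
    by rewrite !h.
  by apply/finset.setP => c; rewrite !inE; case: eqVneq => //= ->; rewrite (negbTE ab) !andbF.
by rewrite !finset.subUset !finset.sub1set !inE; case: (a \in U); case: (b \in U).
Qed.

Lemma induced_compl G U :
  (#|induced_edges G (~: U)| + \sum_(u in U) deg G u = #|G| + #|induced_edges G U|)%N.
Proof.
have -> : (\sum_(u in U) deg G u = \sum_(f in G) #|val f :&: U|)%N.
  under eq_bigr do rewrite /deg -sum1_card.
  under [RHS]eq_bigr do rewrite -sum1_card.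
  rewrite (exchange_big_dep (mem G))/=; last by move=> u f _; rewrite inE => /andP[].
  apply: eq_bigr => f fG; apply: eq_bigl => u.
  by rewrite !inE fG andbC.
rewrite !induced_sumE -sum1_card -!big_split/=; apply: eq_bigr => f _.
exact: card_setI_edge.
Qed.

Lemma induced_le_sqr G U : (#|induced_edges G U| <= #|U| ^ 2)%N.
Proof.
rewrite -(card_imset _ val_inj).
apply: (@leq_trans 'C(#|U|, 2)).
  rewrite -cards_draws; apply: subset_leq_card.
  apply/fintype.subsetP => _ /imsetP[f + ->]; rewrite !inE => /andP[_ ->].
  exact: (valP f).
exact: bin2_le_expn.
Qed.

Lemma induced_setU1 G U u : u \notin U ->
  (#|induced_edges G U| <= #|induced_edges G (u |: U)| <= #|induced_edges G U| + #|U|)%N.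
Proof.
move=> uU; apply/andP; split.
  apply/subset_leq_card/fintype.subsetP => f; rewrite !inE => /andP[-> h].
  by apply: fintype.subset_trans h _; apply: finset.subsetUr.
pose E := [set f in induced_edges G (u |: U) | u \in val f].
have sub : induced_edges G (u |: U) \subset induced_edges G U :|: E.
  apply/fintype.subsetP => f; rewrite !inE => /andP[-> h] /=; rewrite h andTb.
  case: (boolP (u \in val f)) => uf; first by rewrite orbT.
  rewrite orbF; apply/fintype.subsetP => v vf.
  move/fintype.subsetP/(_ v vf): h; rewrite !inE => /orP[/eqP vu|//].
  by move: uf; rewrite -vu vf.
apply: leq_trans (subset_leq_card sub) _.
apply: leq_trans (leq_card_setU _ _) _; rewrite leq_add2l.
rewrite -(card_imset _ val_inj).
apply: leq_trans (leq_imset_card (fun v => [set u; v]%SET) _).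
apply/subset_leq_card/fintype.subsetP => _ /imsetP[f + ->].
rewrite !inE => /andP[/andP[_ h] uf]; have [v vu fE] := edge_mem uf.
apply/imsetP; exists v => //.
have vf : v \in val f by rewrite fE !inE eqxx orbT.
by move/fintype.subsetP/(_ v vf): h; rewrite !inE (negbTE vu).
Qed.
End graphs.

Section degrees.
Variables (R : realType) (p : R).
Hypothesis hp : 0 < p < 1.
Variable n : nat.
Implicit Types (G : graph n) (u v x y : 'I_n) (U V : {set 'I_n}) (f : edge n).

(** On the diagonal the value is - p, not 0; this is why the sums of [eta] below run over sets that
    avoid u. *)
Definition eta u v G : R := (adj G u v)%:R - p.

Lemma etaE u v (uv : u != v) G : eta u v G = xi p (mkedge uv) G.
Proof. by rewrite /eta /xi adjE. Qed.

Lemma eta_sqr_le1 u v G : eta u v G ^+ 2 <= 1.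
Proof.
case/andP: hp => p0 p1; rewrite -[leLHS]real_normK ?num_real// expr_le1//.
by rewrite ler_norml /eta; case: (adj G u v) => /=; apply/andP; split; lra.
Qed.

Lemma adj_indep u v (uv : u != v) a b G : [set a; b]%SET != [set u; v]%SET ->
  adj (mkedge uv |: G) a b = adj (G :\ mkedge uv) a b.
Proof.
move=> h; apply: eq_existsb => f; rewrite !inE.
case: (eqVneq f (mkedge uv)) => // ->.
by rewrite val_mkedge [_ == [set a; b]%SET]eq_sym (negbTE h).
Qed.

Lemma set2_neq u v v' : v != u -> v != v' -> [set u; v]%SET != [set u; v']%SET.
Proof. by move=> vu; apply: contra_neq => /set2_inj; apply. Qed.

Lemma Gnp_exp_eta_sum u V : u \notin V ->
  Gnp_exp p (fun G => (\sum_(v in V) eta u v G) ^+ 2) <= n%:R.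
Proof.
move=> uV.
have -> : n%:R = \sum_(v < n) 1 :> R by rewrite sumr_const card_ord.
rewrite (_ : (fun G => _) = fun G =>
  (\sum_v (if v \in V then eta u v G else 0)) ^+ 2); last first.
  by apply: funext => G; rewrite big_mkcond.
apply: (le_Gnp_exp_sqr_orth hp) => [v G|v v' vv'].
  by case: ifP; rewrite ?expr0n// eta_sqr_le1.
case: (boolP (v \in V)) => vV; last first.
  by rewrite -[RHS](Gnp_exp_cst p n 0); congr Gnp_exp; apply: funext => G; rewrite mul0r.
case: (boolP (v' \in V)) => v'V; last first.
  by rewrite -[RHS](Gnp_exp_cst p n 0); congr Gnp_exp; apply: funext => G; rewrite mulr0.
have uv : u != v by apply: contraNneq uV => ->.
have uv' : u != v' by apply: contraNneq uV => ->.
under eq_fun do rewrite (etaE uv).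
apply: Gnp_exp_xi => G; rewrite /eta adj_indep//.
by apply: set2_neq; rewrite eq_sym.
Qed.

(** For v != v' the edge uv occurs in none of the other three factors of the cross term, so
    [Gnp_exp_xi] applies. *)
Lemma Gnp_exp_eta_prod u u' V : u != u' -> u \notin V -> u' \notin V ->
  Gnp_exp p (fun G => (\sum_(v in V) eta u v G * eta u' v G) ^+ 2) <= n%:R.
Proof.
move=> uu' uV u'V.
have -> : n%:R = \sum_(v < n) 1 :> R by rewrite sumr_const card_ord.
rewrite (_ : (fun G => _) = fun G =>
  (\sum_v (if v \in V then eta u v G * eta u' v G else 0)) ^+ 2); last first.
  by apply: funext => G; rewrite big_mkcond.
apply: (le_Gnp_exp_sqr_orth hp) => [v G|v v' vv'].
  case: ifP; rewrite ?expr0n// => _.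
  by rewrite exprMn mulr_ile1 ?sqr_ge0 ?eta_sqr_le1.
case: (boolP (v \in V)) => vV; last first.
  by rewrite -[RHS](Gnp_exp_cst p n 0); congr Gnp_exp; apply: funext => G; rewrite mul0r.
case: (boolP (v' \in V)) => v'V; last first.
  by rewrite -[RHS](Gnp_exp_cst p n 0); congr Gnp_exp; apply: funext => G; rewrite mulr0.
have uv : u != v by apply: contraNneq uV => ->.
have uv' : u != v' by apply: contraNneq uV => ->.
have u'v' : u' != v' by apply: contraNneq u'V => ->.
under eq_fun do rewrite (etaE uv) -!mulrA.
apply: Gnp_exp_xi => G; rewrite /eta !adj_indep//.
- by apply/eqP => /finset.setP/(_ v'); rewrite !inE eqxx orbT eq_sym (negbTE uv')
    eq_sym (negbTE vv').
- by apply: set2_neq; rewrite eq_sym.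
- apply/eqP => /finset.setP/(_ u'); rewrite !inE eqxx (eq_sym u' u) (negbTE uu') /=.
  by move=> /esym/eqP e; move: u'V; rewrite e vV.
Qed.

Lemma edges_eta G : #|G|%:R - p * 'C(n, 2)%:R = \sum_f xi p f G.
Proof.
rewrite /xi sumrB sumr_const -card_edge mulr_natr; congr (_ - _).
by rewrite -sum_indic_card.
Qed.

Lemma Gnp_exp_edges_sqr :
  Gnp_exp p (fun G => (#|G|%:R - p * 'C(n, 2)%:R) ^+ 2) <= n%:R ^+ 2.
Proof.
apply: (@le_trans _ _ (\sum_(f : edge n) 1)); last first.
  by rewrite sumr_const card_edge -natrX ler_nat bin2_le_expn.
under eq_fun do rewrite edges_eta.
apply: (le_Gnp_exp_sqr_orth hp) => [f G|f f' ff']; first exact: xi_sqr_le1.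
apply: Gnp_exp_xi => G; rewrite /xi !inE eq_sym (negbTE ff').
by [].
Qed.

Lemma Gnp_exp_deg_expR u (l : R) : `|l| <= 1 / 100 ->
  Gnp_exp p (fun G => expR (l * ((deg G u)%:R - p * n.-1%:R))) <=
  expR (2 / 3 * l ^+ 2 * (p * (1 - p)) * n%:R).
Proof.
move=> hl; case/andP: (hp) => p0 p1.
pose g f (b : bool) : R := if u \in val f then expR (l * (b%:R - p)) else 1.
have -> : (fun G => expR (l * ((deg G u)%:R - p * n.-1%:R))) =
    (fun G => \prod_f g f (f \in G)).
  apply: funext => G; rewrite /g -big_mkcond/= -expR_sum -mulr_sumr; congr (expR (_ * _)).
  rewrite sumrB sumr_const -(card_edges_at u) mulr_natr; congr (_ - _ *+ _); last first.
    by apply: eq_card => f; rewrite !inE.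
  rewrite /deg -sum_indic_card [RHS]big_mkcond; apply: eq_bigr => f _.
  by rewrite !inE; case: (_ \in val f); rewrite ?andbT ?andbF.
rewrite Gnp_exp_prod /g.
rewrite (bigID (fun f => u \in val f))/= [X in _ * X]big1 ?mulr1; last first.
  by move=> f /negbTE ->; ring.
rewrite (eq_bigr (fun=> p * expR (l * (1 - p)) + (1 - p) * expR (- l * p))); last first.
  by move=> f ->; rewrite /= sub0r mulrN mulNr.
rewrite prodr_const (eq_card (_ : _ =i [set f : edge n | u \in val f])); last first.
  by move=> f; rewrite inE.
rewrite card_edges_at.
apply: (@le_trans _ _ (expR (2 / 3 * l ^+ 2 * (p * (1 - p))) ^+ n.-1)).
  rewrite lerXn2r ?nnegrE ?bern_mgf ?expR_ge0//.
  by rewrite addr_ge0// mulr_ge0 ?expR_ge0//; lra.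
rewrite -expRM_natl ler_expR mulrC ler_wpM2l ?ler_nat ?leq_pred//.
have pq0 : 0 <= p * (1 - p) by apply: mulr_ge0; lra.
have l20 : 0 <= l ^+ 2 by exact: sqr_ge0.
by apply: mulr_ge0 => //; lra.
Qed.

(** One statistic that controls the degree sums of all vertex sets at once, so no union bound over
    sets is taken. Both signs are included because D - dev(k) can have either sign. *)
Definition excess (T : R) G : R := \sum_u
  (Num.max ((deg G u)%:R - p * n.-1%:R - T) 0 +
   Num.max (- ((deg G u)%:R - p * n.-1%:R) - T) 0).

Lemma excess_ge0 (T : R) G : 0 <= excess T G.
Proof. by apply: sumr_ge0 => u _; rewrite addr_ge0// le_max lexx orbT. Qed.

Lemma deg_sum_excess (T : R) G U :
  `|\sum_(u in U) ((deg G u)%:R - p * n.-1%:R)| <= #|U|%:R * T + excess T G.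
Proof.
apply: (@le_trans _ _ (\sum_(u in U) (T + (Num.max ((deg G u)%:R - p * n.-1%:R - T) 0 +
   Num.max (- ((deg G u)%:R - p * n.-1%:R) - T) 0)))).
  apply: le_trans (ler_norm_sum _ _ _) _; apply: ler_sum => u _.
  set z := _ - _.
  have le_maxl0 (w : R) : w <= Num.max w 0 /\ 0 <= Num.max w 0.
    by rewrite !le_max !lexx orbT.
  have [a1 a2] := le_maxl0 (z - T); have [a3 a4] := le_maxl0 (- z - T).
  by rewrite ler_norml; apply/andP; split; lra.
rewrite big_split/= sumr_const mulr_natl lerD2l /excess.
rewrite [leRHS](bigID (mem U))/= lerDl sumr_ge0// => u _.
by rewrite addr_ge0// le_max lexx orbT.
Qed.

(** The inequality x <= exp (l x) / l replaces a positive part by an exponential moment; the factor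
    2 counts the two signs. *)
Lemma Gnp_exp_excess (T l : R) : 0 < l <= 1 / 100 ->
  Gnp_exp p (excess T) <=
  2 * n%:R * expR (2 / 3 * l ^+ 2 * (p * (1 - p)) * n%:R - l * T) / l.
Proof.
move=> /andP[l0 l1].
have hmax (z : R) : Num.max (z - T) 0 <= expR (- (l * T)) / l * expR (l * z).
  have -> : expR (- (l * T)) / l * expR (l * z) = expR (l * (z - T)) / l.
    by rewrite mulrBr expRD; ring.
  rewrite ge_max divr_ge0 ?expR_ge0 ?(ltW l0)// andbT ler_pdivlMr// mulrC.
  by apply: le_trans (expR_ge1Dx _); rewrite lerDr.
have e1 u (s : R) : `|s| <= 1 / 100 -> s ^+ 2 = l ^+ 2 ->
    Gnp_exp p (fun G => expR (- (l * T)) / l * expR (s * ((deg G u)%:R - p * n.-1%:R))) <=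
    expR (2 / 3 * l ^+ 2 * (p * (1 - p)) * n%:R - l * T) / l.
  move=> hs sl; rewrite Gnp_expZ.
  rewrite [leRHS](_ : _ = expR (- (l * T)) / l *
    expR (2 / 3 * l ^+ 2 * (p * (1 - p)) * n%:R)); last by rewrite expRD; ring.
  rewrite ler_wpM2l ?divr_ge0 ?expR_ge0 ?(ltW l0)// -sl.
  exact: Gnp_exp_deg_expR.
apply: (@le_trans _ _ (\sum_(u < n)
  2 * (expR (2 / 3 * l ^+ 2 * (p * (1 - p)) * n%:R - l * T) / l))); last first.
  by rewrite sumr_const card_ord -[leLHS]mulr_natr le_eqVlt; apply/orP; left; apply/eqP; ring.
rewrite /excess Gnp_exp_sum; apply: ler_sum => u _.
rewrite Gnp_expD [leRHS]mulr_natl mulr2n; apply: lerD.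
  apply: le_trans (e1 u l _ _) => //; last by rewrite ger0_norm ?(ltW l0).
  by apply: le_Gnp_exp => // G.
apply: le_trans (e1 u (- l) _ _); last by rewrite sqrrN.
  apply: le_Gnp_exp => // G; apply: le_trans (hmax _) _.
  by rewrite mulrN mulNr.
by rewrite normrN ger0_norm ?(ltW l0).
Qed.
End degrees.

(** * Resampling by exchanging neighbours of paired vertices *)

Section coins.
Variables (R : realType) (T : finType).
Implicit Types (A H N : {set T}).

(** N plays the role of a neighbourhood and A that of the set of exchanged positions; on positions
    adjacent to exactly one of two partners this is the new neighbourhood. *)
Definition symdiff A N : {set T} := [set y | (y \in N) (+) (y \in A)].

Lemma card_setI_eq H z :
  #|[set A : {set T} | #|H :&: A| == z]| = ('C(#|H|, z) * 2 ^ (#|T| - #|H|))%N.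
Proof.
pose f A := (H :&: A, A :\: H).
have finj : injective f.
  move=> A A' [/finset.setP h1 /finset.setP h2]; apply/finset.setP => y.
  by move: (h1 y) (h2 y); rewrite !inE; case: (y \in H).
rewrite -(card_imset _ finj) -cards_draws.
rewrite -(_ : #|~: H| = #|T| - #|H|)%N; last by rewrite cardsCs finset.setCK.
rewrite -card_powerset -cardsX; apply: eq_card => -[C D].
rewrite !inE/=; apply/imsetP/idP => [[A]|/andP[/andP[CH Cz] DH]].
  rewrite inE => h [-> ->]; rewrite finset.subsetIl h /=.
  by apply/fintype.subsetP => y; rewrite !inE => /andP[].
exists (C :|: D); rewrite ?inE.
  rewrite (_ : H :&: _ = C)//; apply/finset.setP => y; rewrite !inE.
  move/fintype.subsetP/(_ y): CH; move/fintype.subsetP/(_ y): DH; rewrite inE.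
  by case: (y \in C); case: (y \in D); case: (y \in H) => //= h1 h2;
    rewrite ?(h1 isT) ?(h2 isT).
congr (_, _); apply/finset.setP => y; rewrite !inE;
  move/fintype.subsetP/(_ y): CH; move/fintype.subsetP/(_ y): DH; rewrite inE;
  by case: (y \in C); case: (y \in D); case: (y \in H) => //= h1 h2;
    rewrite ?(h1 isT) ?(h2 isT).
Qed.

(** The map A to [symdiff A N] is an involution, so a uniform A gives a uniform set, whose trace on
    H has Bin(|H|, 1/2) size whatever N is. *)
Lemma coin_law H N (P : pred nat) :
  #|[set A : {set T} | P #|H :&: symdiff A N|]|%:R / 2 ^+ #|T| =
  \sum_(z < #|H|.+1 | P z) binp 2^-1 #|H| z :> R.
Proof.
have sK : cancel (symdiff ^~ N) (symdiff ^~ N).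
  by move=> A; apply/finset.setP => y; rewrite !inE addbA addbb.
rewrite -(card_imset _ (can_inj sK)).
rewrite (_ : _ @: _ = [set A : {set T} | P #|H :&: A|]); last first.
  apply/finset.setP => A; apply/imsetP/idP => [[B]|].
    by rewrite !inE => h ->.
  by rewrite inE => h; exists (symdiff A N); rewrite ?inE sK.
pose g A : 'I_(#|H|.+1) := inord #|H :&: A|.
have gE A : g A = #|H :&: A| :> nat.
  by rewrite inordK// ltnS subset_leq_card// finset.subsetIl.
rewrite -sum1_card (partition_big g (fun z => P z))/=; last by move=> A; rewrite inE gE.
rewrite natr_sum mulr_suml; apply: eq_bigr => z Pz.
rewrite sum1_card (eq_card (_ : _ =i [set A : {set T} | #|H :&: A| == z])); last first.
  move=> A; rewrite !inE [LHS]unfold_in/= inE -(inj_eq val_inj) /= gE.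
  by case: eqP => [->|]; rewrite ?Pz ?andbF.
rewrite card_setI_eq natrM natrX /binp -[RHS]mulrA -mulrA; congr (_ * _).
have hT : (#|H| <= #|T|)%N by exact: max_card.
have zH : (z <= #|H|)%N by rewrite -ltnS.
rewrite (_ : 1 - 2^-1 = 2^-1 :> R); last by field.
rewrite -exprD subnKC// -[in X in _ / X](subnKC hT) exprD exprVn.
by field; rewrite !expf_neq0//; apply/eqP; lra.
Qed.

(** Chernoff bound through the mean of 2^{- count}: independence gives a product of factors at most
    1 - pi/2 <= exp (- pi/2), and fewer than M successes make 2^{- count} at least 2^{- M}. *)
Lemma coin_few (J : {set T}) (E : T -> pred {set T}) (pi : R) (M : nat) :
  0 <= pi ->
  (forall i, i \in J -> pi <= #|[set A | E i A]|%:R / 2 ^+ #|T|) ->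
  #|[set w : {ffun T -> {set T}} | (#|[set i in J | E i (w i)]| < M)%N]|%:R <=
  2 ^+ M * expR (- (pi / 2 * #|J|%:R)) * #|{ffun T -> {set T}}|%:R.
Proof.
move=> pi0 hE.
pose phi i A : R := if (i \in J) && E i A then 2^-1 else 1.
apply: (@le_trans _ _ (\sum_(w : {ffun T -> {set T}}) 2 ^+ M * \prod_i phi i (w i))).
  rewrite -sum_indic_card; apply: ler_sum => w _; rewrite inE /phi -big_mkcond/=.
  rewrite prodr_const.
  have e0 m : 0 < 2^-1 ^+ m :> R by rewrite exprn_gt0// invr_gt0 ltr0n.
  case: ltnP => [lt|_]; last by rewrite mulr_ge0 ?exprn_ge0 ?ltW.
  rewrite exprVn ler_pdivlMr ?exprn_gt0// mul1r.
  rewrite ler_eXn2l ?ltr1n//; apply: leq_trans (ltnW lt).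
  by apply/eq_leq/eq_card => i; rewrite !inE.
rewrite -mulr_sumr -(bigA_distr_bigA phi) -mulrA ler_wpM2l ?exprn_ge0//.
have c2 : #|{: {set T}}|%:R = 2 ^+ #|T| :> R.
  by rewrite -[#|{: {set T}}|]cardsT -powersetT card_powerset cardsT natrX.
have S0 : 0 < 2 ^+ #|T| :> R by rewrite exprn_gt0.
rewrite card_ffun natrX c2.
apply: (@le_trans _ _ (\prod_i ((if i \in J then expR (- (pi / 2)) else 1) * 2 ^+ #|T|))).
  apply: ler_prod => i _; apply/andP; split.
    by apply: sumr_ge0 => A _; rewrite /phi; case: ifP => _; rewrite ?invr_ge0.
  case: (boolP (i \in J)) => iJ; last first.
    by rewrite /phi (negbTE iJ)/= sumr_const c2 mul1r.
  have -> : \sum_A phi i A = \sum_A (1 - 2^-1 * (A \in [set A | E i A])%:R).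
    by apply: eq_bigr => A _; rewrite /phi iJ inE; case: (E i A) => /=; field.
  rewrite sumrB -mulr_sumr sum_indic_card sumr_const c2.
  apply: (@le_trans _ _ ((1 - pi / 2) * 2 ^+ #|T|)); last first.
    by rewrite ler_wpM2r ?(ltW S0)//; exact: expR_ge1Dx.
  by have := hE i iJ; rewrite ler_pdivlMr// => h; lra.
rewrite big_split/= prodr_const -big_mkcond/= prodr_const mulrC -expRM_natl.
by rewrite mulrC (_ : _ * - _ = - (pi / 2 * #|J|%:R)); last by ring.
Qed.
End coins.

(** * The exchange as a measure-preserving involution *)

Section swaps.
Variables (n k : nat) (I : {set 'I_n}).
Hypothesis hk : (k + k <= n)%N.
Implicit Types (G : graph n) (u v x y : 'I_n) (A U : {set 'I_n}) (f : edge n)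
  (w : {ffun 'I_n -> {set 'I_n}}).

(* Vertices i and i + k, for i < k, are partners; vertices from 2k on are their
   own partners. *)
Definition partner v : 'I_n :=
  insubd v (if v < k then v + k else if v < k + k then v - k else v)%N.

Lemma val_partner v : partner v =
  (if v < k then v + k else if v < k + k then v - k else v)%N :> nat.
Proof.
rewrite [LHS]val_insubd; case: ifP => // /negbT; have := ltn_ord v.
by case: (ltnP v k) => h1; case: (ltnP v (k + k)) => h2; lia.
Qed.

Lemma partnerK : involutive partner.
Proof.
move=> v; apply: val_inj => /=; rewrite !val_partner.
case: (ltnP v k) => h1.
  by rewrite ltnNge leq_addl /= ltn_add2r h1 addnK.
case: (ltnP v (k + k)) => h2; last by rewrite ltnNge h1 /= ltnNge h2.
by rewrite (_ : v - k < k)%N ?subnK//; lia.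
Qed.

Lemma partner_id v : (k + k <= v)%N -> partner v = v.
Proof.
move=> h; apply: val_inj => /=; rewrite val_partner.
by case: (ltnP v k) => h1; case: (ltnP v (k + k)) => h2; lia.
Qed.

Lemma partner_lt v : (partner v < k + k)%N = (v < k + k)%N.
Proof.
by rewrite val_partner; case: (ltnP v k) => h1; case: (ltnP v (k + k)) => h2; lia.
Qed.

(** The member below k of the pair of v, which names the pair; meaningful for v < 2k. *)
Definition pidx v : 'I_n := if (v < k)%N then v else partner v.

Lemma pidx_partner v : (v < k + k)%N -> pidx (partner v) = pidx v.
Proof.
move=> h; rewrite /pidx val_partner h.
case: (ltnP v k) => h1; first by rewrite ltnNge leq_addl /= partnerK.
by rewrite (_ : v - k < k)%N//; lia.
Qed.

Lemma pidx_lt v : (v < k)%N -> pidx v = v.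
Proof. by rewrite /pidx => ->. Qed.

(** An edge moves only if it joins a paired vertex u to an unpaired y. The coin [w (pidx u)] is
    shared by u and its partner, so uy and u'y trade places and the exchange is an involution; edges
    between paired vertices stay. Arbitrary sets A are allowed so that this invariance is stated on
    images under [partner]. *)
Definition toggled w A : bool :=
  [exists u in A, exists y in A,
     [&& (u < k + k)%N, (k + k <= y)%N, pidx u \in I & y \in w (pidx u)]].

Lemma toggledP w A : reflect (exists u y, [/\ u \in A, y \in A &
  [&& (u < k + k)%N, (k + k <= y)%N, pidx u \in I & y \in w (pidx u)]]) (toggled w A).
Proof.
apply: (iffP exists_inP) => [[u uA /exists_inP[y yA h]]|[u [y [uA yA h]]]].
  by exists u, y.
by exists u => //; apply/exists_inP; exists y.
Qed.

Lemma toggled_partner w A : toggled w (partner @: A) = toggled w A.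
Proof.
have imp B : toggled w B -> toggled w (partner @: B).
  move/toggledP => [u [y [uB yB /and4P[h1 h2 h3 h4]]]].
  apply/toggledP; exists (partner u), y; split; first exact: imset_f.
    by rewrite -(partner_id h2) imset_f.
  by rewrite partner_lt h1 h2 pidx_partner// h3.
apply/idP/idP => [/imp|]; last exact: imp.
rewrite -imset_comp (_ : _ @: A = A)//.
by rewrite (eq_imset _ (_ : _ =1 id)) ?imset_id// => v; exact: partnerK.
Qed.

Definition swap_pair w A := if toggled w A then partner @: A else A.

Lemma card_swap_pair w A : #|swap_pair w A| = #|A|.
Proof.
by rewrite /swap_pair; case: ifP => // _; rewrite card_imset//; exact: inv_inj partnerK.
Qed.

Lemma swap_pairK w : involutive (swap_pair w).
Proof.
move=> A; rewrite {2}/swap_pair; case: ifP => hA; last by rewrite /swap_pair hA.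
rewrite /swap_pair toggled_partner hA -imset_comp.
by rewrite (eq_imset _ (_ : _ =1 id)) ?imset_id// => v; exact: partnerK.
Qed.

(** The default value of [insubd] never occurs, because [swap_pair] preserves cardinality. *)
Definition swap_edge w f : edge n := insubd f (swap_pair w (val f)).

Lemma val_swap_edge w f : val (swap_edge w f) = swap_pair w (val f).
Proof. by rewrite val_insubd card_swap_pair (valP f). Qed.

Lemma swap_edgeK w : involutive (swap_edge w).
Proof. by move=> f; apply: val_inj; rewrite !val_swap_edge swap_pairK. Qed.

Definition swap_graph w G : graph n := [set f | swap_edge w f \in G].

Lemma swap_graphK w : involutive (swap_graph w).
Proof. by move=> G; apply/finset.setP => f; rewrite !inE swap_edgeK. Qed.

Lemma card_swap_graph w G : #|swap_graph w G| = #|G|.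
Proof.
rewrite -(card_imset _ (inv_inj (swap_edgeK w))); apply: eq_card => f.
apply/imsetP/idP => [[g]|fG]; first by rewrite inE => h ->.
by exists (swap_edge w f); rewrite ?inE swap_edgeK.
Qed.

Lemma adj_swap_graph w G u v : adj (swap_graph w G) u v =
  if toggled w [set u; v] then adj G (partner u) (partner v) else adj G u v.
Proof.
case: (eqVneq u v) => [->|uv]; first by rewrite !adjxx if_same.
have pp : partner u != partner v by rewrite (inj_eq (inv_inj partnerK)).
rewrite !adjE inE; case: ifP => h.
  congr (_ \in G); apply: val_inj.
  by rewrite val_swap_edge !val_mkedge /swap_pair h imsetU1 imset_set1.
congr (_ \in G); apply: val_inj.
by rewrite val_swap_edge !val_mkedge /swap_pair h.
Qed.

Lemma toggled_in w U : (forall u, u \in U -> (u < k + k)%N) -> toggled w U = false.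
Proof.
move=> h; apply/negbTE/toggledP => -[u [y [_ yU /and4P[_ h2 _ _]]]].
by have := h _ yU; rewrite ltnNge h2.
Qed.

Lemma toggled2 w u y : (u < k + k)%N -> (k + k <= y)%N ->
  toggled w [set u; y] = (pidx u \in I) && (y \in w (pidx u)).
Proof.
move=> hu hy; apply/toggledP/andP => [[u' [y' []]]|[h1 h2]].
  rewrite !inE => /orP[] /eqP -> /orP[] /eqP -> /and4P[a b c d]; split=> //; lia.
by exists u, y; split; rewrite ?inE ?eqxx ?orbT// hu hy h1 h2.
Qed.

Lemma induced_swap_graph w G U : (forall u, u \in U -> (u < k + k)%N) ->
  induced_edges (swap_graph w G) U = induced_edges G U.
Proof.
move=> hU; apply/finset.setP => f; rewrite !inE.
case: (boolP (val f \subset U)) => fU; rewrite ?andbF// !andbT.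
congr (_ \in G); apply: val_inj; rewrite val_swap_edge /swap_pair toggled_in//.
by move=> u /(fintype.subsetP fU)/hU.
Qed.

Lemma deg_swap_graph_out w G u : (u < k + k)%N -> pidx u \notin I ->
  deg (swap_graph w G) u = deg G u.
Proof.
move=> hu uI; rewrite !deg_adj; apply: eq_card => v; rewrite !inE adj_swap_graph.
case: (ltnP v (k + k)) => hv; last by rewrite toggled2// (negbTE uI).
by rewrite toggled_in// => y; rewrite !inE => /orP[] /eqP ->.
Qed.

Definition outer : {set 'I_n} := [set y : 'I_n | (k + k <= y)%N].
Definition nbr_out G u : {set 'I_n} := [set y in outer | adj G u y].
(** The exchange of xy and x'y has an effect only where exactly one of them is present. All other
    neighbours of a vertex are counted by [deg_fixed]. *)
Definition split_set G i : {set 'I_n} :=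
  [set y in outer | adj G i y (+) adj G (partner i) y].
Definition deg_fixed G u : nat :=
  (#|[set v in ~: outer | adj G u v]| +
   #|[set y in outer | adj G u y && adj G (partner u) y]|)%N.

Lemma split_set_partner G i : split_set G (partner i) = split_set G i.
Proof. by apply/finset.setP => y; rewrite !inE partnerK addbC. Qed.

Lemma deg_swap_graph_in w G u : (u < k + k)%N -> pidx u \in I ->
  deg (swap_graph w G) u =
  (deg_fixed G u + #|split_set G u :&: symdiff (w (pidx u)) (nbr_out G u)|)%N.
Proof.
move=> hu uI; rewrite deg_adj /deg_fixed -!sum1_card !(big_mkcond (fun _ => _ \in _))/=.
rewrite -!big_split/=; apply: eq_bigr => v _; rewrite !inE adj_swap_graph.
case: (leqP (k + k) v) => hv; last first.
  rewrite toggled_in; last by move=> y; rewrite !inE => /orP[] /eqP ->.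
  by rewrite /=; case: (adj G u v).
rewrite toggled2// uI (partner_id hv)/=.
by case: (adj G u v); case: (adj G (partner u) v); case: (v \in w _).
Qed.

Lemma deg_swap_graph_partner w G u : (u < k + k)%N -> pidx u \in I ->
  (deg (swap_graph w G) (partner u) +
     #|split_set G u :&: symdiff (w (pidx u)) (nbr_out G u)| =
   deg_fixed G (partner u) + #|split_set G u|)%N.
Proof.
move=> hu uI; rewrite deg_swap_graph_in ?partner_lt// ?pidx_partner//.
rewrite split_set_partner -addnA; congr (_ + _)%N.
rewrite -!sum1_card !(big_mkcond (fun _ => _ \in _))/=.
rewrite -!big_split/=; apply: eq_bigr => v _; rewrite !inE.
case: (leqP (k + k) v) => hv //=.
by case: (adj G u v); case: (adj G (partner u) v); case: (v \in w _).
Qed.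

(** Each [swap_graph w] is a bijection that keeps the number of edges, hence the mass. So the
    probability of B is also that of a graph swapped by a uniform w, and b bounds it given any G in
    T. *)
Lemma swap_symmetrization (R : realType) (p : R) (hp : 0 < p < 1)
    (T B : pred (graph n)) (b : R) : 0 <= b ->
  (forall G, T G -> #|[set w | B (swap_graph w G)]|%:R <=
     b * #|{ffun 'I_n -> {set 'I_n}}|%:R) ->
  Gnp_prob p B <= Gnp_prob p (fun G => ~~ T G) + b.
Proof.
move=> b0 h; set W := #|{ffun 'I_n -> {set 'I_n}}|%:R in h *.
have W0 : 0 < W.
  by rewrite ltr0n; apply/card_gt0P; exists [ffun=> finset.set0].
have mass w G : Gnp_mass p (swap_graph w G) = Gnp_mass p G.
  by rewrite !Gnp_massE card_swap_graph.
have e1 w : Gnp_prob p B = Gnp_exp p (fun G => (B (swap_graph w G))%:R).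
  rewrite Gnp_probE /Gnp_exp (reindex_inj (inv_inj (swap_graphK w)))/=.
  by apply: eq_bigr => G _; rewrite mass.
have : W * Gnp_prob p B <= W * (Gnp_prob p (fun G => ~~ T G) + b).
  apply: (@le_trans _ _ (Gnp_exp p (fun G => \sum_w (B (swap_graph w G))%:R))).
    rewrite Gnp_exp_sum (eq_bigr _ (fun w _ => esym (e1 w))) sumr_const.
    by rewrite -[leRHS]mulr_natl.
  rewrite Gnp_probE -[b in leRHS](Gnp_exp_cst p n) -Gnp_expD -Gnp_expZ.
  apply: (le_Gnp_exp hp) => G.
  have -> : \sum_w (B (swap_graph w G))%:R = #|[set w | B (swap_graph w G)]|%:R :> R.
    by rewrite -sum_indic_card; apply: eq_bigr => w _; rewrite inE.
  case: (boolP (T G)) => TG /=; first by rewrite add0r mulrC; exact: h.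
  apply: (@le_trans _ _ W); first by rewrite ler_nat max_card.
  by rewrite ler_peMr ?(ltW W0)// lerDl.
by rewrite ler_pM2l.
Qed.
End swaps.

(** * Typical pairs *)

Section typical_pairs.
Variables (R : realType) (p : R).
Hypothesis hp : 0 < p < 1.
Variables (n k : nat).
Hypothesis hk : (k + k <= n)%N.
Implicit Types (G : graph n) (u v y i : 'I_n).

Local Notation outer := (@outer n k).
Local Notation partner := (@partner n k).

Definition dev_in u G : R := \sum_(v in ~: outer :\ u) eta p u v G.
Definition dev_out u G : R := \sum_(y in outer) eta p u y G.
Definition codev u G : R := \sum_(y in outer) eta p u y G * eta p (partner u) y G.

(** Each of the five quantities has second moment at most n, so Chebyshev's inequality applies with
    t of order sqrt(n ln n). The first four centre the two degrees, and [codev] is needed for the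
    size of the split set. *)
Definition typical (t : R) G i : bool :=
  [&& `|dev_in i G| < t, `|dev_in (partner i) G| < t, `|dev_out i G| < t,
      `|dev_out (partner i) G| < t & `|codev i G| < t].

Lemma card_outer : #|outer| = (n - (k + k))%N.
Proof.
have hc : #|~: outer| = (k + k)%N.
  have finj : injective (widen_ord hk).
    by move=> a b /(congr1 val) /= h; apply: val_inj.
  rewrite -[RHS]card_ord -(card_imset _ finj); apply: eq_card => v.
  rewrite !inE -ltnNge; apply/idP/imsetP => [h|[a _ ->]] //=.
    by exists (Ordinal h) => //; apply: val_inj.
by have := cardsC outer; rewrite hc card_ord; lia.
Qed.

Lemma outer_notin u : (u < k + k)%N -> u \notin outer.
Proof. by move=> h; rewrite inE -ltnNge. Qed.

Lemma Gnp_prob_atypical (t : R) i : 0 < t -> (i < k)%N ->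
  Gnp_prob p (fun G => ~~ typical t G i) <= 5 * n%:R / t ^+ 2.
Proof.
move=> t0 ik.
have ikk : (i < k + k)%N by apply: leq_trans ik (leq_addr _ _).
have pkk : (partner i < k + k)%N by rewrite partner_lt.
have neq : i != partner i.
  by rewrite -(inj_eq val_inj)/= val_partner// ik; move: ik; lia.
have cheb (F : graph n -> R) : Gnp_exp p (fun G => F G ^+ 2) <= n%:R ->
    Gnp_prob p (fun G => t <= `|F G|) <= n%:R / t ^+ 2.
  by move=> h; exact: Gnp_chebyshev.
have [ho ho'] := (outer_notin ikk, outer_notin pkk).
have du (u : 'I_n) : u \notin ~: outer :\ u by rewrite !inE eqxx.
have c1 := cheb _ (Gnp_exp_eta_sum hp (du i)).
have c2 := cheb _ (Gnp_exp_eta_sum hp (du (partner i))).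
have c3 := cheb _ (Gnp_exp_eta_sum hp ho).
have c4 := cheb _ (Gnp_exp_eta_sum hp ho').
have c5 := cheb _ (Gnp_exp_eta_prod hp neq ho ho').
pose A1 := fun G => t <= `|dev_in i G|.
pose A2 := fun G => t <= `|dev_in (partner i) G|.
pose A3 := fun G => t <= `|dev_out i G|.
pose A4 := fun G => t <= `|dev_out (partner i) G|.
pose A5 := fun G => t <= `|codev i G|.
have u1 : Gnp_prob p (fun G => ~~ typical t G i) <=
    Gnp_prob p A1 + Gnp_prob p (fun G => [|| A2 G, A3 G, A4 G | A5 G]).
  apply: Gnp_prob_union => // G; rewrite /typical !negb_and -!leNgt.
  by rewrite -/(A1 G) -/(A2 G) -/(A3 G) -/(A4 G) -/(A5 G).
have u2 := @Gnp_prob_union _ _ hp _ _ A2 (fun G => [|| A3 G, A4 G | A5 G]) (fun G h => h).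
have u3 := @Gnp_prob_union _ _ hp _ _ A3 (fun G => A4 G || A5 G) (fun G h => h).
have u4 := @Gnp_prob_union _ _ hp _ _ A4 A5 (fun G h => h).
have -> : 5 * n%:R / t ^+ 2 = 5 * (n%:R / t ^+ 2) by rewrite mulrA.
move: c1 c2 c3 c4 c5 u1 u2 u3 u4.
rewrite -/A1 -/A2 -/A3 -/A4 -/A5; move: (n%:R / t ^+ 2) => z; lra.
Qed.

(** Markov's inequality for the number of atypical pairs. *)
Lemma Gnp_prob_few_typical (t : R) (J : {set 'I_n}) : 0 < t -> (0 < #|J|)%N ->
  (forall i, i \in J -> (i < k)%N) ->
  Gnp_prob p (fun G => #|[set i in J | typical t G i]|%:R < #|J|%:R / 2 :> R) <=
  10 * n%:R / t ^+ 2.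
Proof.
move=> t0 J0 hJ.
have J0' : 0 < #|J|%:R :> R by rewrite ltr0n.
have e1 G : #|[set i in J | ~~ typical t G i]|%:R =
    \sum_(i in J) (~~ typical t G i)%:R :> R.
  rewrite -sum_indic_card [RHS]big_mkcond; apply: eq_bigr => i _.
  by rewrite !inE; case: (i \in J).
have e2 : Gnp_exp p (fun G => #|[set i in J | ~~ typical t G i]|%:R) <=
    #|J|%:R * (5 * n%:R / t ^+ 2).
  under eq_fun do rewrite e1.
  rewrite Gnp_exp_sum mulr_natl -sumr_const; apply: ler_sum => i iJ.
  by rewrite -Gnp_probE; apply: Gnp_prob_atypical => //; exact: hJ.
apply: (@le_trans _ _ (Gnp_prob p (fun G => #|J|%:R / 2 <=
    #|[set i in J | ~~ typical t G i]|%:R :> R))).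
  apply: le_Gnp_prob => // G.
  have -> : #|J|%:R = #|[set i in J | typical t G i]|%:R +
     #|[set i in J | ~~ typical t G i]|%:R :> R.
    rewrite -natrD -[in LHS](cardsID [set i | typical t G i] J).
    congr ((_ + _)%:R); apply: eq_card => i; rewrite !inE//.
    by rewrite andbC.
  by move: (_%:R) (_%:R) => a b; lra.
apply: le_trans (Gnp_markov hp _ _) _.
- by move=> G; exact: ler0n.
- by rewrite divr_gt0.
rewrite ler_pdivrMr ?divr_gt0//; apply: le_trans e2 _.
by rewrite le_eqVlt; apply/orP; left; apply/eqP; field; rewrite gt_eqF.
Qed.

Lemma card_adj_sum G u (V : {set 'I_n}) :
  #|[set v in V | adj G u v]|%:R = p * #|V|%:R + \sum_(v in V) eta p u v G :> R.
Proof.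
rewrite mulr_natr -[p *+ _]sumr_const -big_split/= -sum_indic_card [RHS]big_mkcond.
apply: eq_bigr => v _.
by rewrite !inE /eta addrC subrK; case: (v \in V).
Qed.

(** [deg_fixed] plus half of the split set is the mean degree of u over the coins: the exchange
    averages the outward degrees of the two partners. *)
Lemma deg_fixed_dev G u : (u < k + k)%N ->
  (deg_fixed k G u)%:R + #|split_set k G u|%:R / 2 - p * n.-1%:R =
  dev_in u G + (dev_out u G + dev_out (partner u) G) / 2 :> R.
Proof.
move=> uk; rewrite /deg_fixed natrD.
have e1 : #|[set v in ~: outer | adj G u v]|%:R = p * (k + k).-1%:R + dev_in u G :> R.
  have -> : [set v in ~: outer | adj G u v] = [set v in ~: outer :\ u | adj G u v].
    apply/finset.setP => v; rewrite !inE; case: eqVneq => // ->.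
    by rewrite adjxx !andbF.
  rewrite card_adj_sum; congr (_ * _%:R + _).
  have := cardsD1 u (~: outer); rewrite !inE -ltnNge uk add1n => h.
  have := cardsC outer; rewrite card_outer card_ord h => h2.
  have h3 (c : nat) : (n - (k + k) + c.+1 = n)%N -> c = (k + k).-1.
    by move: hk uk; lia.
  exact: h3 h2.
have e2 : #|[set y in outer | adj G u y && adj G (partner u) y]|%:R +
   #|split_set k G u|%:R / 2 = p * (n - (k + k))%:R +
     (dev_out u G + dev_out (partner u) G) / 2 :> R.
  transitivity ((#|[set v in outer | adj G u v]|%:R +
    #|[set v in outer | adj G (partner u) v]|%:R) / 2 : R).
    rewrite -!sum_indic_card !mulr_suml -!big_split/= mulr_suml.
    apply: eq_bigr => y _; rewrite !inE.
    by case: (k + k <= y)%N; case: (adj G u y); case: (adj G (partner u) y) => /=; field.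
  by rewrite !card_adj_sum card_outer /dev_out; field.
rewrite -[X in X - _ = _]addrA e1 e2.
have -> : n.-1%:R = (k + k).-1%:R + (n - (k + k))%:R :> R.
  by rewrite -natrD; congr (_%:R); move: uk hk; lia.
by field.
Qed.

(** The indicator of exactly one adjacency is a + b - 2ab; substitute a = p + eta and b = p + eta'
    and sum over the outer vertices. *)
Lemma split_set_dev G u : (u < k + k)%N -> #|split_set k G u|%:R =
  2 * (p * (1 - p)) * (n - (k + k))%:R +
  (1 - 2 * p) * (dev_out u G + dev_out (partner u) G) - 2 * codev u G :> R.
Proof.
move=> uk.
transitivity (\sum_(y in outer) (2 * (p * (1 - p)) +
    (1 - 2 * p) * (eta p u y G + eta p (partner u) y G) -
    2 * (eta p u y G * eta p (partner u) y G)) : R); last first.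
  by rewrite sumrB big_split/= sumr_const -!mulr_sumr big_split/= card_outer mulr_natr.
rewrite -sum_indic_card [RHS]big_mkcond/=.
apply: eq_bigr => y _; rewrite !inE /eta.
by case: (k + k <= y)%N; case: (adj G u y); case: (adj G (partner u) y) => /=; ring.
Qed.

Lemma typical_partner_dev (t : R) G i : (i < k)%N -> typical t G i ->
  [/\ `|(deg_fixed k G i)%:R + #|split_set k G i|%:R / 2 - p * n.-1%:R| <= 2 * t,
      `|(deg_fixed k G (partner i))%:R + #|split_set k G i|%:R / 2 - p * n.-1%:R| <= 2 * t &
      2 * (p * (1 - p)) * (n - (k + k))%:R - 4 * t <= #|split_set k G i|%:R].
Proof.
case/andP: (hp) => p0 p1.
move=> ik /and5P[h1 h2 h3 h4 h5].
have ikk : (i < k + k)%N by apply: leq_trans ik (leq_addr _ _).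
have pkk : (partner i < k + k)%N by rewrite partner_lt.
have e1 := deg_fixed_dev G ikk.
have e2 := deg_fixed_dev G pkk.
rewrite split_set_partner// partnerK// in e2.
have e3 := split_set_dev G ikk.
rewrite e1 e2 e3.
move: h1 h2 h3 h4 h5; rewrite !ltr_norml => /andP[a1 b1] /andP[a2 b2] /andP[a3 b3].
move=> /andP[a4 b4] /andP[a5 b5].
split; [by rewrite ler_norml; apply/andP; split; lra..|].
have : - (2 * t) <= (1 - 2 * p) * (dev_out i G + dev_out (partner i) G).
  have : `|(1 - 2 * p) * (dev_out i G + dev_out (partner i) G)| <= 1 * (2 * t).
    rewrite normrM ler_pM// ler_norml; apply/andP; split; lra.
  by rewrite mul1r ler_norml => /andP[].
by move: (_ * (dev_out i G + _)) => z; lra.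
Qed.
End typical_pairs.

(** * Existence of an induced subgraph with prescribed size *)

Section chain.
Variables (R : realType) (p : R) (n k : nat).
Hypothesis hk : (k + k <= n)%N.
Variables (G : graph n) (Q : {set 'I_n}) (lo hi K : R).
Implicit Types (i u : 'I_n) (W : {set 'I_n}).

Local Notation partner := (@partner n k).
Let dd u : R := (deg G u)%:R - p * n.-1%:R.

Hypothesis hQ : forall i, i \in Q -> (i < k)%N.
Hypothesis hgood : forall i, i \in Q ->
  (lo <= dd i <= hi) && (lo <= - dd (partner i) <= hi).
Hypotheses (lo0 : 0 <= lo) (hi0 : 0 <= hi).
Hypothesis hK : `|K| <= #|Q|%:R * lo - #|Q|%:R ^+ 2.

Let sel W i := if i \in W then partner i else i.
Let Uset W := [set sel W i | i in Q].
Let err (U : {set 'I_n}) : R :=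
  K - \sum_(u in U) dd u + #|induced_edges G U|%:R.

Let pidx_sel W i : i \in Q -> pidx k (sel W i) = i.
Proof.
move=> iQ; have ik := hQ iQ; rewrite /sel; case: ifP => _; last exact: pidx_lt.
by rewrite pidx_partner ?pidx_lt//; apply: leq_trans ik (leq_addr _ _).
Qed.

Let sel_inj W : {in Q &, injective (sel W)}.
Proof.
by move=> i j iQ jQ /(congr1 (pidx k)); rewrite !pidx_sel.
Qed.

Let sel_lt W i : i \in Q -> (sel W i < k + k)%N.
Proof.
move=> iQ; have ik : (i < k + k)%N by apply: leq_trans (hQ iQ) (leq_addr _ _).
by rewrite /sel; case: ifP => _; rewrite ?partner_lt.
Qed.

Let card_Uset W : #|Uset W| = #|Q|.
Proof. by rewrite card_in_imset//; exact: sel_inj. Qed.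

Let sum_Uset W : \sum_(u in Uset W) dd u = \sum_(i in Q) dd (sel W i).
Proof. by rewrite big_imset//; exact: sel_inj. Qed.

Let induced_Uset_le W : #|induced_edges G (Uset W)|%:R <= #|Q|%:R ^+ 2 :> R.
Proof. by rewrite -natrX ler_nat -(card_Uset W) induced_le_sqr. Qed.

(** The empty W takes the high-degree vertex of every pair and W = Q the low-degree one, so the two
    degree sums bracket K. The term |Q|^2 in [hK] absorbs the edges inside the chosen set. *)
Let err_set0 : err (Uset finset.set0) <= 0.
Proof.
have h : #|Q|%:R * lo <= \sum_(i in Q) dd (sel finset.set0 i).
  rewrite mulr_natl -sumr_const; apply: ler_sum => i iQ.
  by rewrite /sel inE; have /andP[/andP[]] := hgood iQ.
have h2 := induced_Uset_le finset.set0.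
by rewrite /err sum_Uset; move: hK; rewrite ler_norml => /andP[_ h3]; lra.
Qed.

Let err_Q : 0 <= err (Uset Q).
Proof.
have h : #|Q|%:R * lo <= \sum_(i in Q) - dd (sel Q i).
  rewrite mulr_natl -sumr_const; apply: ler_sum => i iQ.
  by rewrite /sel iQ; have /andP[_ /andP[]] := hgood iQ.
rewrite sumrN in h.
have h2 : 0 <= #|induced_edges G (Uset Q)|%:R :> R by rewrite ler0n.
have h4 : 0 <= #|Q|%:R ^+ 2 :> R by exact: sqr_ge0.
by rewrite /err sum_Uset; move: hK; rewrite ler_norml => /andP[h3 _]; lra.
Qed.

Let err_step W i : i \in Q -> i \notin W ->
  `|err (Uset (i |: W)) - err (Uset W)| <= 2 * hi + #|Q|%:R.
Proof.
move=> iQ iW.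
set U' := sel W @: (Q :\ i).
have eW : Uset W = i |: U'.
  by rewrite /Uset -{1}(finset.setD1K iQ) imsetU1 /sel (negbTE iW).
have eiW : Uset (i |: W) = partner i |: U'.
  rewrite /Uset -{1}(finset.setD1K iQ) imsetU1 {1}/sel setU11; congr (_ |: _).
  apply: eq_in_imset => j; rewrite !inE /sel => /andP[ji _].
  by rewrite !inE (negbTE ji).
have cU' : (#|U'| < #|Q|)%N.
  apply: leq_ltn_trans (leq_imset_card _ _) _.
  by rewrite (cardsD1 i Q) iQ ltnS.
have i1 : i \notin U'.
  apply/imsetP => -[j]; rewrite !inE => /andP[ji jQ] /(congr1 (pidx k)).
  rewrite pidx_sel// pidx_lt ?hQ// => e; by rewrite e eqxx in ji.
have ikk : (i < k + k)%N by apply: leq_trans (hQ iQ) (leq_addr _ _).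
have i2 : partner i \notin U'.
  apply/imsetP => -[j]; rewrite !inE => /andP[ji jQ] /(congr1 (pidx k)).
  rewrite pidx_sel// pidx_partner// pidx_lt ?hQ// => e; by rewrite e eqxx in ji.
have /andP[a1 b1] := induced_setU1 G i1.
have /andP[a2 b2] := induced_setU1 G i2.
have /andP[/andP[c1 c2] /andP[c3 c4]] := hgood iQ.
rewrite /err eW eiW !big_setU1//=.
move: a1 b1 a2 b2 cU'; rewrite -!(ler_nat R) !natrD -(natr1 #|U'|) => a1 b1 a2 b2 cU'.
move: (dd i) (dd (partner i)) c1 c2 c3 c4 (\sum_(u in U') dd u) => x y c1 c2 c3 c4 s.
move: a1 b1 a2 b2 cU' lo0 hi0 c1 c2 c3 c4.
move: (#|_|%:R) (#|_|%:R) (#|_|%:R) (#|_|%:R) => z1 z2 z3 z4.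
by move=> *; rewrite ler_norml; apply/andP; split; lra.
Qed.

(* Take W maximal in Q with err (Uset W) <= 0: adding one more index crosses 0. *)
Lemma balanced_transversal : exists U : {set 'I_n},
  [/\ #|U| = #|Q|, forall u, u \in U -> (u < k + k)%N && (pidx k u \in Q) &
      `|K - \sum_(u in U) ((deg G u)%:R - p * n.-1%:R) + #|induced_edges G U|%:R|
        <= hi + #|Q|%:R].
Proof.
have fin W : `|err (Uset W)| <= hi + #|Q|%:R ->
    exists U : {set 'I_n}, [/\ #|U| = #|Q|,
      forall u, u \in U -> (u < k + k)%N && (pidx k u \in Q) &
      `|err U| <= hi + #|Q|%:R].
  move=> h; exists (Uset W); split=> //.
  by move=> _ /imsetP[i iQ ->]; rewrite sel_lt// pidx_sel.
pose P W := (W \subset Q) && (err (Uset W) <= 0).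
have P0 : P finset.set0 by rewrite /P finset.sub0set.
have [W /maxsetP[/andP[WQ eW0] Wmax] _] := maxset_exists P0.
have Q0 : (0 : R) <= #|Q|%:R by rewrite ler0n.
case: (boolP (Q \subset W)) => QW.
  apply: (fin W); have e0 : err (Uset W) = 0.
    apply/eqP; rewrite eq_le eW0.
    by rewrite (_ : W = Q) ?err_Q//; apply/eqP; rewrite finset.eqEsubset WQ.
  by rewrite e0 normr0 addr_ge0.
move/subsetPn: QW => [i iQ iW].
have st := err_step iQ iW.
have pos : 0 < err (Uset (i |: W)).
  rewrite ltNge; apply/negP => neg.
  have := Wmax (i |: W); rewrite /P neg andbT.
  rewrite finset.subUset finset.sub1set iQ WQ => /(_ isT (finset.subsetUr _ _)) e.
  by move: iW; rewrite -e setU11.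
move: st; rewrite ler_norml => /andP[_ st].
(* The crossing step has length at most 2 hi + |Q|, so one of its two ends is within hi + |Q| of
   0. *)
case: (lerP (- (hi + #|Q|%:R)) (err (Uset W))) => h.
  by apply: (fin W); rewrite ler_norml h/=; lra.
by apply: (fin (i |: W)); rewrite ler_norml; apply/andP; split; lra.
Qed.
End chain.

(** The partners share the h split vertices, z to one and h - z to the other; their degrees deviate
    by z - h/2 and its negative, up to 2t. *)
Lemma shift_bounds (R : realType) (lo hi t g1 g2 f1 f2 z h c : R) :
  g1 = f1 + z -> g2 + z = f2 + h ->
  `|f1 + h / 2 - c| <= 2 * t -> `|f2 + h / 2 - c| <= 2 * t ->
  lo + 2 * t <= z - h / 2 <= hi - 2 * t ->
  (lo <= g1 - c <= hi) && (lo <= - (g2 - c) <= hi).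
Proof.
move=> e1 e2; rewrite !ler_norml => /andP[b1 b2] /andP[b3 b4] /andP[b5 b6].
by apply/andP; split; apply/andP; split; lra.
Qed.

(** This is [induced_compl] for the complete graph; multiplied by p it supplies the means. *)
Lemma bin2_compl (n m : nat) : (m <= n)%N ->
  ('C(n, 2) + 'C(m, 2) = 'C(n - m, 2) + m * n.-1)%N.
Proof.
move=> mn; have := subnKC mn; move: (n - m)%N => a <-.
have h (x : nat) : (2 * 'C(x, 2) + x = x * x)%N.
  by rewrite -mul_bin_diag bin1; case: x => // x; rewrite [RHS]mulnS addnC.
have hm : (m * (m + a).-1 + m = m * (m + a))%N.
  by case: (m + a)%N (leq_addr a m) => [|b _]; [rewrite leqn0 => /eqP ->|rewrite mulnS addnC].
have := h (m + a)%N; have := h m; have := h a; move: hm; rewrite mulnDl !mulnDr.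
move: ('C(m, 2)) ('C(a, 2)) ('C(m + a, 2)) (m * (m + a).-1)%N => u v w z.
by lia.
Qed.

(** * Removing M coarse vertices and one fine vertex *)

Section exact_subgraph.
Variables (R : realType) (p : R).
Hypothesis hp : 0 < p < 1.
Variables (n r : nat).
Let k := (r + r)%N.
Hypothesis hk : (k + k <= n)%N.
Hypothesis r0 : (0 < r)%N.
Implicit Types (G : graph n) (i u x : 'I_n).

Local Notation partner := (@partner n k).
Let dd G u : R := (deg G u)%:R - p * n.-1%:R.

(** Coarse and fine pairs both lie below k + k, so each of the two exchanges leaves the edges among
    all of them in place. *)
Definition coarse : {set 'I_n} := [set i : 'I_n | (i < r)%N].
Definition fine : {set 'I_n} := [set i : 'I_n | (r <= i < k)%N].

Lemma card_coarse : #|coarse| = r.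
Proof.
have rn : (r <= n)%N by move: hk; rewrite /k; lia.
have finj : injective (widen_ord rn).
  by move=> a b /(congr1 val) /= h; apply: val_inj.
rewrite -[RHS]card_ord -(card_imset _ finj); apply: eq_card => v.
rewrite !inE; apply/idP/imsetP => [h|[a _ ->]] //=.
by exists (Ordinal h) => //; apply: val_inj.
Qed.

Lemma card_fine : #|fine| = r.
Proof.
have lt (a : 'I_r) : (r + a < n)%N by have := ltn_ord a; move: hk; rewrite /k; lia.
pose f (a : 'I_r) : 'I_n := Ordinal (lt a).
have finj : injective f.
  by move=> a b /(congr1 val) /= h; apply: val_inj => /=; lia.
rewrite -[RHS]card_ord -(card_imset _ finj); apply: eq_card => v.
rewrite !inE; apply/idP/imsetP => [/andP[h1 h2]|[a _ ->]] /=.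
  have h3 : (v - r < r)%N by move: h2; rewrite /k; lia.
  by exists (Ordinal h3) => //; apply: val_inj => /=; lia.
by have := ltn_ord a; rewrite /k; lia.
Qed.

Lemma coarse_lt i : i \in coarse -> (i < k)%N.
Proof. by rewrite inE /k; lia. Qed.

Lemma fine_lt i : i \in fine -> (i < k)%N.
Proof. by rewrite inE => /andP[]. Qed.

Variables (t lo hi h0 : R).
Hypotheses (t0 : 0 < t) (lo0 : 0 <= lo) (hi0 : 0 <= hi).
Hypothesis hh0 : h0 <= 2 * (p * (1 - p)) * (n - (k + k))%:R - 4 * t.

Definition extreme G i : bool :=
  (lo <= dd G i <= hi) && (lo <= - dd G (partner i) <= hi).

Lemma coin_few_half (J : {set 'I_n}) (E : 'I_n -> pred {set 'I_n}) (pi : R) (M : nat) :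
  0 <= pi -> r%:R / 2 <= #|J|%:R :> R ->
  (forall i, i \in J -> pi <= #|[set A | E i A]|%:R / 2 ^+ n) ->
  #|[set w : {ffun 'I_n -> {set 'I_n}} | (#|[set i in J | E i (w i)]| < M)%N]|%:R <=
  2 ^+ M * expR (- (pi / 2 * (r%:R / 2))) * #|{ffun 'I_n -> {set 'I_n}}|%:R.
Proof.
move=> pi0 cJ hE; apply: le_trans (@coin_few R _ J E pi M pi0 _) _.
  by move=> i iJ; rewrite card_ord; exact: hE.
rewrite ler_wpM2r// ler_wpM2l ?exprn_ge0// ler_expR lerN2 ler_wpM2l//.
by rewrite divr_ge0.
Qed.

Lemma Gnp_prob_few_extreme (pi : R) (M : nat) : 0 <= pi ->
  (forall h : nat, h0 <= h%:R -> (h <= n)%N ->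
    pi <= \sum_(z < h.+1 | lo + 2 * t <= z%:R - h%:R / 2 <= hi - 2 * t)
            binp 2^-1 h z) ->
  Gnp_prob p (fun G => (#|[set i in coarse | extreme G i]| < M)%N) <=
  10 * n%:R / t ^+ 2 + 2 ^+ M * expR (- (pi / 2 * (r%:R / 2))).
Proof.
move=> pi0 hpi.
pose T G := r%:R / 2 <= #|[set i in coarse | typical p k t G i]|%:R :> R.
have := @swap_symmetrization n k coarse hk R p hp T
  (fun G => (#|[set i in coarse | extreme G i]| < M)%N)
  (2 ^+ M * expR (- (pi / 2 * (r%:R / 2)))).
move=> /(_ _ _)/le_trans; apply.
- by rewrite mulr_ge0 ?exprn_ge0 ?expR_ge0.
(* Typicality is tested on G before the exchange, so J' does not depend on the coins and its pairs
   behave independently. *)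
- move=> G TG; set J' := [set i in coarse | typical p k t G i].
  pose E i (A : {set 'I_n}) : bool := lo + 2 * t <=
    #|split_set k G i :&: symdiff A (nbr_out k G i)|%:R -
    #|split_set k G i|%:R / 2 <= hi - 2 * t.
  have hE i : i \in J' -> pi <= #|[set A | E i A]|%:R / 2 ^+ n.
    rewrite inE => /andP[iC typ].
    have [_ _ hs] := typical_partner_dev hp hk (coarse_lt iC) typ.
    have := @coin_law R _ (split_set k G i) (nbr_out k G i)
      (fun z => lo + 2 * t <= z%:R - #|split_set k G i|%:R / 2 <= hi - 2 * t).
    rewrite card_ord => ->; apply: hpi; first exact: le_trans hh0 hs.
    by rewrite -[X in (_ <= X)%N](card_ord n) max_card.
  apply: le_trans (coin_few_half M pi0 TG hE).
  rewrite ler_nat; apply/subset_leq_card/fintype.subsetP => w; rewrite !inE.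
  apply: leq_ltn_trans; apply/subset_leq_card/fintype.subsetP => i.
  rewrite !inE => /andP[/andP[ir typ] Ei].
  have iC : i \in coarse by rewrite inE.
  have ik := coarse_lt iC.
  have ikk : (i < k + k)%N by apply: leq_trans ik (leq_addr _ _).
  rewrite ir /= /extreme.
  have [a1 a2 _] := typical_partner_dev hp hk ik typ.
  have d1 := @deg_swap_graph_in n k coarse hk w G i ikk.
  have d2 := @deg_swap_graph_partner n k coarse hk w G i ikk.
  rewrite pidx_lt// in d1 d2.
  apply: shift_bounds a1 a2 Ei; first by rewrite d1// natrD.
  by rewrite -natrD d2// natrD.
- rewrite lerD2r.
  apply: (@le_trans _ _ (Gnp_prob p (fun G =>
    #|[set i in coarse | typical p k t G i]|%:R < #|coarse|%:R / 2 :> R))).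
    by apply: le_Gnp_prob => // G; rewrite /T -ltNge card_coarse.
  apply: Gnp_prob_few_typical => //; first by rewrite card_coarse.
  exact: coarse_lt.
Qed.

Variables (M e : nat) (s pi : R).
Hypothesis Mn : (M < n)%N.
Hypothesis pi0 : 0 <= pi.
Hypothesis hpi : forall h z : nat, h0 <= h%:R -> (h <= n)%N ->
  `|z%:R - h%:R / 2| <= s -> pi <= binp 2^-1 h z.
Hypothesis hs0 : s <= h0 / 2.
Hypothesis hs : hi + 2 * M%:R + 2 * t <= s.

(** What the degree deviations of the M + 1 removed vertices must sum to for an exact hit, up to the
    number of edges among them. *)
Definition surplus G : R := #|G|%:R - p * 'C(n, 2)%:R -
  (e%:R - p * 'C(n - M.+1, 2)%:R) - p * 'C(M.+1, 2)%:R.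

Let hit G := has_induced G (n - M.+1) e.

Let few G := (#|[set i in coarse | extreme G i]| < M)%N.

Let dok G := `|surplus G| <= M%:R * lo - M%:R ^+ 2.

Lemma deg_swap_fine w G u : (u < k + k)%N -> pidx k u \in coarse ->
  deg (swap_graph k fine w G) u = deg G u.
Proof.
move=> uk uC; apply: deg_swap_graph_out => //.
by move: uC; rewrite !inE => h; rewrite (leqNgt r) h.
Qed.

Lemma extreme_swap_fine w G i : i \in coarse ->
  extreme (swap_graph k fine w G) i = extreme G i.
Proof.
move=> iC; have ik := coarse_lt iC.
have ikk : (i < k + k)%N by apply: leq_trans ik (leq_addr _ _).
rewrite /extreme /dd !deg_swap_fine ?partner_lt ?pidx_partner ?pidx_lt//.
Qed.

Lemma few_swap_fine w G : few (swap_graph k fine w G) = few G.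
Proof.
rewrite /few; congr (_ < _)%N; apply: eq_card => i; rewrite !inE.
by case: (boolP (i < r)%N) => //= ir; rewrite extreme_swap_fine// inE.
Qed.

(* The single vertex x removed in addition to U can be chosen among many fine
   vertices, and its degree must take one prescribed value. *)
Lemma exact_from_degree G (U : {set 'I_n}) x : #|U| = M -> x \notin U ->
  (#|G| + #|induced_edges G (x |: U)| = e + \sum_(u in U) deg G u + deg G x)%N ->
  hit G.
Proof.
move=> cU xU h; apply/existsP; exists (~: (x |: U)).
apply/andP; split.
  by rewrite cardsCs finset.setCK cardsU1 xU cU card_ord add1n.
have := induced_compl G (x |: U); rewrite big_setU1//= h.
by rewrite -[RHS]addnA [X in _ = (_ + X)%N]addnC => /addIn ->.
Qed.

(** The number of split vertices that x must receive is within s of the middle h/2. The budget [hs]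
    collects hi + M left over by U, M for the edges from x to U, and 2t for the centring of the
    degree of x. *)
Lemma surplus_degree G (U : {set 'I_n}) (y f h : R) : #|U| = M ->
  `|surplus G - \sum_(u in U) dd G u + #|induced_edges G U|%:R| <= hi + M%:R ->
  #|induced_edges G U|%:R <= y <= #|induced_edges G U|%:R + M%:R ->
  `|f + h / 2 - p * n.-1%:R| <= 2 * t ->
  `|(#|G|%:R + y - (e%:R + \sum_(u in U) (deg G u)%:R + f)) - h / 2| <= s.
Proof.
move=> cU; rewrite /dd sumrB sumr_const cU /surplus.
have : 'C(n, 2)%:R + 'C(M.+1, 2)%:R =
    'C(n - M.+1, 2)%:R + (M%:R + 1) * n.-1%:R :> R.
  by rewrite natr1 -natrM -!natrD (bin2_compl Mn).
rewrite -[(p * _) *+ M]mulr_natr.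
move: ('C(n, 2)%:R : R) ('C(M.+1, 2)%:R : R) ('C(n - M.+1, 2)%:R : R) => b1 b2 b3.
move: (#|G|%:R : R) (#|induced_edges G U|%:R : R) => g a.
move: (\sum_(u in U) (deg G u)%:R : R) (n.-1%:R : R) => d c.
move=> h1; have -> : b1 = b3 + (M%:R + 1) * c - b2 by rewrite -h1; ring.
rewrite !ler_norml => /andP[h2 h3] /andP[h4 h5] /andP[h6 h7].
by apply/andP; split; move: hs; lra.
Qed.

Lemma Gnp_prob_no_exact :
  Gnp_prob p (fun G => [&& dok G, ~~ few G & ~~ hit G]) <=
  10 * n%:R / t ^+ 2 + 2 * expR (- (pi / 2 * (r%:R / 2))).
Proof.
pose typ G := r%:R / 2 <= #|[set i in fine | typical p k t G i]|%:R :> R.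
(* [dok] and [few] are invariant under the fine exchange, so for G violating the premise no swapped
   graph is counted. *)
pose T G := (dok G && ~~ few G) ==> typ G.
have := @swap_symmetrization n k fine hk R p hp T
  (fun G => [&& dok G, ~~ few G & ~~ hit G]) (2 * expR (- (pi / 2 * (r%:R / 2)))).
move=> /(_ _ _)/le_trans; apply.
- by rewrite mulr_ge0 ?expR_ge0.
- move=> G; rewrite /T.
  case: (boolP (dok G && ~~ few G)) => /= [/andP[dG fG]|nG] tG; last first.
    rewrite (_ : [set w | _] = finset.set0) ?cards0 ?mulr_ge0 ?expR_ge0//.
    apply/finset.setP => w; rewrite !inE few_swap_fine /dok /surplus card_swap_graph//.
    by rewrite andbA -/(surplus G) -/(dok G) (negbTE nG).
  have [Q QE cQ] : exists2 Q : {set 'I_n},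
      Q \subset [set i in coarse | extreme G i] & #|Q| = M.
    move: fG; rewrite -leqNgt => /card_geqP[q [uq sq subq]].
    exists [set i in q]; last by rewrite cardsE (card_uniqP uq).
    by apply/fintype.subsetP => i; rewrite inE => /subq.
  have hQ i : i \in Q -> (i < k)%N.
    by move=> /(fintype.subsetP QE); rewrite inE => /andP[/coarse_lt].
  have gQ i : i \in Q -> (lo <= (deg G i)%:R - p * n.-1%:R <= hi) &&
      (lo <= - ((deg G (partner i))%:R - p * n.-1%:R) <= hi).
    by move=> /(fintype.subsetP QE); rewrite inE => /andP[].
  have := balanced_transversal hk hQ gQ lo0 hi0; rewrite cQ.
  move=> /(_ _ dG)[U [cU hU errU]].
  set J' := [set i in fine | typical p k t G i].
  have pU x : x \in J' -> x \notin U.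
    rewrite inE => /andP[xF _]; apply/negP => /hU /andP[_].
    rewrite pidx_lt ?fine_lt// => /(fintype.subsetP QE).
    by move: xF; rewrite !inE => /andP[h _]; rewrite ltnNge h.
  (* U is taken from G, and the fine exchange changes neither |G|, nor the degrees on U, nor the
     edges inside U and x. The required count is thus fixed before the coins are tossed. *)
  pose Z x := (#|G| + #|induced_edges G (x |: U)| -
    (e + \sum_(u in U) deg G u + deg_fixed k G x))%N.
  pose E x (A : {set 'I_n}) : bool :=
    #|split_set k G x :&: symdiff A (nbr_out k G x)| == Z x.
  have hZ x : x \in J' ->
    [/\ (e + \sum_(u in U) deg G u + deg_fixed k G x <=
          #|G| + #|induced_edges G (x |: U)|)%N,
        `|(Z x)%:R - #|split_set k G x|%:R / 2| <= s :> R &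
        h0 <= #|split_set k G x|%:R].
    move=> xJ; have xU := pU x xJ; move: xJ; rewrite inE => /andP[xF typx].
    have [f1 _ f3] := typical_partner_dev hp hk (fine_lt xF) typx.
    have h3 := le_trans hh0 f3.
    have /andP[g1 g2] := induced_setU1 G xU; rewrite cU in g2.
    pose X : R := #|G|%:R + #|induced_edges G (x |: U)|%:R -
      (e%:R + \sum_(u in U) (deg G u)%:R + (deg_fixed k G x)%:R).
    have hd : `|X - #|split_set k G x|%:R / 2| <= s.
      by apply: (surplus_degree cU errU _ f1); rewrite -natrD !ler_nat g1.
    (* Ensures that the truncated subtraction in [Z] is a true one; this is the role of s <=
       h0/2. *)
    have X0 : 0 <= X.
      clearbody X; move: hd hs0 h3; rewrite ler_norml => /andP[+ _].
      by move: (#|split_set k G x|%:R : R) => h; lra.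
    have le : (e + \sum_(u in U) deg G u + deg_fixed k G x <=
          #|G| + #|induced_edges G (x |: U)|)%N.
      by rewrite -(ler_nat R) (natrD _ #|G|) (natrD _ (e + _)) (natrD _ e) natr_sum -subr_ge0.
    split=> //; rewrite natrB// (natrD _ #|G|) (natrD _ (e + _)) (natrD _ e) natr_sum.
    exact: hd.
  have hE x : x \in J' -> pi <= #|[set A | E x A]|%:R / 2 ^+ n.
    move=> xJ; have [_ z1 z2] := hZ x xJ.
    have := @coin_law R _ (split_set k G x) (nbr_out k G x) (pred1 (Z x)).
    rewrite card_ord => ->.
    have zlt : (Z x < #|split_set k G x|.+1)%N.
      rewrite ltnS -(ler_nat R).
      by move: z1; rewrite ler_norml => /andP[_ z1]; move: hs0 z1 z2; lra.
    rewrite (big_pred1 (Ordinal zlt)); last by move=> z; rewrite /= -val_eqE.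
    apply: hpi => //.
    by rewrite -[X in (_ <= X)%N](card_ord n) max_card.
  (* Fewer than one success means none, and 2^1 is the factor 2 of the bound. *)
  apply: le_trans (coin_few_half 1 pi0 tG hE).
  rewrite ler_nat; apply/subset_leq_card/fintype.subsetP => w; rewrite !inE.
  move=> /and3P[_ _]; rewrite ltnS leqNgt; apply: contra.
  rewrite card_gt0 => /set0Pn[x]; rewrite inE => /andP[xJ Ex].
  have xU := pU x xJ; have [z1 _ _] := hZ x xJ.
  have xF : x \in fine by move: xJ; rewrite inE => /andP[].
  have xk := fine_lt xF.
  have xkk : (x < k + k)%N by apply: leq_trans xk (leq_addr _ _).
  apply: (exact_from_degree cU xU).
  rewrite card_swap_graph// induced_swap_graph//; last first.
    by move=> u; rewrite !inE => /orP[/eqP ->//|/hU /andP[]].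
  rewrite (eq_bigr (deg G)); last first.
    move=> u /hU /andP[uk uQ]; apply: deg_swap_fine => //.
    by move/(fintype.subsetP QE): uQ; rewrite inE => /andP[].
  rewrite deg_swap_graph_in// pidx_lt//.
  by move: Ex z1; rewrite /E /Z => /eqP -> z1; rewrite addnA subnKC.
- rewrite lerD2r.
  apply: (@le_trans _ _ (Gnp_prob p (fun G =>
    #|[set i in fine | typical p k t G i]|%:R < #|fine|%:R / 2 :> R))).
    apply: le_Gnp_prob => // G; rewrite /T negb_imply => /andP[_].
    by rewrite /typ -ltNge card_fine.
  apply: Gnp_prob_few_typical => //; first by rewrite card_fine.
  exact: fine_lt.
Qed.

Lemma Gnp_prob_no_exact_le (pi1 : R) : 0 <= pi1 ->
  (forall h : nat, h0 <= h%:R -> (h <= n)%N ->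
    pi1 <= \sum_(z < h.+1 | lo + 2 * t <= z%:R - h%:R / 2 <= hi - 2 * t)
            binp 2^-1 h z) ->
  Gnp_prob p (fun G => (`|surplus G| <= M%:R * lo - M%:R ^+ 2) &&
                       ~~ has_induced G (n - M.+1) e) <=
  20 * n%:R / t ^+ 2 + 2 ^+ M * expR (- (pi1 / 2 * (r%:R / 2))) +
  2 * expR (- (pi / 2 * (r%:R / 2))).
Proof.
move=> pi10 hpi1.
have h1 := Gnp_prob_few_extreme M pi10 hpi1.
have h2 := Gnp_prob_no_exact.
apply: (@le_trans _ _ (Gnp_prob p few +
  Gnp_prob p (fun G => [&& dok G, ~~ few G & ~~ hit G]))).
  apply: Gnp_prob_union => // G; rewrite -/(dok G) -/(hit G).
  by case: (few G).
have -> : 20 * n%:R / t ^+ 2 = 10 * n%:R / t ^+ 2 + 10 * n%:R / t ^+ 2 by ring.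
move: h1 h2; rewrite -/few; move: (10 * n%:R / t ^+ 2) => z; lra.
Qed.

End exact_subgraph.

Local Open Scope classical_set_scope.
Local Open Scope ring_scope.

(** * Asymptotics *)

Section limn_inf_sup_bounds.
Variables (R : realType) (u : nat -> R).
Hypothesis u01 : forall n, 0 <= u n <= 1.

Let bounded_u : bounded_fun (u : nat -> R^o).
Proof.
exists 1; split; first exact: num_real.
move=> x x1 n _ /=; have /andP[h0 h1] := u01 n.
by rewrite ger0_norm//; apply: le_trans h1 (ltW x1).
Qed.

Let has_lb_sdrop n : has_lbound (sdrop u n).
Proof. by exists 0 => _ [m _ <-]; have /andP[] := u01 m. Qed.

Let has_ub_sdrop n : has_ubound (sdrop u n).
Proof. by exists 1 => _ [m _ <-]; have /andP[] := u01 m. Qed.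

Let infs_le n m : (n <= m)%N -> infs u n <= u m.
Proof. by move=> nm; apply: ge_inf => //; exists m. Qed.

Let sups_ge n m : (n <= m)%N -> u m <= sups u n.
Proof. by move=> nm; apply: ub_le_sup => //; exists m. Qed.

Lemma limn_inf_ge (l : R) : (\forall n \near \oo, l <= u n) -> l <= limn_inf u.
Proof.
move=> [N _ hN]; rewrite limn_infE//.
apply: (@le_trans _ _ (infs u N)).
  by apply: lb_le_inf; [exists (u N), N => /=|move=> _ [m /= Nm <-]; exact: hN].
by apply: ub_le_sup; [exact: bounded_fun_has_ubound_infs|exists N].
Qed.

Lemma limn_sup_le (l : R) : (\forall n \near \oo, u n <= l) -> limn_sup u <= l.
Proof.
move=> [N _ hN]; rewrite limn_supE//.
apply: (@le_trans _ _ (sups u N)).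
  apply: ge_inf; last by exists N.
  by exists 0 => _ [n _ <-]; apply: le_trans (sups_ge (leqnn n)); have /andP[] := u01 n.
by apply: ge_sup; [exists (u N), N => /=|move=> _ [m /= Nm <-]; exact: hN].
Qed.

Lemma limn_inf_le_sup : limn_inf u <= limn_sup u.
Proof.
rewrite limn_infE// limn_supE//.
apply: ge_sup; first by exists (infs u 0%N), 0%N.
move=> _ [n _ <-]; apply: lb_le_inf; first by exists (sups u 0%N), 0%N.
move=> _ [m _ <-]; apply: (@le_trans _ _ (u (maxn n m))).
  by apply: infs_le; rewrite leq_maxl.
by apply: sups_ge; rewrite leq_maxr.
Qed.
End limn_inf_sup_bounds.

Section growth.
Variable R : realType.
Implicit Types (c K : R).

(** The order of the extreme degree deviations. Its product with [scale] is n, the order of D, which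
    explains the scale sqrt(n/ln n). *)
Definition sqrt_nln (n : nat) : R := Num.sqrt (n%:R * ln n%:R).

Lemma near_ln_ge K : \forall n \near \oo, K <= ln (n%:R : R).
Proof.
apply: filterS (nbhs_infty_ger (expR K)) => n hn.
by rewrite -[K]expRK ler_ln ?posrE ?expR_gt0// (lt_le_trans (expR_gt0 K)).
Qed.

Lemma near_ln_le c : 0 < c -> \forall n \near \oo, ln (n%:R : R) <= c * n%:R.
Proof.
move=> c0; near=> n.
have n1 : 1 <= n%:R :> R by near: n; exact: nbhs_infty_ger.
have n0 : 0 < n%:R :> R by lra.
set x := Num.sqrt (n%:R : R).
have x0 : 0 < x by rewrite sqrtr_gt0.
have xE : x ^+ 2 = n%:R by rewrite sqr_sqrtr// ltW.
have xc : 2 / c <= x.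
  have h : (2 / c) ^+ 2 <= n%:R by near: n; exact: nbhs_infty_ger.
  by rewrite -(@ler_pXn2r _ 2) ?xE ?nnegrE ?(ltW x0)// divr_ge0 ?(ltW c0).
rewrite -xE lnXn// -mulr_natl.
apply: (@le_trans _ _ (2 * x)); first by rewrite ler_wpM2l// ltW// ln_sublinear.
rewrite expr2 mulrA ler_wpM2r ?(ltW x0)//.
by rewrite mulrC -ler_pdivrMr.
Unshelve. all: by end_near.
Qed.

Lemma near_sqrt_nln_le c : 0 < c -> \forall n \near \oo, sqrt_nln n <= c * n%:R.
Proof.
move=> c0; near=> n.
have n1 : 1 <= n%:R :> R by near: n; exact: nbhs_infty_ger.
have hl : ln (n%:R : R) <= c ^+ 2 * n%:R.
  by near: n; apply: near_ln_le; rewrite exprn_gt0.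
have cn : 0 <= c * n%:R by rewrite mulr_ge0 ?(ltW c0).
rewrite /sqrt_nln -[leRHS]ger0_norm// -sqrtr_sqr ler_wsqrtr//.
by rewrite mulrC exprMn [n%:R ^+ 2]expr2 mulrA ler_wpM2r.
Unshelve. all: by end_near.
Qed.

Lemma near_sqrt_nln_ge K : \forall n \near \oo, K <= sqrt_nln n.
Proof.
near=> n.
have n1 : 1 <= n%:R :> R by near: n; exact: nbhs_infty_ger.
have l1 : 1 <= ln (n%:R : R) by near: n; exact: near_ln_ge.
have hK : K ^+ 2 <= n%:R by near: n; exact: nbhs_infty_ger.
apply: le_trans (ler_norm K) _; rewrite -sqrtr_sqr /sqrt_nln ler_wsqrtr//.
by apply: le_trans hK _; rewrite ler_peMr.
Unshelve. all: by end_near.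
Qed.

Lemma scaleM_ln n : 0 < ln (n%:R : R) -> scale R n * ln n%:R = sqrt_nln n.
Proof.
move=> l0; rewrite /scale /sqrt_nln.
have -> : n%:R * ln n%:R = (n%:R / ln n%:R) * ln (n%:R : R) ^+ 2.
  by rewrite expr2 mulrA divfK ?gt_eqF.
by rewrite [RHS]sqrtrM ?divr_ge0 ?(ltW l0)// sqrtr_sqr ger0_norm ?(ltW l0).
Qed.

Lemma scaleM_sqrt_nln n : 0 < ln (n%:R : R) -> scale R n * sqrt_nln n = n%:R.
Proof.
move=> l0; rewrite /scale /sqrt_nln -sqrtrM ?divr_ge0 ?(ltW l0)//.
rewrite (_ : n%:R / ln n%:R * (n%:R * ln n%:R) = n%:R ^+ 2 :> R).
  by rewrite sqrtr_sqr ger0_norm.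
by rewrite mulrACA mulVf ?gt_eqF// mulr1 expr2.
Qed.

Lemma scale_ge0 n : 0 <= scale R n.
Proof. exact: sqrtr_ge0. Qed.

Lemma near_scale_le c : 0 < c -> \forall n \near \oo, scale R n <= c * n%:R.
Proof.
move=> c0; near=> n.
have l1 : 1 <= ln (n%:R : R) by near: n; exact: near_ln_ge.
have h : sqrt_nln n <= c * n%:R by near: n; exact: near_sqrt_nln_le.
apply: le_trans h; rewrite -scaleM_ln; last by lra.
by rewrite ler_peMr ?scale_ge0.
Unshelve. all: by end_near.
Qed.

Lemma near_scale_le_sqrt_nln c : 0 < c ->
  \forall n \near \oo, scale R n <= c * sqrt_nln n.
Proof.
move=> c0; near=> n.
have l1 : c^-1 <= ln (n%:R : R) by near: n; exact: near_ln_ge.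
have ci : 0 < c^-1 by rewrite invr_gt0.
rewrite -scaleM_ln; last exact: lt_le_trans ci l1.
rewrite mulrCA ler_peMr ?scale_ge0//.
by rewrite mulrC -ler_pdivrMr// div1r.
Unshelve. all: by end_near.
Qed.

Lemma near_scale_sqr_le c : 0 < c ->
  \forall n \near \oo, scale R n ^+ 2 <= c * n%:R.
Proof.
move=> c0; near=> n.
have h : scale R n <= c * sqrt_nln n by near: n; exact: near_scale_le_sqrt_nln.
have l1 : 1 <= ln (n%:R : R) by near: n; exact: near_ln_ge.
rewrite expr2; apply: (@le_trans _ _ (scale R n * (c * sqrt_nln n))).
  by rewrite ler_wpM2l ?scale_ge0.
rewrite mulrCA scaleM_sqrt_nln//; lra.
Unshelve. all: by end_near.
Qed.

Lemma near_scale_ge K : \forall n \near \oo, K <= scale R n.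
Proof.
pose K1 := Num.max K 1.
have K10 : 0 < K1 by rewrite lt_max ltr01 orbT.
near=> n.
have l1 : 1 <= ln (n%:R : R) by near: n; exact: near_ln_ge.
have hl : ln (n%:R : R) <= (K1 ^+ 2)^-1 * n%:R.
  by near: n; apply: near_ln_le; rewrite invr_gt0 exprn_gt0.
apply: (@le_trans _ _ K1); first by rewrite le_max lexx.
rewrite -[K1]ger0_norm ?(ltW K10)// -sqrtr_sqr /scale ler_wsqrtr//.
rewrite ler_pdivlMr; last by lra.
by rewrite mulrC -ler_pdivlMr ?exprn_gt0// mulrC.
Unshelve. all: by end_near.
Qed.
End growth.

(** * Excess of the degrees and fluctuations of the number of edges *)

Section edge_count.
Variables (R : realType) (p : R).
Hypothesis hp : 0 < p < 1.

Lemma bin2R n : 'C(n, 2)%:R = n%:R * (n%:R - 1) / 2 :> R.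
Proof.
suff h : n%:R * (n%:R - 1) = 2 * 'C(n, 2)%:R :> R.
  by rewrite h mulrC mulrA mulVf ?mul1r// pnatr_eq0.
case: n => [|m]; first by rewrite bin0n mul0r mulr0.
have -> : m.+1%:R - 1 = m%:R :> R by rewrite -natr1 addrK.
by rewrite -!natrM -(mul_bin_diag m.+1 1) bin1.
Qed.

Lemma bin2_sqrt_bounds n : (2 <= n)%N ->
  n%:R / 2 <= Num.sqrt ('C(n, 2)%:R : R) <= n%:R.
Proof.
move=> n2; have n2R : 2 <= n%:R :> R by rewrite ler_nat.
have n0 : 0 <= n%:R :> R by rewrite ler0n.
apply/andP; split.
  rewrite -[leLHS]ger0_norm ?divr_ge0// -sqrtr_sqr ler_wsqrtr// bin2R.
  by rewrite exprMn expr2; nra.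
rewrite -[leRHS]ger0_norm// -sqrtr_sqr ler_wsqrtr// bin2R expr2; nra.
Qed.

Lemma near_prob_excess (d eps : R) : 0 < d -> 0 < eps ->
  \forall n \near \oo, Gnp_prob p (fun G : graph n => d * n%:R <=
    excess p (22 / 19 * Num.sqrt (p * (1 - p)) * sqrt_nln R n) G) <= eps.
Proof.
(* The constant 22/19 enters here: (22/19)^2 = 484/361 exceeds 4/3. *)
have aux (z : R) : 1 <= z -> - (3 / 8 * ((22 / 19) ^+ 2 * z)) <= - z / 2 by lra.
case/andP: (hp) => p0 p1 d0 eps0.
set a := 22 / 19 * Num.sqrt (p * (1 - p)).
have q0 : 0 < p * (1 - p) by apply: mulr_gt0; lra.
set q := p * (1 - p) in q0 *.
have a0 : 0 < a.
  by have : 0 < Num.sqrt q by [rewrite sqrtr_gt0]; rewrite /a; move: (Num.sqrt q) => z; lra.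
have aE : a ^+ 2 = (22 / 19) ^+ 2 * q.
  by rewrite exprMn sqr_sqrtr ?(ltW q0).
(* l = b S / n minimises (2/3) l^2 q n - l a S, with minimum - (3/8) (a^2/q) ln n. *)
pose b := 3 / 4 * a / q.
have b0 : 0 < b by rewrite /b divr_gt0// mulr_gt0.
near=> n.
have n1 : 1 <= n%:R :> R by near: n; exact: nbhs_infty_ger.
have n0 : 0 < n%:R :> R by lra.
have S1 : 1 <= sqrt_nln R n by near: n; exact: near_sqrt_nln_ge.
have L1 : 1 <= ln (n%:R : R) by near: n; exact: near_ln_ge.
have Sn : sqrt_nln R n <= (b^-1 / 100) * n%:R.
  by near: n; apply: near_sqrt_nln_le; rewrite divr_gt0 ?invr_gt0.
have hL : (2 / (eps * d * b)) ^+ 2 <= ln (n%:R : R).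
  by near: n; exact: near_ln_ge.
move: S1 L1 Sn hL; set S := sqrt_nln R n => S1; set L := ln (n%:R : R) => L1 Sn hL.
have S0 : 0 < S := lt_le_trans ltr01 S1.
have L0 : 0 <= L := le_trans ler01 L1.
have SE : S ^+ 2 = n%:R * L.
  by rewrite /S /sqrt_nln sqr_sqrtr// mulr_ge0 ?ler0n// (le_trans ler01).
pose l := b * S / n%:R.
have l0 : 0 < l by rewrite /l divr_gt0// mulr_gt0.
have l1 : l <= 1 / 100.
  rewrite /l ler_pdivrMr//.
  have := ler_wpM2l (ltW b0) Sn; rewrite !mulrA mulfV ?gt_eqF//; lra.
apply: le_trans (Gnp_markov hp _ _) _.
- by move=> G; exact: excess_ge0.
- by rewrite mulr_gt0.
rewrite ler_pdivrMr ?mulr_gt0//.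
have l01 : 0 < l <= 1 / 100 by rewrite l0.
apply: le_trans (Gnp_exp_excess hp n (a * S) l01) _.
rewrite -/q ler_pdivrMr//.
have eE : 2 / 3 * l ^+ 2 * q * n%:R - l * (a * S) <= - L / 2.
  have -> : 2 / 3 * l ^+ 2 * q * n%:R - l * (a * S) =
     - (3 / 8 * (a ^+ 2 * S ^+ 2 / (q * n%:R))).
    by rewrite /l /b; field; rewrite !gt_eqF.
  rewrite aE SE.
  have -> : (22 / 19) ^+ 2 * q * (n%:R * L) / (q * n%:R) = (22 / 19) ^+ 2 * L.
    by field; rewrite !gt_eqF.
  exact: aux.
apply: (@le_trans _ _ (2 * n%:R * expR (- L / 2))).
  by rewrite ler_wpM2l ?mulr_ge0 ?(ltW n0)// ler_expR.
have sL : expR (- L / 2) * S = Num.sqrt L.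
  have -> : expR (- L / 2) = (Num.sqrt n%:R)^-1.
    rewrite -[n%:R](@lnK R) ?posrE// -/L (_ : L = 2%:R * (L / 2)); last by field.
    rewrite expRM_natl sqrtr_sqr ger0_norm ?expR_ge0// -expRN; congr expR.
    by field.
  rewrite /S /sqrt_nln -/L sqrtrM ?(ltW n0)// mulrA mulVf ?mul1r//.
  by apply: lt0r_neq0; rewrite sqrtr_gt0.
(* The powers of n cancel exactly, and all that is gained is this factor sqrt(ln n). *)
have key : 2 <= eps * d * b * Num.sqrt L.
  have e0 : 0 < eps * d * b by rewrite mulr_gt0// mulr_gt0.
  rewrite mulrC -ler_pdivrMr// -[leLHS]ger0_norm ?divr_ge0 ?(ltW e0)//.
  by rewrite -sqrtr_sqr ler_wsqrtr.
have eS : expR (- L / 2) * S ^+ 2 = Num.sqrt L * S by rewrite expr2 mulrA sL.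
have E0 := expR_gt0 (- L / 2).
rewrite -(ler_pM2r S0) -[2 * n%:R * _ * S]mulrA sL.
have -> : eps * (d * n%:R) * l * S = (eps * d * b) * S ^+ 2.
  by rewrite /l; field; rewrite gt_eqF.
rewrite SE -[X in _ * (_ * X)](@sqr_sqrtr R L)//.
have sL0 : 0 <= Num.sqrt L by exact: sqrtr_ge0.
rewrite [leRHS](_ : _ = eps * d * b * Num.sqrt L * (n%:R * Num.sqrt L)); last by ring.
by rewrite -mulrA ler_wpM2r// mulr_ge0 ?(ltW n0).
Unshelve. all: by end_near.
Qed.

Lemma Gnp_prob_edges_far n (B : R) : 0 < B -> (0 < n)%N ->
  Gnp_prob p (fun G : graph n => B * n%:R <= `|#|G|%:R - p * 'C(n, 2)%:R|) <=
  (B ^+ 2)^-1.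
Proof.
move=> B0 n0; have nR : 0 < n%:R :> R by rewrite ltr0n.
apply: le_trans (Gnp_chebyshev hp (Gnp_exp_edges_sqr hp n) _) _.
  by rewrite mulr_gt0.
by rewrite exprMn invfM mulrCA divff ?mulr1// gt_eqF// exprn_gt0.
Qed.

(** The middle half of the window contains at least n/4 values, each of probability at least exp (-
    c1) / (18 n); hence the 72. The factor 4 in c1 comes from C(n,2) >= n^2/4. *)
Lemma near_prob_edges_window (x : R) : 0 <= x -> exists2 c0 : R, 0 < c0 &
  \forall n \near \oo, c0 <= Gnp_prob p (fun G : graph n =>
    x * n%:R < #|G|%:R - p * 'C(n, 2)%:R < (x + 1) * n%:R).
Proof.
case/andP: (hp) => p0 p1 x0.
have q0 : 0 < p * (1 - p) by apply: mulr_gt0; lra.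
pose c1 := 3 / 5 * (4 * (x + 2) ^+ 2) / (p * (1 - p)).
exists (expR (- c1) / 72); first by rewrite divr_gt0 ?expR_gt0.
near=> n.
have n2 : (2 <= n)%N by near: n; exact: nbhs_infty_ge.
have n1 : 1000 <= n%:R :> R by near: n; exact: nbhs_infty_ger.
have nx : 24 * (x + 2) / (p * (1 - p)) <= n%:R by near: n; exact: nbhs_infty_ger.
have nq : 4 * (x + 2) / (1 - p) <= n%:R by near: n; exact: nbhs_infty_ger.
have n0 : 0 < n%:R :> R by lra.
have /andP[s1 s2] := bin2_sqrt_bounds n2.
have NR := bin2R n.
have N4 : n%:R ^+ 2 / 4 <= 'C(n, 2)%:R :> R by rewrite NR expr2; nra.
have nx' : 24 * (x + 2) * n%:R <= n%:R ^+ 2 * (p * (1 - p)).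
  by rewrite expr2 [leRHS]mulrAC ler_wpM2r ?(ltW n0)// -ler_pdivrMr.
have nq' : 4 * (x + 2) * n%:R <= n%:R ^+ 2 * (1 - p).
  by rewrite expr2 [leRHS]mulrAC ler_wpM2r ?(ltW n0)// -ler_pdivrMr// subr_gt0.
set N := 'C(n, 2) in NR N4 s1 s2 *.
have N0 : 0 < N%:R :> R.
  by apply: lt_le_trans N4; rewrite divr_gt0// exprn_gt0.
have N10 : (10000 <= N)%N.
  rewrite -(ler_nat R); apply: le_trans N4; rewrite expr2; nra.
rewrite (@Gnp_prob_card R p n (fun j => x * n%:R < j%:R - p * N%:R < (x + 1) * n%:R)).
set A := [set j : 'I_N.+1 | N%:R * p + (x + 1 / 4) * n%:R <= (j : nat)%:R
   <= N%:R * p + (x + 3 / 4) * n%:R]%SET.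
have cA : n%:R / 4 <= #|A|%:R :> R.
  apply: le_trans (card_itv_ge _ _); first lra.
    by rewrite addr_ge0// mulr_ge0//; lra.
  have h : (x + 3 / 4) * n%:R <= (x + 2) * n%:R by rewrite ler_wpM2r ?(ltW n0)//; lra.
  have h2 : n%:R ^+ 2 / 4 * (1 - p) <= N%:R * (1 - p) by rewrite ler_wpM2r//; lra.
  lra.
have h18 m (z : R) : n%:R / 2 <= z -> z <= n%:R -> 0 < m -> (m * n%:R)^-1 <= (m * z)^-1.
  move=> z1 z2 m0; rewrite lef_pV2 ?posrE ?mulr_gt0//; first by rewrite ler_pM2l.
  by apply: lt_le_trans z1; rewrite divr_gt0.
have ptA (j : 'I_N.+1) : j \in A -> expR (- c1) / (18 * n%:R) <= binp p N j.
  rewrite inE => /andP[h1 h2].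
  have jN : (j <= N)%N by rewrite -ltnS.
  have hd : `|j%:R - N%:R * p| <= (x + 1) * n%:R.
    rewrite ler_norml; apply/andP; split.
      have : 0 <= x * n%:R by rewrite mulr_ge0 ?(ltW n0).
      lra.
    lra.
  have hd2 : `|j%:R - N%:R * p| + 2 <= (x + 2) * n%:R by lra.
  have Nq : n%:R ^+ 2 / 4 * (p * (1 - p)) <= N%:R * (p * (1 - p)).
    by rewrite ler_wpM2r// ltW.
  have hd3 : `|j%:R - N%:R * p| + 2 <= N%:R * (p * (1 - p)) / 6.
    by apply: le_trans hd2 _; lra.
  apply: le_trans (binp_lower hp N10 jN hd3).
  rewrite mulrC; apply: ler_pM; rewrite ?expR_ge0 ?invr_ge0 ?mulr_ge0 ?(ltW n0)//.
    exact: h18.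
  rewrite ler_expR lerN2 (ler_pdivrMr _ _ (mulr_gt0 q0 N0)).
  rewrite /c1 (mulrA (_ / (p * (1 - p)))) divfK ?gt_eqF// -[leRHS]mulrA ler_wpM2l ?divr_ge0//.
  apply: (@le_trans _ _ (((x + 2) * n%:R) ^+ 2)).
    by rewrite lerXn2r// nnegrE ?addr_ge0// mulr_ge0 ?addr_ge0 ?(ltW n0).
  rewrite exprMn -[leRHS]mulrA [leRHS]mulrCA ler_wpM2l ?sqr_ge0//.
  by rewrite [leRHS]mulrC -ler_pdivrMr.
apply: (@le_trans _ _ (\sum_(j in A) expR (- c1) / (18 * n%:R))).
  rewrite sumr_const -[leRHS]mulr_natl.
  have -> : expR (- c1) / 72 = n%:R / 4 * (expR (- c1) / (18 * n%:R)).
    by field; rewrite gt_eqF.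
  by rewrite ler_wpM2r// divr_ge0 ?expR_ge0// mulr_ge0 ?(ltW n0).
apply: le_trans (ler_sum _ ptA) _.
rewrite big_mkcond [leRHS]big_mkcond; apply: ler_sum => j _.
case: (boolP (j \in A)) => jA; last by case: ifP => // _; exact: binp_ge0.
rewrite ifT//; move: jA; rewrite inE => /andP[h1 h2].
by apply/andP; split; lra.
Unshelve. all: by end_near.
Qed.

(** At most 3 d n values, each of probability at most 2E/n. The bound is uniform in y because the
    centre will be dev(n), and dev(n)/n need not converge. *)
Lemma near_prob_edges_near : exists2 K : R, 0 < K & forall d : R, 0 < d ->
  \forall n \near \oo, forall y : R,
    Gnp_prob p (fun G : graph n =>
      `|#|G|%:R - p * 'C(n, 2)%:R - y| <= d * n%:R) <= K * d.
Proof.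
case/andP: (hp) => p0 p1.
have q0 : 0 < p * (1 - p) by apply: mulr_gt0; lra.
set E := expR (6 / (p * (1 - p))).
have E0 : 0 < E by exact: expR_gt0.
exists (6 * E); first by rewrite mulr_gt0.
move=> d d0; near=> n => y.
have n2 : (2 <= n)%N by near: n; exact: nbhs_infty_ge.
have n1 : 1 <= n%:R :> R by near: n; exact: nbhs_infty_ger.
have nd : d^-1 <= n%:R by near: n; exact: nbhs_infty_ger.
have nq : 36 / (p * (1 - p)) <= n%:R by near: n; exact: nbhs_infty_ger.
have n0 : 0 < n%:R :> R by lra.
have dn1 : 1 <= d * n%:R by rewrite mulrC -ler_pdivrMr// div1r.
have /andP[s1 s2] := bin2_sqrt_bounds n2.
set N := 'C(n, 2) in s1 s2 *.
rewrite (@Gnp_prob_card R p n (fun j => `|j%:R - p * N%:R - y| <= d * n%:R)).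
set A := [set j : 'I_N.+1 | p * N%:R + y - d * n%:R <= (j : nat)%:R
   <= p * N%:R + y + d * n%:R]%SET.
have cA : #|A|%:R <= 3 * (d * n%:R).
  by apply: le_trans (card_itv_le _ _) _; lra.
have pt j : binp p N j <= 2 * E / n%:R.
  apply: le_trans (binp_upper hp _ _) _; first by apply: le_trans s1; lra.
  rewrite -/E [2 * E]mulrC -mulrA ler_wpM2l ?(ltW E0)//.
  have -> : 2 / n%:R = (n%:R / 2)^-1 :> R by rewrite invf_div.
  by rewrite lef_pV2 ?posrE//; lra.
apply: (@le_trans _ _ (\sum_(j in A) 2 * E / n%:R)).
  rewrite big_mkcond [leRHS]big_mkcond; apply: ler_sum => j _.
  have E2 : 0 <= 2 * E / n%:R by rewrite divr_ge0 ?mulr_ge0 ?(ltW E0) ?(ltW n0).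
  case: (boolP (j \in A)) => jA; first by case: ifP.
  rewrite ifF//; apply/negbTE; move: jA; rewrite inE; apply: contra.
  by rewrite ler_norml => /andP[h1 h2]; apply/andP; split; lra.
rewrite sumr_const -[leLHS]mulr_natl.
have -> : 6 * E * d = 3 * (d * n%:R) * (2 * E / n%:R) by field; rewrite gt_eqF.
by rewrite ler_wpM2r// divr_ge0 ?mulr_ge0 ?(ltW E0) ?(ltW n0).
Unshelve. all: by end_near.
Qed.
End edge_count.

Section growth_half.
Variable R : realType.

Lemma sqrt_nat_expR n : (0 < n)%N ->
  Num.sqrt (n%:R : R) = expR (ln (n%:R : R) / 2).
Proof.
move=> n0; have nR : 0 < n%:R :> R by rewrite ltr0n.
rewrite -[in LHS](@lnK R n%:R) ?posrE//.
rewrite {1}(_ : ln (n%:R : R) = 2%:R * (ln (n%:R : R) / 2)); last by field.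
by rewrite expRM_natl sqrtr_sqr ger0_norm ?expR_ge0.
Qed.

Lemma expRN_le_inv (y : R) : 0 < y -> expR (- y) <= y^-1.
Proof.
move=> y0; rewrite expRN lef_pV2 ?posrE ?expR_gt0//.
by apply: le_trans (expR_ge1Dx y); rewrite lerDr.
Qed.

Lemma near_expR_ln_ge (K : R) : \forall n \near \oo, K <= expR (ln (n%:R : R) / 50).
Proof.
near=> n.
have h : 50 * K <= ln (n%:R : R) by near: n; exact: near_ln_ge.
apply: le_trans (expR_ge1Dx _); move: h; move: (ln _) => z h; lra.
Unshelve. all: by end_near.
Qed.
End growth_half.

Lemma center_le (R : realType) (z h y : R) :
  `|z - h / 2| + 2 <= y -> y <= h / 24 -> 0 < h -> z <= h.
Proof. by have := ler_norm (z - h / 2); move: (`|_|) => a; lra. Qed.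

Lemma half_in01 (R : realType) : 0 < (2^-1 : R) < 1.
Proof. by apply/andP; split; lra. Qed.

Lemma half_var_gt0 (R : realType) : 0 < (2^-1 * (1 - 2^-1) : R).
Proof. by rewrite mulr_gt0//; lra. Qed.

(** Origin of 12/25 = (3/5)(9/25) / ((1/4)(9/5)): the distance is (3/5) rho sqrt(n ln n) and the
    variance h/4 with h >= (9/5) q n. Being below 1/2 is what matters. *)
Lemma coin_exponent_le (R : realType) (q m l h : R) :
  9 / 5 * q * m * l <= h * l ->
  3 / 5 * (9 / 25 * q * (m * l)) <= 12 / 25 * l * (2^-1 * (1 - 2^-1) * h).
Proof.
rewrite (_ : 9 / 5 * q * m * l = 9 / 5 * (q * m * l)); last by ring.
rewrite (_ : 3 / 5 * (9 / 25 * q * (m * l)) = 27 / 125 * (q * m * l)); last by field.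
rewrite (_ : 12 / 25 * l * (2^-1 * (1 - 2^-1) * h) = 3 / 25 * (h * l)); last by field.
by move: (q * m * l) (h * l) => a b; lra.
Qed.

Lemma window_le (R : realType) (rho s : R) : 0 <= rho * s ->
  11 / 19 * rho * s + 2 * (rho / 400 * s) <= rho * s.
Proof.
rewrite (_ : 11 / 19 * rho * s + 2 * (rho / 400 * s) =
  (11 / 19 + 1 / 200) * (rho * s)); last by field.
by move: (rho * s) => z; lra.
Qed.

Lemma window_slack (R : realType) (rho s : R) : 2 <= rho / 400 * s ->
  11 / 19 * rho * s + 2 * (rho / 400 * s) + 2 <= 3 / 5 * rho * s.
Proof.
rewrite (_ : 11 / 19 * rho * s = 11 / 19 * (rho * s)); last by field.
rewrite (_ : 3 / 5 * rho * s = 3 / 5 * (rho * s)); last by field.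
rewrite (_ : rho / 400 * s = 1 / 400 * (rho * s)); last by field.
by move: (rho * s) => z; lra.
Qed.

Lemma half_le (R : realType) (q m h : R) : 9 / 5 * q * m <= h ->
  9 / 10 * q * m <= h / 2.
Proof.
rewrite (_ : 9 / 5 * q * m = 9 / 5 * (q * m)); last by ring.
rewrite (_ : 9 / 10 * q * m = 9 / 10 * (q * m)); last by field.
by move: (q * m) => z; lra.
Qed.

Lemma window_shift (R : realType) (lo g z h : R) :
  h / 2 + (lo + g) <= z <= h / 2 + (lo + 2 * g) ->
  lo + 2 * (g / 2) <= z - h / 2 <= lo + 3 * g - 2 * (g / 2).
Proof. by move=> /andP[h1 h2]; apply/andP; split; lra. Qed.

Lemma window_abs (R : realType) (lo g z h : R) : 0 <= lo -> 2 <= g ->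
  h / 2 + (lo + g) <= z <= h / 2 + (lo + 2 * g) ->
  `|z - h / 2| <= lo + 2 * g.
Proof.
by move=> h0 h3 /andP[h1 h2]; rewrite ler_norml; apply/andP; split; lra.
Qed.

Lemma count_slack (R : realType) (lo g h : R) : 2 <= g ->
  g / 2 <= h / 2 + (lo + 2 * g) - (h / 2 + (lo + g)) - 1.
Proof. by move=> g2; lra. Qed.

Lemma half_add_le (R : realType) (y h : R) : y <= h / 2 -> h / 2 + y <= h.
Proof. by lra. Qed.

(** * Fair coin probabilities for large n *)

Section fair_coin_bounds.
Variables (R : realType) (q rho : R).
Hypotheses (q0 : 0 < q) (rho0 : 0 < rho) (rhoE : rho ^+ 2 = q).

Local Notation S := (sqrt_nln R).

(* A lower bound for the Bin(h, 1/2) point probabilities at distance at most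
   (3/5) rho sqrt(n ln n) from h/2, for (9/5) q n <= h <= n; it is of order n^{-0.98}. *)
Definition point_bound (n : nat) : R :=
  (18 * Num.sqrt n%:R)^-1 * expR (- (12 / 25 * ln n%:R)).

Lemma point_bound_ge0 n : 0 <= point_bound n.
Proof. by rewrite mulr_ge0 ?expR_ge0// invr_ge0 mulr_ge0 ?sqrtr_ge0. Qed.

Lemma near_binp_half_ge : \forall n \near \oo, forall h z : nat,
  9 / 5 * q * n%:R <= h%:R -> (h <= n)%N ->
  `|z%:R - h%:R / 2| + 2 <= 3 / 5 * rho * S n -> point_bound n <= binp 2^-1 h z.
Proof.
near=> n => h z hh hn hz.
have n1 : 1 <= n%:R :> R by near: n; exact: nbhs_infty_ger.
have nq : 10000 / (9 / 5 * q) <= n%:R by near: n; exact: nbhs_infty_ger.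
have Sq : 3 / 5 * rho * S n <= 9 / 5 * q * n%:R / 24.
  have h1 : S n <= (9 / 5 * q / 24 / (3 / 5 * rho)) * n%:R.
    near: n; apply: near_sqrt_nln_le.
    by rewrite divr_gt0 ?divr_gt0 ?mulr_gt0 ?divr_gt0.
  have r0 : 0 < 3 / 5 * rho by rewrite mulr_gt0 ?divr_gt0.
  apply: le_trans (ler_wpM2l (ltW r0) h1) _.
  by rewrite mulrA mulrCA divff ?mulr1 ?gt_eqF// mulrAC.
have n0 : 0 < n%:R :> R by apply: lt_le_trans n1.
have L0 : 0 <= ln (n%:R : R) by apply: ln_ge0.
have hq0 : 0 < 9 / 5 * q by rewrite mulr_gt0 ?divr_gt0.
have h10 : (10000 <= h)%N.
  by rewrite -(ler_nat R); apply: le_trans hh; rewrite mulrC -ler_pdivrMr.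
have h0 : 0 < h%:R :> R by apply: lt_le_trans hh; rewrite mulr_gt0.
have hS : 3 / 5 * rho * S n <= h%:R / 24.
  by apply: le_trans Sq _; rewrite ler_wpM2r// invr_ge0.
have zh : (z <= h)%N.
  by rewrite -(ler_nat R); exact: center_le hz hS h0.
have hp2 := half_in01 R.
have e1 : `|z%:R - h%:R * 2^-1 : R| + 2 <= h%:R * (2^-1 * (1 - 2^-1)) / 6.
  apply: le_trans hz _; apply: le_trans hS _.
  by rewrite le_eqVlt; apply/orP; left; apply/eqP; field.
apply: le_trans (binp_lower hp2 h10 zh e1).
apply: ler_pM; rewrite ?invr_ge0 ?mulr_ge0 ?sqrtr_ge0 ?expR_ge0//.
  rewrite lef_pV2 ?posrE ?mulr_gt0 ?sqrtr_gt0// ler_wpM2l//.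
  by rewrite ler_wsqrtr// ler_nat.
rewrite ler_expR lerN2 ler_pdivrMr; last by rewrite mulr_gt0// half_var_gt0.
apply: (@le_trans _ _ (3 / 5 * (3 / 5 * rho * S n) ^+ 2)).
  by rewrite ler_wpM2l ?divr_ge0// lerXn2r ?nnegrE ?addr_ge0// (le_trans _ hz)// addr_ge0.
have -> : (3 / 5 * rho * S n) ^+ 2 = 9 / 25 * q * (n%:R * ln n%:R).
  rewrite !exprMn rhoE /S sqr_sqrtr; last by rewrite mulr_ge0 ?(ltW n0).
  by field.
exact: coin_exponent_le (ler_wpM2r L0 hh).
Unshelve. all: by end_near.
Qed.

Local Notation lo n := (11 / 19 * rho * S n).
Local Notation g n := (rho / 400 * S n).

(** The deviations between lo + g and lo + 2g comprise at least g/2 integers, each with probability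
    at least [point_bound]. Here t = g/2, so 2t = g is the margin needed at both ends of the range
    from lo to lo + 3g. *)
Lemma near_sum_binp_half_ge : \forall n \near \oo, forall h : nat,
  9 / 5 * q * n%:R <= h%:R -> (h <= n)%N ->
  g n / 2 * point_bound n <=
  \sum_(z < h.+1 | lo n + 2 * (g n / 2) <= z%:R - h%:R / 2 <=
                    lo n + 3 * g n - 2 * (g n / 2)) binp 2^-1 h z.
Proof.
near=> n => h hh hn.
have pb : forall h z : nat, 9 / 5 * q * n%:R <= h%:R -> (h <= n)%N ->
  `|z%:R - h%:R / 2| + 2 <= 3 / 5 * rho * S n -> point_bound n <= binp 2^-1 h z.
  by near: n; exact: near_binp_half_ge.
have g2 : 2 <= g n.
  have h1 : 2 / (rho / 400) <= S n by near: n; exact: near_sqrt_nln_ge.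
  have g0 : 0 < rho / 400 by rewrite divr_gt0 ?ltr0n.
  by move: h1; rewrite ler_pdivrMr// mulrC.
have Sq : lo n + 2 * g n <= 9 / 10 * q * n%:R.
  have h1 : S n <= (9 / 10 * q / rho) * n%:R.
    near: n; apply: near_sqrt_nln_le.
    by rewrite divr_gt0 ?mulr_gt0 ?divr_gt0.
  have h2 : rho * S n <= 9 / 10 * q * n%:R.
    apply: le_trans (ler_wpM2l (ltW rho0) h1) _.
    by rewrite mulrA [rho * _]mulrC divfK ?gt_eqF.
  have r0 : 0 <= rho * S n by rewrite mulr_ge0 ?sqrtr_ge0// ltW.
  by apply: le_trans h2; exact: window_le.
have hS : lo n + 2 * g n <= h%:R / 2.
  by apply: le_trans Sq _; exact: half_le hh.
have r0 : 0 <= rho * S n by rewrite mulr_ge0 ?sqrtr_ge0// ltW.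
have lo0 : 0 <= lo n by rewrite -mulrA mulr_ge0// divr_ge0.
have g0 : 0 <= g n := le_trans (ler0n R 2) g2.
have hi5 : lo n + 2 * g n + 2 <= 3 / 5 * rho * S n by exact: window_slack.
set A := finset (fun z : 'I_h.+1 => h%:R / 2 + (lo n + g n) <= (z : nat)%:R
   <= h%:R / 2 + (lo n + 2 * g n)).
have cA : g n / 2 <= #|A|%:R.
  apply: le_trans (card_itv_ge _ _).
  - exact: count_slack.
  - exact: addr_ge0 (divr_ge0 (ler0n _ _) (ler0n _ 2)) (addr_ge0 lo0 g0).
  - exact: half_add_le.
apply: (@le_trans _ _ (\sum_(z in A) point_bound n)).
  by rewrite sumr_const -[leRHS]mulr_natl ler_wpM2r ?point_bound_ge0.
rewrite big_mkcond [leRHS]big_mkcond; apply: ler_sum => z _.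
have b0 : 0 <= binp (2^-1 : R) h z by apply: binp_ge0; exact: half_in01.
case: (boolP (z \in A)) => zA; last by case: ifP.
move: zA; rewrite inE => zA.
have zA' := window_shift zA.
rewrite ifT//; apply: pb => //.
apply: le_trans hi5; rewrite lerD2r.
exact: window_abs lo0 g2 zA.
Unshelve. all: by end_near.
Qed.
End fair_coin_bounds.

Section error_terms.
Variable R : realType.
Local Notation S := (sqrt_nln R).

(** The exponent is 1 - 1/2 - 12/25 = 1/50: the expected number of fine pairs with the required
    degree tends to infinity. *)
Lemma near_point_bound_ge : exists2 kap : R, 0 < kap &
  \forall n \near \oo, forall r : nat, n%:R / 160 <= r%:R :> R ->
    kap * expR (ln n%:R / 50) <= point_bound R n / 2 * (r%:R / 2).
Proof.
pose kap : R := 18^-1 / 160 / 4.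
have kap0 : 0 < kap by rewrite /kap !divr_gt0 ?invr_gt0 ?ltr0n.
exists kap => //; near=> n => r hr.
have n0 : (0 < n)%N by near: n; exact: nbhs_infty_gt.
have sE := sqrt_nat_expR R n0.
have nE : n%:R = expR (ln (n%:R : R) / 2) * expR (ln (n%:R : R) / 2).
  by rewrite -sE -expr2 sqr_sqrtr ?ler0n.
have pE : point_bound R n * n%:R = 18^-1 * expR (ln n%:R / 50).
  rewrite /point_bound sE {3}nE.
  have -> : expR (ln n%:R / 50) = expR (- (12 / 25 * ln n%:R)) * expR (ln n%:R / 2) :> R.
    by rewrite -expRD; congr expR; field.
  move: (expR_gt0 (ln (n%:R : R) / 2)) => /lt0r_neq0.
  move: (expR (_ / 2)) (expR (- _)) => u v u0.
  by field; rewrite u0.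
apply: (@le_trans _ _ (point_bound R n / 2 * (n%:R / 160 / 2))).
  rewrite le_eqVlt; apply/orP; left; apply/eqP.
  rewrite (_ : point_bound R n / 2 * (n%:R / 160 / 2) =
    point_bound R n * n%:R / 160 / 4); last by field.
  by rewrite pE /kap; field.
apply: ler_wpM2l; last by rewrite ler_wpM2r// invr_ge0 ler0n.
by rewrite divr_ge0 ?point_bound_ge0 ?ler0n.
Unshelve. all: by end_near.
Qed.

(** The first term is of order 1/ln n. In the second, M <= S while the exponent is of order at least
    S n^{1/50}, so 2^M is beaten and exp (- S) remains. The third decays with the number of fine
    candidates. *)
Lemma near_error_le (gam C eps : R) : 0 < gam -> 0 < C -> 0 < eps ->
  \forall n \near \oo, forall r M : nat, n%:R / 160 <= r%:R :> R ->
    M%:R <= C * scale R n ->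
    20 * n%:R / (gam * S n / 2) ^+ 2 +
    2 ^+ M * expR (- (gam * S n / 2 * point_bound R n / 2 * (r%:R / 2))) +
    2 * expR (- (point_bound R n / 2 * (r%:R / 2))) <= eps.
Proof.
move=> gam0 C0 eps0; have [kap kap0 hkap] := near_point_bound_ge.
have e3 : 0 < eps / 3 by rewrite divr_gt0.
have third (a b c : R) : a <= eps / 3 -> b <= eps / 3 -> c <= eps / 3 -> a + b + c <= eps.
  by lra.
near=> n => r M hr hM.
have n0 : (0 < n)%N by near: n; exact: nbhs_infty_gt.
have nR : 0 < n%:R :> R by rewrite ltr0n.
have Lb : 80 / gam ^+ 2 / (eps / 3) <= ln (n%:R : R) by near: n; exact: near_ln_ge.
have L1 : 1 <= ln (n%:R : R) by near: n; exact: near_ln_ge.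
have L0 : 0 < ln (n%:R : R) by apply: lt_le_trans L1.
have S1 : 1 <= S n by near: n; exact: near_sqrt_nln_ge.
have S0 : 0 < S n by apply: lt_le_trans S1.
have Se : (eps / 3)^-1 <= S n by near: n; exact: near_sqrt_nln_ge.
have X1 : 4 / gam / kap <= expR (ln (n%:R : R) / 50) by near: n; exact: near_expR_ln_ge.
have X2 : 2 / (eps / 3) / kap <= expR (ln (n%:R : R) / 50) by near: n; exact: near_expR_ln_ge.
have CS : scale R n <= C^-1 * S n.
  by near: n; apply: near_scale_le_sqrt_nln; rewrite invr_gt0.
have hY : kap * expR (ln n%:R / 50) <= point_bound R n / 2 * (r%:R / 2).
  by apply: (near hkap n).
have Y1 : 4 / gam <= point_bound R n / 2 * (r%:R / 2).
  by apply: le_trans hY; rewrite [leRHS]mulrC -ler_pdivrMr.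
have Y2 : 2 / (eps / 3) <= point_bound R n / 2 * (r%:R / 2).
  by apply: le_trans hY; rewrite [leRHS]mulrC -ler_pdivrMr.
rewrite (_ : gam * S n / 2 * point_bound R n / 2 * (r%:R / 2) =
  gam * S n / 2 * (point_bound R n / 2 * (r%:R / 2))); last by field.
move: Y1 Y2; set Y : R := point_bound R n / 2 * (r%:R / 2) => Y1 Y2.
clearbody Y.
have Y0 : 0 < Y by apply: lt_le_trans Y1; rewrite divr_gt0 ?ltr0n.
apply: third.
- have -> : 20 * n%:R / (gam * S n / 2) ^+ 2 = 80 / gam ^+ 2 / ln n%:R.
    have SE : S n ^+ 2 = n%:R * ln n%:R.
      by rewrite /sqrt_nln sqr_sqrtr// mulr_ge0 ?(ltW nR) ?(ltW L0).
    rewrite !exprMn SE; field.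
    by rewrite !gt_eqF.
  by rewrite ler_pdivrMr// [leRHS]mulrC -ler_pdivrMr.
- have hM2 : M%:R <= S n.
    apply: le_trans hM _; rewrite -ler_pdivlMl//.
  have -> : 2 ^+ M * expR (- (gam * S n / 2 * Y)) =
     2 ^+ M * expR (- M%:R) * expR (M%:R - gam * S n / 2 * Y).
    by rewrite -[RHS]mulrA -expRD; congr (_ * expR _); ring.
  have eM : 2 ^+ M * expR (- M%:R) <= 1 :> R.
    have -> : expR (- M%:R) = expR (- 1) ^+ M :> R.
      by rewrite -expRM_natl mulrN1.
    rewrite -exprMn exprn_ile1// ?mulr_ge0 ?expR_ge0//.
    rewrite expRN ler_pdivrMr ?expR_gt0// mul1r.
    by apply: le_trans (expR_ge1Dx 1).
  apply: (@le_trans _ _ (expR (- S n))).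
    rewrite -[leRHS]mul1r; apply: ler_pM; rewrite ?expR_ge0 ?mulr_ge0 ?exprn_ge0 ?expR_ge0//.
    rewrite ler_expR.
    have : S n * 2 <= gam * S n / 2 * Y.
      have h : gam * S n / 2 * (4 / gam) <= gam * S n / 2 * Y.
        by rewrite ler_wpM2l// divr_ge0 ?ler0n// mulr_ge0 ?(ltW gam0) ?(ltW S0).
      apply: le_trans h; rewrite le_eqVlt; apply/orP; left; apply/eqP.
      by field; rewrite gt_eqF.
    by move: hM2; move: (gam * S n / 2 * Y) (S n) (M%:R : R) => u v w; lra.
  apply: le_trans (expRN_le_inv S0) _.
  by rewrite -[leRHS]invrK lef_pV2 ?posrE ?invr_gt0.
- apply: (@le_trans _ _ (2 / Y)); first by rewrite ler_wpM2l ?ler0n// expRN_le_inv.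
  by rewrite ler_pdivrMr// [leRHS]mulrC -ler_pdivrMr.
Unshelve. all: by end_near.
Qed.
End error_terms.

Lemma le_max_induced (e : nat -> nat) n (G : graph n) k : (k <= n)%N ->
  has_induced G k (e k) -> (k <= max_induced e G)%N.
Proof.
rewrite -ltnS => kn h.
exact: (@leq_bigmax_cond _ (fun i : 'I_n.+1 => has_induced G i (e i)) val (Ordinal kn) h).
Qed.

(** Explains 3/5 and 400: since 3/5 - 11/19 = 2/95 > 6/400, a margin of 5g + 2 above lo stays within
    the range of [near_binp_half_ge]. *)
Lemma window_slack5 (R : realType) (rho s : R) : 2 <= rho / 400 * s ->
  11 / 19 * rho * s + 5 * (rho / 400 * s) + 2 <= 3 / 5 * rho * s.
Proof.
rewrite (_ : 11 / 19 * rho * s = 11 / 19 * (rho * s)); last by field.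
rewrite (_ : 3 / 5 * rho * s = 3 / 5 * (rho * s)); last by field.
rewrite (_ : rho / 400 * s = 1 / 400 * (rho * s)); last by field.
by move: (rho * s) => z; lra.
Qed.

Lemma window_le5 (R : realType) (rho s : R) : 0 <= rho * s ->
  11 / 19 * rho * s + 5 * (rho / 400 * s) <= rho * s.
Proof.
rewrite (_ : 11 / 19 * rho * s + 5 * (rho / 400 * s) =
  (11 / 19 + 1 / 80) * (rho * s)); last by field.
by move: (rho * s) => z; lra.
Qed.

(** The bound 9/5 is 19/10 from the outer vertices minus 1/10 for the atypicality allowance 4t =
    2g. *)
Lemma outer_large (R : realType) (q y n m g : R) : 0 < q -> 19 / 20 * n <= m ->
  g <= q / 20 * n -> 9 / 5 * q * n <= 2 * q * m - 4 * (g / 2).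
Proof.
move=> q0 nm gn; have := ler_wpM2l (ltW q0) nm.
rewrite (_ : q * (19 / 20 * n) = 19 / 20 * (q * n)); last by field.
rewrite (_ : 9 / 5 * q * n = 9 / 5 * (q * n)); last by field.
rewrite (_ : 2 * q * m = 2 * (q * m)); last by ring.
move: gn; rewrite (_ : q / 20 * n = 1 / 20 * (q * n)); last by field.
by move: (q * n) (q * m) => a b; lra.
Qed.

Lemma surplus_norm_le (R : realType) (p D dv c2 m An Bn lo d : R) :
  0 < p < 1 -> `|D| <= Bn -> `|dv| <= An -> 0 <= c2 <= d / 4 ->
  m ^+ 2 <= d / 4 -> An + Bn + d <= m * lo ->
  `|D - dv - p * c2| <= m * lo - m ^+ 2.
Proof.
move=> /andP[p0 p1] hD hdv /andP[c0 c1] hm hl.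
have pc : `|p * c2| <= d / 4.
  rewrite ger0_norm ?mulr_ge0 ?(ltW p0)//; apply: le_trans c1.
  by rewrite ler_piMl// ltW.
apply: le_trans (ler_normB _ _) _.
apply: le_trans (lerD (ler_normB _ _) (lexx _)) _.
move: hD hdv pc hm hl; move: (`|D|) (`|dv|) (`|p * c2|) (m ^+ 2) (m * lo).
by move=> a1 a2 a3 a4 a5; lra.
Qed.

Lemma removal_size (R : realType) (T M c : R) : M = T - 2 -> T <= c -> c < T + 1 ->
  c - 3 <= M /\ M + 1 < c.
Proof. by move=> -> h1 h2; split; lra. Qed.

Lemma removal_lt (R : realType) (M c n : R) :
  M + 1 < c -> c <= n / 2 -> 0 < n -> M < n.
Proof. by lra. Qed.

Lemma threshold_le (R : realType) (M c l g : R) : M + 1 < c -> 2 * c <= g ->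
  l + 3 * g + 2 * M + 2 * (g / 2) <= l + 5 * g.
Proof. by lra. Qed.

Lemma outer_size (R : realType) (n m : R) : 20 * m <= n -> 19 / 20 * n <= n - m.
Proof. by lra. Qed.

Lemma rest_large (R : realType) (M c n k : R) :
  M + 1 < c -> c <= n / 2 -> 2 * k <= n -> k <= n - (M + 1).
Proof. by lra. Qed.

Lemma bin2_le_sqr (R : realType) (M c : R) : 0 <= M -> M + 1 < c ->
  (M + 1) * (M + 1 - 1) / 2 <= c ^+ 2.
Proof. by move=> M0 Mc; rewrite expr2; nra. Qed.

Lemma budget_le (R : realType) (A B x n l : R) :
  3 * l <= (x - (A + B)) / 2 * n ->
  A * n + B * n + (x - (A + B)) / 2 * n <= x * n - 3 * l.
Proof. by lra. Qed.

(** * Lower bound on X_n *)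

Section near_exact.
Variables (R : realType) (p : R).
Hypothesis hp : 0 < p < 1.
Variable e : nat -> nat.
Local Notation S := (sqrt_nln R).

(** The target D - dev(k) is at most (A + B) n in absolute value, whereas about C sqrt(n/ln n)
    vertices of deviation b sqrt(n ln n) supply b C n; the difference d n pays for the lower-order
    terms. The square root is abstracted as [rho] to keep the arithmetic polynomial. *)
Let near_no_exact_rho (q rho A B C eps : R) : p * (1 - p) = q ->
  0 < rho -> rho ^+ 2 = q -> 0 <= A -> 0 <= B -> 0 < C ->
  A + B < 11 / 19 * rho * C ->
  (\forall k \near \oo, `|deviation p e k| <= A * k%:R) -> 0 < eps ->
  \forall n \near \oo, Gnp_prob p (fun G : graph n =>
    (`|#|G|%:R - p * 'C(n, 2)%:R| <= B * n%:R) &&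
    ((max_induced e G)%:R <= n%:R - C * scale R n)) <= eps.
Proof.
case/andP: (hp) => p0 p1 qE rho0 rhoE A0 B0 C0 AB [k0 _ hdev] eps0.
have q0 : 0 < q by rewrite -qE mulr_gt0// subr_gt0.
pose d := 11 / 19 * rho * C - (A + B).
have d0 : 0 < d by rewrite subr_gt0.
have g00 : 0 < rho / 400 by rewrite divr_gt0 ?ltr0n.
have b0 : 0 < 11 / 19 * rho by rewrite mulr_gt0 ?divr_gt0 ?ltr0n.
have H1 := nbhs_infty_ger (200 : R).
have H2 := nbhs_infty_ger (2 * k0%:R : R).
have H3 := near_ln_ge (1 : R).
have H5 : \forall n \near \oo, 2 <= rho / 400 * S n.
  apply: filterS (near_sqrt_nln_ge (2 / (rho / 400))) => n.
  by rewrite ler_pdivrMr// mulrC.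
have H6 : \forall n \near \oo, rho * S n <= 9 / 10 * q * n%:R.
  have c0 : 0 < 9 / 10 * q / rho by rewrite divr_gt0 ?mulr_gt0 ?divr_gt0 ?ltr0n.
  apply: filterS (near_sqrt_nln_le c0) => n h.
  apply: le_trans (ler_wpM2l (ltW rho0) h) _.
  by rewrite mulrA [rho * _]mulrC divfK ?gt_eqF.
have H7 : \forall n \near \oo, rho / 400 * S n <= q / 20 * n%:R.
  have c0 : 0 < q / 20 / (rho / 400) by rewrite divr_gt0// divr_gt0 ?ltr0n.
  apply: filterS (near_sqrt_nln_le c0) => n h.
  apply: le_trans (ler_wpM2l (ltW g00) h) _.
  by rewrite mulrA [rho / 400 * _]mulrC divfK ?gt_eqF.
have H8 : \forall n \near \oo, 3 <= C * scale R n.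
  apply: filterS (near_scale_ge (3 / C)) => n.
  by rewrite ler_pdivrMr// mulrC.
have H9 : \forall n \near \oo, 2 * (C * scale R n) <= rho / 400 * S n.
  have c0 : 0 < rho / 400 / (2 * C) by rewrite divr_gt0// mulr_gt0 ?ltr0n.
  apply: filterS (near_scale_le_sqrt_nln c0) => n h.
  rewrite mulrA mulrC -ler_pdivlMr ?mulr_gt0 ?ltr0n//.
  by rewrite mulrAC.
have H10 : \forall n \near \oo, C * scale R n <= n%:R / 2.
  have c0 : 0 < C^-1 / 2 by rewrite divr_gt0 ?invr_gt0 ?ltr0n.
  apply: filterS (near_scale_le c0) => n h.
  apply: le_trans (ler_wpM2l (ltW C0) h) _.
  by rewrite !mulrA divff ?gt_eqF// mul1r mulrC.
have H11 : \forall n \near \oo, (C * scale R n) ^+ 2 <= d / 2 / 4 * n%:R.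
  have c0 : 0 < d / 2 / 4 / C ^+ 2 by rewrite !divr_gt0 ?exprn_gt0 ?ltr0n.
  apply: filterS (near_scale_sqr_le c0) => n h.
  rewrite exprMn mulrC -ler_pdivlMr ?exprn_gt0//.
  by rewrite mulrAC.
have H12 : \forall n \near \oo, 3 * (11 / 19 * rho * S n) <= d / 2 * n%:R.
  have c0 : 0 < d / 2 / (3 * (11 / 19 * rho)).
    by rewrite divr_gt0 ?(divr_gt0 d0)// ?mulr_gt0 ?ltr0n.
  apply: filterS (near_sqrt_nln_le c0) => n h.
  rewrite mulrA mulrC -ler_pdivlMr ?mulr_gt0 ?ltr0n//.
  by rewrite mulrAC.
have H13 := near_binp_half_ge q0 rho0 rhoE.
have H14 := near_sum_binp_half_ge q0 rho0 rhoE.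
have H15 := near_error_le g00 C0 eps0.
apply: (filterS _ (filterI H1 (filterI H2 (filterI H3 (filterI H5
  (filterI H6 (filterI H7 (filterI H8 (filterI H9 (filterI H10 (filterI H11
  (filterI H12 (filterI H13 (filterI H14 H15)))))))))))))) => n.
move=> [n200 [nk0 [L1 [g2 [rSn [gSn [c3 [cg [cn [csq [bS [hpt [hrg herr]]]]]]]]]]]]].
clear H1 H2 H3 H5 H6 H7 H8 H9 H10 H11 H12 H13 H14 H15.
have n0 : 0 < n%:R :> R by apply: lt_le_trans n200; rewrite ltr0n.
have nN : (200 <= n)%N by rewrite -(ler_nat R).
(* The pairs of both kinds occupy 4r <= n/20 vertices, so 19/20 of the vertices remain outer while r
   is still of order n. *)
pose r := (n %/ 80)%N.
have rn : (80 * r <= n)%N by rewrite mulnC leq_trunc_div.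
have rn2 : (n <= 160 * r)%N by move: nN; rewrite /r; clear; lia.
have r0 : (0 < r)%N by move: nN rn2; clear; lia.
have kn : ((r + r) + (r + r) <= n)%N by move: rn; clear; lia.
have r160 : n%:R / 160 <= r%:R :> R.
  by rewrite ler_pdivrMr ?ltr0n// -natrM ler_nat mulnC.
pose T : nat := Num.trunc (C * scale R n).
have T1 : T%:R <= C * scale R n < T.+1%:R.
  by apply: truncn_itv; apply: le_trans c3; rewrite ler0n.
have T3 : (3 <= T)%N.
  by rewrite /T truncn_ge_nat//; apply: le_trans c3; rewrite ler0n.
move: T1; case/andP => T1 T2.
(* M + 1 = T - 1 vertices are removed, strictly fewer than C [scale], so that a hit contradicts the
   upper bound on [max_induced]. *)
pose M : nat := (T - 2)%N.
have MT : M.+2 = T by rewrite /M; move: T3; clear; lia.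
have MR : M%:R = T%:R - 2 :> R by rewrite -MT -addn2 natrD addrK.
have [Mlo Mhi] : C * scale R n - 3 <= M%:R /\ M%:R + 1 < C * scale R n.
  by apply: removal_size MR T1 _; rewrite natr1.
have Mn : (M < n)%N by rewrite -(ltr_nat R); exact: removal_lt Mhi cn n0.
have gS0 : 0 < rho / 400 * S n by apply: lt_le_trans g2; rewrite ltr0n.
have lo0 : 0 <= 11 / 19 * rho * S n.
  by rewrite mulr_ge0 ?(ltW b0) ?sqrtr_ge0.
have rS0 : 0 <= rho * S n by rewrite mulr_ge0 ?(ltW rho0) ?sqrtr_ge0.
have kR : 19 / 20 * n%:R <= (n - (r + r + (r + r)))%:R :> R.
  rewrite natrB//; apply: outer_size.
  by rewrite -natrM ler_nat; move: rn; clear; lia.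
have hi0 : 0 <= 11 / 19 * rho * S n + 3 * (rho / 400 * S n).
  exact: addr_ge0 lo0 (mulr_ge0 (ler0n _ 3) (ltW gS0)).
have t0 : 0 < rho / 400 * S n / 2 by rewrite divr_gt0 ?ltr0n.
have hh0 : 9 / 5 * q * n%:R <=
    2 * (p * (1 - p)) * (n - (r + r + (r + r)))%:R - 4 * (rho / 400 * S n / 2).
  by rewrite qE; exact: outer_large.
(* 5g = 3g from hi = lo + 3g, plus g = 2t, plus g >= 2M. *)
pose s := 11 / 19 * rho * S n + 5 * (rho / 400 * S n).
have hpi (h z : nat) : 9 / 5 * q * n%:R <= h%:R -> (h <= n)%N ->
    `|z%:R - h%:R / 2| <= s -> point_bound R n <= binp 2^-1 h z.
  move=> hh hn hz; apply: hpt => //; apply: le_trans (window_slack5 g2).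
  by rewrite lerD2r.
have hs0 : s <= 9 / 5 * q * n%:R / 2.
  apply: le_trans (window_le5 rS0) _; apply: le_trans rSn _.
  exact: half_le (lexx _).
have hs : 11 / 19 * rho * S n + 3 * (rho / 400 * S n) + 2 * M%:R +
    2 * (rho / 400 * S n / 2) <= s.
  exact: threshold_le Mhi cg.
have pi10 : 0 <= rho / 400 * S n / 2 * point_bound R n.
  by rewrite mulr_ge0 ?(ltW t0) ?point_bound_ge0.
have main := @Gnp_prob_no_exact_le R p hp n r kn r0 _ _ _ _ t0 lo0 hi0 hh0 M
  (e (n - M.+1)) s _ Mn (point_bound_ge0 R n) hpi hs0 hs _ pi10 hrg.
have MC : M%:R <= C * scale R n.
  by apply: le_trans (ltW Mhi); rewrite lerDl ler01.
apply: le_trans (le_trans main (herr r M r160 MC)).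
apply: le_Gnp_prob => // G /andP[hD hmax]; apply/andP; split; last first.
  apply/negP => /(le_max_induced (leq_subr _ _)).
  rewrite -(ler_nat R) => hm; have := le_trans hm hmax.
  rewrite natrB// -(natr1 M) lerD2l lerN2 => h.
  by move: (lt_le_trans Mhi h); rewrite ltxx.
have hd : deviation p e (n - M.+1) = (e (n - M.+1))%:R - p * 'C(n - M.+1, 2)%:R.
  by rewrite /deviation mulrC.
rewrite /surplus -hd.
have kM : (k0 <= n - M.+1)%N.
  rewrite -(ler_nat R) natrB// -(natr1 M).
  exact: rest_large Mhi cn nk0.
have hdv : `|deviation p e (n - M.+1)| <= A * n%:R.
  by apply: le_trans (hdev _ kM) _; rewrite ler_wpM2l// ler_nat leq_subr.
have M0 : 0 <= M%:R :> R by exact: ler0n.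
have c2 : 0 <= ('C(M.+1, 2)%:R : R) <= d / 2 * n%:R / 4.
  rewrite ler0n /= bin2R -(natr1 M) [leRHS]mulrAC.
  by apply: le_trans csq; exact: bin2_le_sqr.
have m2 : M%:R ^+ 2 <= d / 2 * n%:R / 4.
  by rewrite [leRHS]mulrAC; apply: le_trans csq; rewrite lerXn2r// nnegrE (le_trans M0).
apply: (surplus_norm_le hp hD hdv c2 m2).
have sn : scale R n * S n = n%:R.
  by apply: scaleM_sqrt_nln; apply: lt_le_trans L1; exact: ltr01.
apply: le_trans (ler_wpM2r lo0 Mlo).
rewrite [leRHS]mulrBl.
have -> : C * scale R n * (11 / 19 * rho * S n) = 11 / 19 * rho * C * n%:R.
  by rewrite -sn; ring.
exact: budget_le bS.
Qed.

Lemma near_no_exact (A B C eps : R) : 0 <= A -> 0 <= B -> 0 < C ->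
  A + B < 11 / 19 * Num.sqrt (p * (1 - p)) * C ->
  (\forall k \near \oo, `|deviation p e k| <= A * k%:R) -> 0 < eps ->
  \forall n \near \oo, Gnp_prob p (fun G : graph n =>
    (`|#|G|%:R - p * 'C(n, 2)%:R| <= B * n%:R) &&
    ((max_induced e G)%:R <= n%:R - C * scale R n)) <= eps.
Proof.
have q0 : 0 < p * (1 - p) by case/andP: hp => p0 p1; rewrite mulr_gt0// subr_gt0.
apply: (@near_no_exact_rho (p * (1 - p))) => //; first by rewrite sqrtr_gt0.
by rewrite sqr_sqrtr ?(ltW q0).
Qed.
End near_exact.

Lemma deviation_le (R : realType) (x y i b d : R) :
  `|x| <= y -> 0 <= i <= d -> 0 <= b <= d -> `|x - i + b| <= y + d.
Proof.
rewrite !ler_norml => /andP[h1 h2] /andP[h3 h4] /andP[h5 h6].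
by apply/andP; split; lra.
Qed.

Lemma half_lt (R : realType) (n : R) : 0 < n -> n / 2 < n.
Proof. by lra. Qed.

Lemma half_sub_le (R : realType) (m n k : R) :
  m <= n / 2 -> 2 * k <= n -> k <= n - m.
Proof. by lra. Qed.

Lemma excess_budget (R : realType) (x y z N d : R) :
  0 < d * N -> x <= z * N -> y < d * N -> x + y + d * N <= (z + 3 * d) * N.
Proof. by lra. Qed.

(** * Upper bound on X_n *)

Section upper_bound.
Variables (R : realType) (p : R).
Hypothesis hp : 0 < p < 1.
Variable e : nat -> nat.
Local Notation S := (sqrt_nln R).
Local Notation a := (22 / 19 * Num.sqrt (p * (1 - p))).

Lemma edges_sub_deviation n (G : graph n) (U : {set 'I_n}) :
  #|induced_edges G (~: U)| = e (n - #|U|) ->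
  #|G|%:R - p * 'C(n, 2)%:R - deviation p e (n - #|U|) =
  \sum_(u in U) ((deg G u)%:R - p * n.-1%:R) - #|induced_edges G U|%:R +
  p * 'C(#|U|, 2)%:R.
Proof.
move=> hU; have mn : (#|U| <= n)%N by rewrite -[X in (_ <= X)%N](card_ord n) max_card.
have h1 : (e (n - #|U|))%:R + \sum_(u in U) (deg G u)%:R =
    #|G|%:R + #|induced_edges G U|%:R :> R.
  by rewrite -hU -natr_sum -!natrD (induced_compl G U).
have h2 : 'C(n, 2)%:R + 'C(#|U|, 2)%:R =
    'C(n - #|U|, 2)%:R + #|U|%:R * n.-1%:R :> R.
  by rewrite -natrM -!natrD (bin2_compl mn).
rewrite /deviation sumrB sumr_const -[(p * _) *+ _]mulr_natr.
move: h1 h2.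
move: (\sum_(u in U) (deg G u)%:R : R) (#|induced_edges G U|%:R : R) => s i.
move: ('C(n, 2)%:R : R) ('C(#|U|, 2)%:R : R) ('C(n - #|U|, 2)%:R : R) => x y z.
move: (#|G|%:R : R) ((e (n - #|U|))%:R : R) (#|U|%:R : R) (n.-1%:R : R) => g f m c.
move=> h1 h2; have -> : x = z + m * c - y by rewrite -h2 addrK.
have -> : s = g + i - f by rewrite -h1 addrC addKr.
by ring.
Qed.

(** Removing m <= c [scale] vertices shifts the edge count by less than (a c + d) n through degrees,
    and by O(m^2) = o(n) through the edges inside the removed set. Everything random is in the
    hypotheses on G. *)
Lemma near_max_induced_lt (c d : R) : 0 < c -> 0 < d ->
  \forall n \near \oo, forall G : graph n,
    excess p (a * S n) G < d * n%:R ->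
    (forall m : nat, m%:R <= c * scale R n ->
      (a * c + 3 * d) * n%:R <
        `|#|G|%:R - p * 'C(n, 2)%:R - deviation p e (n - m)|) ->
    (max_induced e G)%:R < n%:R - c * scale R n.
Proof.
case/andP: (hp) => p0 p1 c0 d0.
have a0 : 0 <= a by rewrite mulr_ge0 ?sqrtr_ge0// divr_ge0 ?ler0n.
have H1 : \forall n \near \oo, c * scale R n <= n%:R / 2.
  have k0 : 0 < c^-1 / 2 by rewrite divr_gt0 ?invr_gt0 ?ltr0n.
  apply: filterS (near_scale_le k0) => n h.
  apply: le_trans (ler_wpM2l (ltW c0) h) _.
  by rewrite !mulrA divff ?gt_eqF// mul1r mulrC.
have H2 : \forall n \near \oo, (c * scale R n) ^+ 2 <= d * n%:R.
  have k0 : 0 < d / c ^+ 2 by rewrite divr_gt0 ?exprn_gt0.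
  apply: filterS (near_scale_sqr_le k0) => n h.
  by rewrite exprMn mulrC -ler_pdivlMr ?exprn_gt0// mulrAC.
apply: filterS (filterI H1 (filterI H2 (filterI (near_ln_ge (1 : R))
  (nbhs_infty_ger (1 : R))))).
move=> n [cn [csq [L1 n1]]] G exG hG.
have n0 : 0 < n%:R :> R by apply: lt_le_trans n1; exact: ltr01.
pose Q (k : nat) := k%:R < n%:R - c * scale R n.
(* Takes care of the value 0 of the maximum when no k qualifies. *)
have Q0 : Q 0%N by rewrite /Q subr_gt0; apply: le_lt_trans cn _; exact: half_lt.
rewrite -/(Q _) /max_induced.
apply: (big_ind Q) => //.
  by move=> x y Qx Qy; rewrite /maxn; case: ifP.
move=> [k kn] /= /fintype.existsP[V /andP[/eqP cV /eqP iV]].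
rewrite /Q ltNge; apply/negP => hk.
pose m := (n - k)%N.
have km : (n - m = k)%N by rewrite /m subKn.
have cU : #|~: V| = m by rewrite cardsCs finset.setCK card_ord cV.
have mR : m%:R <= c * scale R n.
  by rewrite /m natrB// lerBlDr -lerBlDl.
have := hG m mR; rewrite ltNge => /negP; apply.
have := @edges_sub_deviation n G (~: V); rewrite cU finset.setCK km => ->//.
have hm2 : m%:R ^+ 2 <= d * n%:R.
  apply: le_trans csq; rewrite lerXn2r// nnegrE ?ler0n//.
  by apply: le_trans mR; exact: ler0n.
have hs := deg_sum_excess p (a * S n) G (~: V).
have i2 : 0 <= (#|induced_edges G (~: V)|%:R : R) <= d * n%:R.
  rewrite ler0n /=; apply: le_trans hm2.
  by rewrite -natrX ler_nat -cU induced_le_sqr.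
have b2 : 0 <= p * 'C(m, 2)%:R <= d * n%:R.
  rewrite mulr_ge0 ?(ltW p0) ?ler0n //=; apply: le_trans hm2.
  apply: (@le_trans _ _ 'C(m, 2)%:R); first by rewrite ler_piMl ?ler0n ?(ltW p1).
  by rewrite -natrX ler_nat bin2_le_expn.
apply: le_trans (deviation_le hs i2 b2) _.
have h1 : #|~: V|%:R * (a * S n) <= a * c * n%:R.
  rewrite cU; apply: (@le_trans _ _ (c * scale R n * (a * S n))).
    by rewrite ler_wpM2r// mulr_ge0// sqrtr_ge0.
  have sn : scale R n * S n = n%:R.
    by apply: scaleM_sqrt_nln; apply: lt_le_trans L1; exact: ltr01.
  by rewrite le_eqVlt; apply/orP; left; apply/eqP; rewrite -[in RHS]sn; ring.
exact: excess_budget (mulr_gt0 d0 n0) h1 exG.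
Qed.

Lemma near_deviation_le (A c : R) : 0 <= A -> 0 < c ->
  (\forall k \near \oo, `|deviation p e k| <= A * k%:R) ->
  \forall n \near \oo, forall m : nat, m%:R <= c * scale R n ->
    `|deviation p e (n - m)| <= A * n%:R.
Proof.
move=> A0 c0 [k0 _ hdev].
have k1 : 0 < c^-1 / 2 by rewrite divr_gt0 ?invr_gt0 ?ltr0n.
apply: filterS (filterI (near_scale_le k1) (nbhs_infty_ger (2 * k0%:R : R))) => n [h1 h2] m hm.
apply: le_trans (hdev (n - m)%N _) _; last first.
  by rewrite ler_wpM2l// ler_nat leq_subr.
have mn2 : m%:R <= n%:R / 2 :> R.
  apply: le_trans hm _; apply: le_trans (ler_wpM2l (ltW c0) h1) _.
  by rewrite !mulrA divff ?gt_eqF// mul1r mulrC.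
have mn : (m <= n)%N.
  rewrite -(ler_nat R); apply: le_trans mn2 _.
  by rewrite ler_pdivrMr ?ltr0n// ler_peMr ?ler0n// ler1n.
rewrite /= -(ler_nat R) natrB//.
exact: half_sub_le mn2 h2.
Qed.
End upper_bound.

Lemma window_prob01 (R : realType) (p : R) (e : nat -> nat) (c C : R) n :
  0 < p < 1 -> 0 <= window_prob p e c C n <= 1.
Proof. by move=> hp; rewrite Gnp_prob_ge0// Gnp_prob_le1. Qed.

Lemma bigO_deviation (R : realType) (p : R) (e : nat -> nat) :
  deviation p e =O_\oo (fun k => k%:R : R) ->
  exists2 A : R, 0 < A & \forall k \near \oo, `|deviation p e k| <= A * k%:R.
Proof.
move/eqOP => [M [_ hM]].
exists (Num.max M 0 + 1).
  by rewrite ltr_pwDr// le_max lexx orbT.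
have lt : M < Num.max M 0 + 1 by rewrite ltr_pwDr// le_max lexx.
by apply: filterS (hM _ lt) => k; rewrite (ger0_norm (ler0n _ k)).
Qed.

(** Passes from sequences to uniformity in m: for each n choose a violating m if there is one, and 0
    otherwise. The chosen sequence is O([scale]), so smoothness along it rules out violations for
    large n. *)
Lemma near_deviation_smooth (R : realType) (p : R) (e : nat -> nat) :
  (forall m : nat -> nat,
      (fun k => (m k)%:R : R) =O_\oo scale R ->
      (fun k => `|deviation p e k - deviation p e (k - m k)|) =o_\oo
        (fun k => k%:R : R)) ->
  forall c d : R, 0 < c -> 0 < d ->
  \forall n \near \oo, forall m : nat, m%:R <= c * scale R n ->
    `|deviation p e n - deviation p e (n - m)| <= d * n%:R.
Proof.
move=> sm c d c0 d0.
pose bad n m := m%:R <= c * scale R n /\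
  ~ `|deviation p e n - deviation p e (n - m)| <= d * n%:R.
have ex n : exists m : nat, m%:R <= c * scale R n /\ ((exists m', bad n m') -> bad n m).
  case: (pselect (exists m', bad n m')) => [[m' hm']|nb].
    by exists m'; split=> //; case: hm'.
  by exists 0%N; split=> //; rewrite mulr_ge0 ?scale_ge0 ?(ltW c0).
have [m hm] := choice ex.
have mO : (fun k => (m k)%:R : R) =O_\oo scale R.
  apply/eqOP; near=> K; near=> k.
  have [h _] := hm k; rewrite !ger0_norm ?scale_ge0//; apply: le_trans h _.
  by rewrite ler_wpM2r ?scale_ge0//; near: K; exact: nbhs_pinfty_ge.
have := sm m mO => /eqoP/(_ d d0); apply: filterS => n hn m' hm'.
apply: contrapT => nb; have [_ /(_ (ex_intro _ m' (conj hm' nb)))[_]] := hm n.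
by apply; move: hn; rewrite normr_id (ger0_norm (ler0n _ n)).
Unshelve. all: by end_near.
Qed.

Lemma window_above (R : realType) (A u n D v : R) :
  `|v| <= A * n -> (A + u + 3) * n < D -> (u + 3 * 1) * n < `|D - v|.
Proof.
by have := ler_norm (D - v); rewrite ler_norml => h /andP[h1 h2] h3; lra.
Qed.

Lemma window_far (R : realType) (n D v w y : R) :
  y * n < `|D - v| -> `|v - w| <= y / 8 * n -> 0 < y * n ->
  (y / 4 + 3 * (y / 8)) * n < `|D - w|.
Proof.
move=> h1 h2 h3; have : `|D - v| <= `|D - w| + `|v - w|.
  by rewrite -[`|v - w|]normrN opprB; apply: le_trans (ler_normD _ _); rewrite addrA subrK.
by move: h1 h2 h3; move: (`|D - v|) (`|D - w|) (`|v - w|) => u1 u2 u3; lra.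
Qed.

(** * Bounds for the probability of the window *)

Section probability_bounds.
Variables (R : realType) (p : R).
Hypothesis hp : 0 < p < 1.
Variables (e : nat -> nat) (A : R).
Hypothesis A0 : 0 < A.
Hypothesis hdev : \forall k \near \oo, `|deviation p e k| <= A * k%:R.
Local Notation S := (sqrt_nln R).
Local Notation rho := (Num.sqrt (p * (1 - p))).
Local Notation a := (22 / 19 * rho).
Local Notation b := (11 / 19 * rho).

Let rho0 : 0 < rho.
Proof. by case/andP: hp => p0 p1; rewrite sqrtr_gt0 mulr_gt0// subr_gt0. Qed.

(** Work on the event that D/n lies between x and x + 1. The choice of x makes c [scale] removals
    insufficient, and A + (x + 1) < b C makes fewer than C [scale] suffice. The two exceptional
    events take at most half of its probability. *)
Lemma near_window_prob_ge (c C : R) : 0 < c -> 0 < C ->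
  2 * A + a * c + 4 < b * C ->
  exists2 l : R, 0 < l & \forall n \near \oo, l <= window_prob p e c C n.
Proof.
move=> c0 C0 hC.
have ac0 : 0 <= a * c by rewrite !mulr_ge0 ?divr_ge0 ?ler0n ?(ltW rho0) ?(ltW c0).
pose x : R := A + a * c + 3.
have x0 : 0 <= x by rewrite /x !addr_ge0 ?ler0n ?(ltW A0).
have [c1 c10 W] := near_prob_edges_window hp x0.
have c4 : 0 < c1 / 4 by rewrite divr_gt0 ?ltr0n.
have x10 : 0 <= x + 1 by rewrite addr_ge0 ?ler01.
have AB : A + (x + 1) < b * C.
  by rewrite /x; move: hC; move: (b * C) (a * c) => u v; lra.
have NE := near_no_exact hp (ltW A0) x10 C0 AB hdev c4.
have EX := near_prob_excess hp (ltr01 : 0 < 1 :> R) c4.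
have UP := near_max_induced_lt hp e c0 (ltr01 : 0 < 1 :> R).
have DV := near_deviation_le (ltW A0) c0 hdev.
exists (c1 / 2); first by rewrite divr_gt0 ?ltr0n.
apply: filterS (filterI W (filterI NE (filterI EX (filterI UP (filterI DV
  (nbhs_infty_gt 0)))))) => n [w [ne [ex [up [dv n0]]]]].
have nR : 0 < n%:R :> R by rewrite ltr0n.
have u1 := @Gnp_prob_union R p hp n
  (fun G => x * n%:R < #|G|%:R - p * 'C(n, 2)%:R < (x + 1) * n%:R)
  (fun G => n%:R - C * scale R n < (max_induced e G)%:R < n%:R - c * scale R n)
  (fun G => (1 * n%:R <= excess p (a * S n) G) ||
    ((`|#|G|%:R - p * 'C(n, 2)%:R| <= (x + 1) * n%:R) &&
     ((max_induced e G)%:R <= n%:R - C * scale R n))).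
have u2 := @Gnp_prob_union R p hp n _
  (fun G => 1 * n%:R <= excess p (a * S n) G)
  (fun G => (`|#|G|%:R - p * 'C(n, 2)%:R| <= (x + 1) * n%:R) &&
     ((max_induced e G)%:R <= n%:R - C * scale R n)) (fun G h => h).
have /u1 {}u1 : forall G : graph n,
  x * n%:R < #|G|%:R - p * 'C(n, 2)%:R < (x + 1) * n%:R ->
  (n%:R - C * scale R n < (max_induced e G)%:R < n%:R - c * scale R n) ||
  ((1 * n%:R <= excess p (a * S n) G) ||
    ((`|#|G|%:R - p * 'C(n, 2)%:R| <= (x + 1) * n%:R) &&
     ((max_induced e G)%:R <= n%:R - C * scale R n))).
  move=> G /andP[D1 D2]; case: (lerP (1 * n%:R) (excess _ _ _)) => [_|exG].
    by rewrite orbT.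
  have D0 : 0 <= #|G|%:R - p * 'C(n, 2)%:R.
    by apply: le_trans (ltW D1); rewrite mulr_ge0 ?(ltW nR).
  rewrite (ger0_norm D0) (ltW D2) /=.
  case: (lerP (max_induced e G)%:R (n%:R - C * scale R n)) => [_|_].
    by rewrite orbT.
  rewrite orbF /=; apply: up => // m hm.
  exact: window_above (dv m hm) D1.
move: u1 u2 w ne ex; rewrite /window_prob; move: (Gnp_prob _ _) (Gnp_prob _ _).
move: (Gnp_prob _ _) (Gnp_prob _ _) (Gnp_prob _ _) => z1 z2 z3 z4 z5; lra.
Qed.

(** With probability bounded away from 0, D is so large that not even C [scale] removals suffice,
    and the lower end of the window is missed. *)
Lemma near_window_prob_le (c C : R) : 0 < C ->
  exists2 l : R, l < 1 & \forall n \near \oo, window_prob p e c C n <= l.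
Proof.
move=> C0.
have aC0 : 0 <= a * C by rewrite !mulr_ge0 ?divr_ge0 ?ler0n ?(ltW rho0) ?(ltW C0).
pose x : R := A + a * C + 3.
have x0 : 0 <= x by rewrite /x !addr_ge0 ?ler0n ?(ltW A0).
have [c1 c10 W] := near_prob_edges_window hp x0.
have c4 : 0 < c1 / 4 by rewrite divr_gt0 ?ltr0n.
have EX := near_prob_excess hp (ltr01 : 0 < 1 :> R) c4.
have UP := near_max_induced_lt hp e C0 (ltr01 : 0 < 1 :> R).
have DV := near_deviation_le (ltW A0) C0 hdev.
exists (1 - c1 / 2); first by rewrite ltrBlDr ltrDl divr_gt0 ?ltr0n.
apply: filterS (filterI W (filterI EX (filterI UP DV))) => n [w [ex [up dv]]].
have := @Gnp_prob_union R p hp n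
  (fun G => x * n%:R < #|G|%:R - p * 'C(n, 2)%:R < (x + 1) * n%:R)
  (fun G => ~~ (n%:R - C * scale R n < (max_induced e G)%:R < n%:R - c * scale R n))
  (fun G => 1 * n%:R <= excess p (a * S n) G).
rewrite Gnp_probC// => u1.
suff /u1 : forall G : graph n,
  x * n%:R < #|G|%:R - p * 'C(n, 2)%:R < (x + 1) * n%:R ->
  ~~ (n%:R - C * scale R n < (max_induced e G)%:R < n%:R - c * scale R n) ||
  (1 * n%:R <= excess p (a * S n) G).
  move: w ex; rewrite /window_prob; move: (Gnp_prob _ _) (Gnp_prob _ _) (Gnp_prob _ _).
  by move=> z1 z2 z3; lra.
move=> G /andP[D1 D2]; case: (lerP (1 * n%:R) (excess _ _ _)) => [_|exG].
  by rewrite orbT.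
rewrite orbF; apply/negP => /andP[+ _]; rewrite ltNge => /negP; apply; apply: ltW.
by apply: up => // m hm; exact: window_above (dv m hm) D1.
Qed.

(** Smoothness freezes the target at dev(n), so the single event |D - dev(n)| > y n excludes all m
    <= c [scale] at once. Four bad events of probability at most eps/8 each are discarded. *)
Lemma near_window_prob_smooth :
  (forall c d : R, 0 < c -> 0 < d ->
    \forall n \near \oo, forall m : nat, m%:R <= c * scale R n ->
      `|deviation p e n - deviation p e (n - m)| <= d * n%:R) ->
  forall eps : R, 0 < eps -> exists c C : R, [/\ 0 < c, 0 < C &
    \forall n \near \oo, 1 - eps / 2 <= window_prob p e c C n].
Proof.
move=> sm eps eps0.
have e8 : 0 < eps / 8 by rewrite divr_gt0 ?ltr0n.
have [K K0 AC] := near_prob_edges_near hp.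
pose y := eps / 8 / K.
have y0 : 0 < y by rewrite /y divr_gt0.
have y8 : 0 < y / 8 by rewrite divr_gt0 ?ltr0n.
have a0 : 0 < a by rewrite mulr_gt0 ?divr_gt0 ?ltr0n.
have b0 : 0 < b by rewrite mulr_gt0 ?divr_gt0 ?ltr0n.
(* Now a c + 3 (y/8) = 5y/8, less than the distance 7y/8 that remains after the target has drifted
   by y/8. *)
pose c := y / 4 / a.
have c0 : 0 < c by rewrite /c divr_gt0// divr_gt0 ?ltr0n.
have acE : a * c = y / 4 by rewrite /c mulrC divfK ?gt_eqF.
(* Chebyshev's bound 1/B^2 for |D| >= B n has to be at most eps/8. *)
pose B := 8 / eps + 1.
have B0 : 0 < B by rewrite /B addr_gt0 ?ltr01// divr_gt0 ?ltr0n.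
pose C := (A + B + 1) / b.
have C0 : 0 < C := divr_gt0 (addr_gt0 (addr_gt0 A0 B0) ltr01) b0.
have AB : A + B < b * C by rewrite /C [ltRHS]mulrC divfK ?gt_eqF// ltrDl ltr01.
have far : (B ^+ 2)^-1 <= eps / 8.
  rewrite -[leRHS]invrK lef_pV2 ?posrE ?invr_gt0 ?exprn_gt0// invf_div.
  have h8 : 0 < 8 / eps by rewrite divr_gt0 ?ltr0n.
  by rewrite /B; move: h8; move: (8 / eps) => z z0; nra.
have NE := near_no_exact hp (ltW A0) (ltW B0) C0 AB hdev e8.
have EX := near_prob_excess hp y8 e8.
have UP := near_max_induced_lt hp e c0 y8.
have SM := sm c (y / 8) c0 y8.
exists c, C; split=> //.
apply: filterS (filterI (AC y y0) (filterI NE (filterI EX (filterI UP (filterI SM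
  (nbhs_infty_gt 0)))))) => n [ac [ne [ex [up [dv n0]]]]].
have nR : 0 < n%:R :> R by rewrite ltr0n.
have fr := le_trans (Gnp_prob_edges_far hp B0 n0) far.
have {}ac : Gnp_prob p (fun G : graph n =>
   `|#|G|%:R - p * 'C(n, 2)%:R - deviation p e n| <= y * n%:R) <= eps / 8.
  by apply: le_trans (ac _) _; rewrite /y mulrC divfK ?gt_eqF.
pose E1 (G : graph n) := `|#|G|%:R - p * 'C(n, 2)%:R - deviation p e n| <= y * n%:R.
pose E2 (G : graph n) := B * n%:R <= `|#|G|%:R - p * 'C(n, 2)%:R|.
pose E3 (G : graph n) := y / 8 * n%:R <= excess p (a * S n) G.
pose E4 (G : graph n) := (`|#|G|%:R - p * 'C(n, 2)%:R| <= B * n%:R) &&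
   ((max_induced e G)%:R <= n%:R - C * scale R n).
pose W (G : graph n) := n%:R - C * scale R n < (max_induced e G)%:R < n%:R - c * scale R n.
have cover (G : graph n) : ~~ W G -> [|| E1 G, E2 G, E3 G | E4 G].
  apply: contraNT; rewrite !negb_or /E1 /E2 /E3 -!ltNge => /and4P[h1 h2 h3 h4].
  rewrite /W ltNge; apply/andP; split.
    by apply: contra h4 => h4; rewrite /E4 (ltW h2).
  apply: up => // m hm; rewrite acE.
  by apply: window_far h1 (dv m hm) _; rewrite mulr_gt0.
have u1 := Gnp_prob_union hp cover.
have u2 := @Gnp_prob_union R p hp n _ E2 (fun G => E3 G || E4 G) (fun G h => h).
have u3 := @Gnp_prob_union R p hp n _ E3 E4 (fun G h => h).
rewrite (Gnp_probC p W) in u1.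
move: u1 u2 u3 ac fr ex ne; rewrite /window_prob -/W -/E1 -/E2 -/E3 -/E4.
move: (Gnp_prob p W) (Gnp_prob p E1) (Gnp_prob p E2) (Gnp_prob p E3) (Gnp_prob p E4).
by move: (Gnp_prob _ _) (Gnp_prob _ _) => z1 z2 z3 z4 z5 z6 z7; lra.
Qed.
End probability_bounds.

Theorem theorem1 (R : realType) (p : R) (e : nat -> nat)
    (hp : 0 < p < 1)
    (he : deviation p e =O_\oo (fun k => k%:R : R)) :
  (exists t : R, 0 < t /\
     forall c C : R, t < c -> 2 * c + t < C ->
       [/\ 0 < limn_inf (window_prob p e c C),
           limn_inf (window_prob p e c C) <= limn_sup (window_prob p e c C) &
           limn_sup (window_prob p e c C) < 1]) /\
  ((forall m : nat -> nat,
      (fun k => (m k)%:R : R) =O_\oo scale R ->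
      (fun k => `|deviation p e k - deviation p e (k - m k)|) =o_\oo
        (fun k => k%:R : R)) ->
   forall eps : R, 0 < eps ->
     exists c C : R, [/\ 0 < c, 0 < C &
       1 - eps < limn_inf (window_prob p e c C)]).
Proof.
have [A A0 hdev] := bigO_deviation he.
have rho0 : 0 < Num.sqrt (p * (1 - p)).
  by case/andP: hp => p0 p1; rewrite sqrtr_gt0 mulr_gt0// subr_gt0.
have b0 : 0 < 11 / 19 * Num.sqrt (p * (1 - p)) by rewrite mulr_gt0 ?divr_gt0 ?ltr0n.
have bnd c C n := window_prob01 e c C n hp.
split.
  (* As a = 2b, the condition 2A + a c + 4 < b C of [near_window_prob_ge] reads 2c + (2A + 4)/b <
     C. *)
  exists ((2 * A + 4) / (11 / 19 * Num.sqrt (p * (1 - p)))); split.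
    by rewrite divr_gt0// addr_gt0 ?mulr_gt0 ?ltr0n.
  set b := 11 / 19 * Num.sqrt (p * (1 - p)) in b0 *.
  set t := _ / b => c C tc hC.
  have t0 : 0 < t by rewrite /t divr_gt0// addr_gt0 ?mulr_gt0 ?ltr0n.
  have c0 : 0 < c := lt_trans t0 tc.
  have C0 : 0 < C by apply: lt_trans hC; rewrite addr_gt0// mulr_gt0 ?ltr0n.
  have hb : 2 * A + 22 / 19 * Num.sqrt (p * (1 - p)) * c + 4 < b * C.
    have -> : 2 * A + 22 / 19 * Num.sqrt (p * (1 - p)) * c + 4 = b * (2 * c + t).
      by rewrite [RHS]mulrDr [b * t]mulrC /t divfK ?gt_eqF// /b; field.
    by rewrite ltr_pM2l.
  have [l l0 hl] := near_window_prob_ge hp A0 hdev c0 C0 hb.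
  have [l' l1 hl'] := near_window_prob_le hp A0 hdev c C0.
  split; first exact: lt_le_trans l0 (limn_inf_ge (bnd c C) hl).
    exact: limn_inf_le_sup (bnd c C).
  exact: le_lt_trans (limn_sup_le (bnd c C) hl') l1.
move=> sm eps eps0.
have [c [C [c0 C0 hw]]] :=
  near_window_prob_smooth hp A0 hdev (near_deviation_smooth sm) eps0.
exists c, C; split=> //; apply: lt_le_trans (limn_inf_ge (bnd c C) hw).
by rewrite ltrD2l ltrN2 ltr_pdivrMr ?ltr0n// ltr_pMr// ltr1n.
Qed.
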